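(* Let $G$ be a connected reductive algebraic group over $\mathbb{C}$, $T\subset B\subset G$ a maximal torus and a Borel subgroup, and let $S\subset T$ be a subgroup (not necessarily connected). Let $X_B=G/B$ and let $X_B^S$ be the fixed subvariety under left multiplication by $S$. Then each connected component of $X_B^S$ is isomorphic, as a $(G^S)^o$-variety, with $(G^S)^o/B^S$. In particular, each connected component of $X_B^S$ is of the same dimension.
   Context: $G^S$ and $B^S$ denote the fixed subgroups of $G$ and $B$ under the conjugation action of $S$, and $(G^S)^o$ is the identity component of $G^S$; $B^S$ is a Borel subgroup of $(G^S)^o$. *)

(* Defs.v *)
From HB Require Import structures.
(* The notations of mpoly are incompatible with those of the topology files. *)
From mathcomp Require Import -(notations) mpoly.
From mathcomp Require Import all_boot all_order all_algebra.
From mathcomp Require Import all_classical all_reals ereal topology.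
From mathcomp.real_closed Require Export complex.

Set Implicit Arguments.
Unset Strict Implicit.
Unset Printing Implicit Defensive.

Import Order.TTheory GRing.Theory Num.Theory.

Local Open Scope classical_set_scope.
Local Open Scope quotient_scope.
Local Open Scope ring_scope.

(* An alias of 'M[K]_n carrying the Zariski topology; over a normed field
   'M[K]_n itself already carries another topology. *)
Definition zmat (K : fieldType) (n : nat) : Type := 'M[K]_n.

Section Zariski.
Context {K : fieldType} {n : nat}.

HB.instance Definition _ := Choice.copy (zmat K n) 'M[K]_n.

Definition mxeval (x : zmat K n) (p : mpoly (n * n) K) : K :=
  meval (fun k => mxvec (x : 'M[K]_n) 0 k) p.

Definition zero_locus (P : set (mpoly (n * n) K)) :
    set (zmat K n) :=
  [set x | forall p, P p -> mxeval x p = 0].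

Definition zariski_open (U : set (zmat K n)) :=
  exists P, U = ~` zero_locus P.

Lemma zariski_openT : zariski_open setT.
Proof.
exists [set mpolyC (n * n) 1]; rewrite -setC0; congr (~` _).
apply/seteqP; split => // x /(_ _ erefl) /eqP.
by rewrite /mxeval mevalC oner_eq0.
Qed.

Lemma zariski_openI : setI_closed zariski_open.
Proof.
move=> _ _ [P ->] [Q ->].
exists [set r | exists p q, [/\ P p, Q q & r = p * q]].
rewrite -setCU; congr (~` _); apply/seteqP; split => x.
  move=> zx _ [p [q [Pp Qq ->]]].
  rewrite /mxeval; have -> := mevalM (fun k => mxvec (x : 'M_n) 0 k) p q.
  by case: zx => [/(_ p Pp)|/(_ q Qq)]; rewrite /mxeval => ->; rewrite ?mul0r ?mulr0.
move=> zx; have [|/existsNP[p /not_implyP[Pp /eqP px]]] := pselect (zero_locus P x).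
  by left.
right => q Qq; have := zx _ (ex_intro _ p (ex_intro _ q (And3 Pp Qq erefl))).
rewrite /mxeval; have -> := mevalM (fun k => mxvec (x : 'M_n) 0 k) p q.
by move/eqP; rewrite mulf_eq0 (negbTE px) => /eqP.
Qed.

Lemma zariski_open_bigU (J : Type) (f : J -> set (zmat K n)) :
  (forall i, zariski_open (f i)) -> zariski_open (\bigcup_i f i).
Proof.
move=> /choice[P fP]; exists (\bigcup_i P i).
rewrite -[LHS]setCK; congr (~` _); rewrite setC_bigcup.
apply/seteqP; split => x zx.
  by move=> p [i _ Pp]; have := zx i I; rewrite fP setCK; apply.
by move=> i _; rewrite fP setCK => p Pp; apply: zx; exists i.
Qed.

HB.instance Definition _ := @isOpenTopological.Build (zmat K n) zariski_open
  zariski_openT zariski_openI zariski_open_bigU.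

End Zariski.

(* A space with functions: a topological space together with, for each open U,
   the K-valued functions that are regular on U; only the values of f on U
   matter in fs_regular U f. Varieties (reduced, over an algebraically closed
   field) are identified with their spaces with functions. *)
Record fspace (K : fieldType) := FSpace {
  fs_space :> topologicalType ;
  fs_regular : set fs_space -> (fs_space -> K) -> Prop }.

Section FSpace.
Context {K : fieldType}.

Definition fs_morphism (X Y : fspace K) (phi : X -> Y) : Prop :=
  continuous phi /\
  forall (V : set Y) (f : Y -> K), open V -> fs_regular V f ->
    fs_regular (phi @^-1` V) (f \o phi).

Definition fs_isomorphism (X Y : fspace K) (phi : X -> Y) : Prop :=
  fs_morphism phi /\
  exists psi : Y -> X, [/\ cancel phi psi, cancel psi phi & fs_morphism psi].

(* Affine space of matrices: locally, quotients of polynomials. *)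
Definition affine_regular (n : nat) (U : set (zmat K n)) (f : zmat K n -> K) :=
  forall x, U x -> exists p q, mxeval x q != 0 /\
    \forall y \near x, f y = mxeval y p / mxeval y q.

Definition affine_fspace (n : nat) : fspace K :=
  @FSpace K (zmat K n) (@affine_regular n).

(* Structure induced on a subset: locally, restrictions of regular functions. *)
Definition sub_regular (X : fspace K) (A : set X) (V : set A) (f : A -> K) :=
  forall x : A, V x -> exists (U : set X) (h : X -> K),
    [/\ open U, U (val x), fs_regular U h &
        forall y : A, V y -> U (val y) -> f y = h (val y)].

Definition sub_fspace (X : fspace K) (A : set X) : fspace K :=
  @FSpace K (A : Type) (@sub_regular X A).

(* Structure on a quotient: functions whose pullback is regular. *)
Definition quot_regular (X : fspace K) (Q : quotType X)
    (U : set (quotient_topology Q)) (f : quotient_topology Q -> K) :=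
  fs_regular (\pi_(quotient_topology Q) @^-1` U)
             (f \o \pi_(quotient_topology Q)).

Definition quot_fspace (X : fspace K) (Q : quotType X) : fspace K :=
  @FSpace K (quotient_topology Q) (@quot_regular X Q).

End FSpace.

Section Topology.
Context {X : topologicalType}.

Definition is_component (A C : set X) : Prop :=
  exists2 x, A x & C = connected_component A x.

Definition irreducible_set (F : set X) : Prop :=
  F !=set0 /\ forall A B : set X, closed A -> closed B ->
    F `<=` A `|` B -> F `<=` A \/ F `<=` B.

End Topology.

(* Krull dimension: supremum of the lengths k of chains F_0 < ... < F_k of
   irreducible closed subsets. *)
Definition krull_dim (R : realType) (X : topologicalType) : \bar R :=
  ereal_sup [set k%:R%:E | k in [set k : nat |
    exists F : nat -> set X,
      (forall i, (i <= k)%N -> closed (F i) /\ irreducible_set (F i)) /\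
      (forall i, (i < k)%N -> F i `<` F i.+1)]].

Section Groups.
Context {K : fieldType}.
Implicit Types n r : nat.

Definition matrix_subgroup n (H : set (zmat K n)) : Prop :=
  [/\ H `<=` [set x | x \in unitmx],
      H 1%:M,
      forall x y, H x -> H y -> H (x *m y) &
      forall x, H x -> H (invmx x)].

(* A linear algebraic group is a Zariski closed subgroup of some GL_n. *)
Definition algebraic_group n (G : set (zmat K n)) : Prop :=
  matrix_subgroup G /\
  exists2 Z : set (zmat K n), closed Z & G = Z `&` [set x | x \in unitmx].

Definition group_fspace n (G : set (zmat K n)) : fspace K :=
  sub_fspace (G : set (affine_fspace n)).

Definition algebraic_isomorphism n r (G : set (zmat K n)) (H : set (zmat K r))
    (phi : group_fspace G -> group_fspace H) : Prop :=
  fs_isomorphism phi /\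
  forall x y z, val z = val x *m val y -> val (phi z) = val (phi x) *m val (phi y).

Definition normal_in n (G U : set (zmat K n)) : Prop :=
  U `<=` G /\ forall g u, G g -> U u -> U (g *m u *m invmx g).

Definition commutators n (H : set (zmat K n)) : set (zmat K n) :=
  [set c | exists x y, [/\ H x, H y & c = x *m y *m invmx x *m invmx y]].

Definition derived n (H : set (zmat K n)) : set (zmat K n) :=
  smallest (@matrix_subgroup n) (commutators H).

Definition solvable_group n (H : set (zmat K n)) : Prop :=
  exists k, iter k (@derived n) H = [set 1%:M].

Definition unipotent n (u : zmat K n) : Prop :=
  exists k, (u - 1%:M : 'M[K]_n) ^+ k = 0.

Definition unipotent_radical n (G : set (zmat K n)) : set (zmat K n) :=
  \bigcup_(U in [set U | [/\ algebraic_group U, connected U, normal_in G U &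
                           forall u, U u -> unipotent u]]) U.

Definition reductive n (G : set (zmat K n)) : Prop :=
  algebraic_group G /\ unipotent_radical G = [set 1%:M].

Definition diagonal_group r : set (zmat K r) :=
  [set x | is_diag_mx x /\ x \in unitmx].

Definition torus n (T : set (zmat K n)) : Prop :=
  algebraic_group T /\
  exists r (phi : group_fspace T -> group_fspace (@diagonal_group r)),
    algebraic_isomorphism phi.

Definition maximal_torus n (G T : set (zmat K n)) : Prop :=
  [/\ torus T, T `<=` G &
      forall T', torus T' -> T' `<=` G -> T `<=` T' -> T' = T].

Definition borel n (G B : set (zmat K n)) : Prop :=
  let connected_solvable H :=
    [/\ algebraic_group H, connected H & solvable_group H] in
  [/\ connected_solvable B, B `<=` G &
      forall B', connected_solvable B' -> B' `<=` G -> B `<=` B' -> B' = B].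

Definition fixed_subgroup n (S H : set (zmat K n)) : set (zmat K n) :=
  [set h | H h /\ forall s, S s -> s *m h *m invmx s = h].

Definition identity_component n (H : set (zmat K n)) : set (zmat K n) :=
  connected_component H (1%:M : 'M[K]_n).

Definition translate n (g : zmat K n) (A : set (zmat K n)) : set (zmat K n) :=
  [set g *m a | a in A].

(* The coset space G/B: two elements of G are identified when their left cosets
   by B agree. *)
Section Homogeneous.
Context {n : nat} (G B : set (zmat K n)).

Definition same_coset (g h : group_fspace G) : bool :=
  `[< translate (val g) B = translate (val h) B >].

Lemma same_coset_refl : reflexive same_coset.
Proof. by move=> g; apply/asboolP. Qed.

Lemma same_coset_sym : symmetric same_coset.
Proof. by move=> g h; apply/asboolP/asboolP. Qed.

Lemma same_coset_trans : transitive same_coset.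
Proof.
by move=> h g k /asboolP gh /asboolP hk; apply/asboolP; rewrite gh.
Qed.

Definition coset_equiv : equiv_rel (group_fspace G) :=
  EquivRel same_coset same_coset_refl same_coset_sym same_coset_trans.

Definition coset_space : fspace K :=
  quot_fspace {eq_quot coset_equiv}.

(* The point gB of G/B, as a set of matrices; g.(hB) is then translate g (hB). *)
Definition coset (x : coset_space) : set (zmat K n) :=
  translate (val (repr (x : quotient_topology {eq_quot coset_equiv}))) B.

Definition fixed_points (S : set (zmat K n)) : set coset_space :=
  [set x | forall s, S s -> translate s (coset x) = coset x].

End Homogeneous.

(* phi is an isomorphism of H-varieties from G1/B1 onto the subset C of G2/B2,
   H acting on both sides by left translation. In particular C is H-stable. *)
Definition equivariant_isomorphism n (H G1 B1 G2 B2 : set (zmat K n))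
    (C : set (coset_space G2 B2))
    (phi : coset_space G1 B1 -> sub_fspace C) : Prop :=
  fs_isomorphism phi /\
  forall h x y, H h -> coset y = translate h (coset x) ->
    coset (val (phi y)) = translate h (coset (val (phi x))).

End Groups.

(* Main.v *)
(** A point gB of X_B is fixed by S when g^-1 S g <= B. Choose a basis in which S
    is diagonal and which refines the flag stabilized by g B g^-1: the order in
    which the characters of S occur is locally constant on X_B^S, and where it is
    constant a unipotent element depending regularly on g straightens S. This
    gives, near each g2, a regular map h into (G^S)^o with gB = h(g) g2 B. Hence
    the (G^S)^o-orbits are open in X_B^S, and they are its components.

    The stabilizer (G^S)^o & g B g^-1 is a Borel subgroup of (G^S)^o: by Borel's
    fixed point theorem, applied to the flags on which S has given characters, a
    larger connected solvable group lies in one of its conjugates. Borel subgroups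
    being conjugate, each component contains a point with stabilizer B^S, and its
    orbit map is a bijection from (G^S)^o / B^S onto the component.

    The map h shows that the inverse of the orbit map is continuous. It is regular
    because a right B-invariant function which is a fraction near g2 extends to an
    invariant regular function on an open subset of G/B: divide out the unipotent
    part of B by an LU decomposition, then replace numerator and denominator by
    their components of a common weight for the diagonal part of B.

    The elements of S commute and are diagonalizable because torsion elements are
    dense in T. *)

From mathcomp Require Import -(notations) mpoly.
Require Import Defs.
From mathcomp Require Import all_boot all_order all_algebra.
From mathcomp Require Import ring closed_field cyclotomic separable mxred.
From mathcomp Require Import all_classical all_reals ereal topology normedtype derive.

Set Implicit Arguments.
Unset Strict Implicit.
Unset Printing Implicit Defensive.

Import Order.TTheory GRing.Theory Num.Theory numFieldNormedType.Exports.

Local Open Scope classical_set_scope.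
Local Open Scope quotient_scope.
Local Open Scope ring_scope.

(** * Function classes and the Zariski topology *)

(** Flag varieties are never formed: a closed set of flags is a subset of [GL], closed there and
    stable under [Bn] on the right. Their completeness enters only through the usual topology of
    [R[i]]: by Gram-Schmidt a coordinate ratio without poles on a closed set of flags is bounded,
    and by quantifier elimination its set of values is finite or cofinite, hence finite. Noetherian
    minimality takes the place of dimension counts.

    Characteristic zero makes integer powers decisive. For unipotent [u] the binomial series is a
    polynomial curve [pw u t] inside every algebraic group containing [u], and the independence of
    the functions [a ^ m * p(m)] separates semisimple from unipotent parts.

    [S] may be infinite and disconnected, so its elements are straightened simultaneously, one entry
    above the diagonal at a time, by ring operations on the entries. Hence the same procedure yields
    both elements of a group and regular maps. It also splits a connected solvable group into
    diagonal and unipotent parts, whence the centralizer of [S] in [B] is connected. *)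

(* Polynomial functions, functions regular at a point and polynomial curves are
   all instances, so that closure properties are proved once. *)
Definition fun_ring (K : fieldType) (X : Type) (P : (X -> K) -> Prop) :=
  [/\ forall c, P (fun=> c), forall f g, P f -> P g -> P (fun x => f x + g x)
    & forall f g, P f -> P g -> P (fun x => f x * g x)].

Definition mx_in (K : fieldType) (X : Type) (P : (X -> K) -> Prop) a b
    (F : X -> 'M[K]_(a, b)) := forall i j, P (fun x => F x i j).

Section FunRing.
Context {K : fieldType} {X : Type} (P : (X -> K) -> Prop).
Hypothesis ringP : fun_ring P.

Lemma frC c : P (fun=> c). Proof. by case: ringP. Qed.
Lemma frD f g : P f -> P g -> P (fun x => f x + g x). Proof. by case: ringP=> _ + _; apply. Qed.
Lemma frM f g : P f -> P g -> P (fun x => f x * g x). Proof. by case: ringP=> _ _; apply. Qed.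
Lemma frN f : P f -> P (fun x => - f x).
Proof. by move=> Pf; under eq_fun do rewrite -mulN1r; exact: (frM (frC _)). Qed.
Lemma frB f g : P f -> P g -> P (fun x => f x - g x).
Proof. by move=> Pf Pg; apply: frD => //; exact: frN. Qed.

Lemma fr_sum I (r : seq I) (Q : pred I) (F : I -> X -> K) :
  (forall i, Q i -> P (F i)) -> P (fun x => \sum_(i <- r | Q i) F i x).
Proof.
move=> PF; elim: r => [|i r IH].
  by under eq_fun do rewrite big_nil; exact: frC.
under eq_fun do rewrite big_cons; case: (boolP (Q i)) => // Qi.
by apply: frD => //; exact: PF.
Qed.

Lemma fr_prod I (r : seq I) (Q : pred I) (F : I -> X -> K) :
  (forall i, Q i -> P (F i)) -> P (fun x => \prod_(i <- r | Q i) F i x).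
Proof.
move=> PF; elim: r => [|i r IH].
  by under eq_fun do rewrite big_nil; exact: frC.
under eq_fun do rewrite big_cons; case: (boolP (Q i)) => // Qi.
by apply: frM => //; exact: PF.
Qed.

Lemma fr_exp f n : P f -> P (fun x => f x ^+ n).
Proof.
move=> Pf; elim: n => [|n IH].
  by under eq_fun do rewrite expr0; exact: frC.
by under eq_fun do rewrite exprS; exact: frM.
Qed.

Lemma fr_meval n (v : X -> 'I_n -> K) (p : mpoly n K) :
  (forall k, P (fun x => v x k)) -> P (fun x => meval (v x) p).
Proof.
move=> Pv; under eq_fun do rewrite mevalE.
apply: fr_sum => m _; apply: frM; first exact: frC.
by apply: fr_prod => i _; exact: fr_exp.
Qed.

Lemma mxin_cst a b (A : 'M[K]_(a, b)) : mx_in P (fun=> A).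
Proof. by move=> i j; exact: frC. Qed.

Lemma mxinM a b c (F : X -> 'M[K]_(a, b)) (G : X -> 'M[K]_(b, c)) :
  mx_in P F -> mx_in P G -> mx_in P (fun x => F x *m G x).
Proof.
move=> PF PG i j; under eq_fun do rewrite mxE.
by apply: fr_sum => k _; exact: frM.
Qed.

Lemma mxinD a b (F G : X -> 'M[K]_(a, b)) :
  mx_in P F -> mx_in P G -> mx_in P (fun x => F x + G x).
Proof. by move=> PF PG i j; under eq_fun do rewrite mxE; exact: frD. Qed.

Lemma mxinN a b (F : X -> 'M[K]_(a, b)) : mx_in P F -> mx_in P (fun x => - F x).
Proof. by move=> PF i j; under eq_fun do rewrite mxE; exact: frN. Qed.

Lemma mxinZ a b (f : X -> K) (F : X -> 'M[K]_(a, b)) :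
  P f -> mx_in P F -> mx_in P (fun x => f x *: F x).
Proof. by move=> Pf PF i j; under eq_fun do rewrite mxE; exact: frM. Qed.

Lemma fr_det a (F : X -> 'M[K]_a) : mx_in P F -> P (fun x => \det (F x)).
Proof.
move=> PF; rewrite /determinant; apply: fr_sum => s _.
by apply: frM; [exact: frC|apply: fr_prod => i _; exact: PF].
Qed.

Lemma mxin_block a b c d (A : X -> 'M[K]_(a, c)) (B : X -> 'M_(a, d))
    (C : X -> 'M_(b, c)) (D : X -> 'M_(b, d)) :
  mx_in P A -> mx_in P B -> mx_in P C -> mx_in P D ->
  mx_in P (fun x => block_mx (A x) (B x) (C x) (D x)).
Proof.
move=> PA PB PC PD i j.
case: (split_ordP i) => i' ->; case: (split_ordP j) => j' ->.
- by under eq_fun do rewrite block_mxEul; exact: PA.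
- by under eq_fun do rewrite block_mxEur; exact: PB.
- by under eq_fun do rewrite block_mxEdl; exact: PC.
- by under eq_fun do rewrite block_mxEdr; exact: PD.
Qed.

End FunRing.

Definition polyfun (K : fieldType) m (f : zmat K m -> K) :=
  exists p, forall x, f x = mxeval x p.

Definition regular_at (K : fieldType) m (x0 : zmat K m) (f : zmat K m -> K) :=
  exists p q, mxeval x0 q != 0 /\ \forall y \near x0, f y = mxeval y p / mxeval y q.

Section Zar.
Context {K : fieldType}.
Implicit Types m n : nat.

Lemma polyfun_ring m : fun_ring (@polyfun K m).
Proof.
split.
- by move=> c; exists (mpolyC _ c) => x; rewrite /mxeval mevalC.
- move=> f g [p fp] [q gq]; exists (p + q) => x; rewrite fp gq /mxeval.
  by have := mevalD (fun k => mxvec (x : 'M_m) 0 k) p q.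
- move=> f g [p fp] [q gq]; exists (p * q) => x; rewrite fp gq /mxeval.
  by have := mevalM (fun k => mxvec (x : 'M_m) 0 k) p q.
Qed.

Lemma polyfun_coord m : mx_in (@polyfun K m) (fun x : zmat K m => x : 'M_m).
Proof.
move=> i j; exists (mpolyX K (mnm1 (mxvec_index i j))) => x.
by rewrite /mxeval mevalXU mxvecE.
Qed.

Lemma fr_mxeval (X : Type) (P : (X -> K) -> Prop) m (F : X -> zmat K m) p :
  fun_ring P -> mx_in P F -> P (fun x => mxeval (F x) p).
Proof.
move=> rP PF; rewrite /mxeval.
apply: (fr_meval rP (v := fun x k => mxvec (F x : 'M_m) 0 k)) => k.
case/mxvec_indexP: k => i j; under eq_fun do rewrite mxvecE; exact: PF.
Qed.

Lemma fr_polyfun (X : Type) (P : (X -> K) -> Prop) m (F : X -> zmat K m) f :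
  fun_ring P -> mx_in P F -> polyfun f -> P (fun x => f (F x)).
Proof. by move=> rP PF [p fp]; under eq_fun do rewrite fp; exact: fr_mxeval. Qed.

Lemma polyfun_mxeval m (p : mpoly (m * m) K) : polyfun (fun x : zmat K m => mxeval x p).
Proof. by exists p. Qed.

Lemma closedP m (Z : set (zmat K m)) : closed Z <-> exists P, Z = zero_locus P.
Proof.
split; first by move=> /closed_openC [P] /(congr1 setC); rewrite !setCK; exists P.
by move=> [P ->]; rewrite -openC; exists P.
Qed.

Lemma closed_zero m (f : zmat K m -> K) : polyfun f -> closed [set x | f x = 0].
Proof.
move=> [p fp]; apply/closedP; exists [set p]; apply/seteqP; split=> x /=.
  by move=> fx q ->; rewrite -fp.
by move=> /(_ p erefl); rewrite -fp.
Qed.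

Lemma zclosed_eq m (f g : zmat K m -> K) : polyfun f -> polyfun g ->
  closed [set x | f x = g x].
Proof.
move=> pf pg; rewrite (_ : mkset _ = [set x | f x - g x = 0]).
  by apply: closed_zero; exact: (frB (polyfun_ring m)).
by apply/seteqP; split=> x /= => [->|/eqP]; [rewrite subrr|rewrite subr_eq0 => /eqP].
Qed.

Lemma closed_all m (I : Type) (Q : I -> set (zmat K m)) :
  (forall i, closed (Q i)) -> closed [set x | forall i, Q i x].
Proof.
move=> cQ; rewrite (_ : mkset _ = \bigcap_i Q i); first by apply: closed_bigI => i _; exact: cQ.
by apply/seteqP; split=> x /= H i; [move=> _|]; exact: H.
Qed.

Lemma closed_mxeq m a b (F G : zmat K m -> 'M[K]_(a, b)) :
  mx_in (@polyfun K m) F -> mx_in (@polyfun K m) G -> closed [set x | F x = G x].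
Proof.
move=> pF pG; rewrite (_ : mkset _ = [set x | forall ij : 'I_a * 'I_b, F x ij.1 ij.2 = G x ij.1 ij.2]).
  by apply: closed_all => -[i j]; exact: zclosed_eq.
apply/seteqP; split => x /= H; first by move=> ij; rewrite H.
by apply/matrixP => i j; exact: (H (i, j)).
Qed.

Lemma closed_sep m (Z : set (zmat K m)) x : closed Z -> ~ Z x ->
  exists2 f, polyfun f & (forall y, Z y -> f y = 0) /\ f x != 0.
Proof.
move=> /closedP[P ->] /existsNP[p /not_implyP[Pp /eqP px]].
by exists (fun y => mxeval y p); [exists p|split=> // y; apply].
Qed.

Lemma open_principal m (U : set (zmat K m)) x : open U -> U x ->
  exists2 f, polyfun f & f x != 0 /\ forall y, f y != 0 -> U y.
Proof.
move=> oU Ux; have [|f pf [fU fx]] := @closed_sep m (~` U) x (open_closedC oU); first by [].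
exists f => //; split => // y /eqP fy; apply: contrapT => /fU; exact: fy.
Qed.

Lemma open_nonzero m (f : zmat K m -> K) : polyfun f -> open [set x | f x != 0].
Proof.
move=> /closed_zero/closed_openC.
by rewrite (_ : ~` _ = [set x | f x != 0]) //; apply/seteqP; split=> x /= /eqP.
Qed.

Lemma open_unitmx m : open [set x : zmat K m | (x : 'M_m) \in unitmx].
Proof.
rewrite (_ : mkset _ = [set x : zmat K m | \det (x : 'M_m) != 0]).
  by apply: open_nonzero; apply: (fr_det (polyfun_ring m)); exact: polyfun_coord.
by apply/seteqP; split=> x /=; rewrite unitmxE unitfE.
Qed.

Lemma continuous_closed (X Y : topologicalType) (F : X -> Y) :
  (forall C, closed C -> closed (F @^-1` C)) -> continuous F.
Proof.
move=> H; apply/continuousP => U oU.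
by rewrite -[X in open X]setCK openC preimage_setC; apply: H; rewrite closedC.
Qed.

Lemma poly_continuous m n (F : zmat K m -> zmat K n) :
  mx_in (@polyfun K m) F -> continuous F.
Proof.
move=> pF; apply: continuous_closed => _ /closedP[P ->].
rewrite (_ : _ @^-1` _ = [set x | forall q : {p | P p}, mxeval (F x) (sval q) = 0]).
  apply: closed_all => q; apply: closed_zero.
  by apply: (fr_mxeval _ (polyfun_ring m)).
by apply/seteqP; split=> x /= H; [move=> -[p Pp]; exact: H|move=> p Pp; exact: (H (exist _ p Pp))].
Qed.

Lemma near_open (X : topologicalType) (x : X) (P : X -> Prop) :
  (\forall y \near x, P y) <-> exists2 V, open V /\ V x & forall y, V y -> P y.
Proof.
by split; rewrite -nbhs_nearE nbhsE => -[V [oV Vx] VP]; exists V.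
Qed.

Lemma regular_ring m (x0 : zmat K m) : fun_ring (regular_at x0).
Proof.
have e1 (y : zmat K m) : mxeval y (mpolyC (m * m) 1) = 1 by rewrite /mxeval mevalC.
have eD (y : zmat K m) p q : mxeval y (p + q) = mxeval y p + mxeval y q.
  by have := mevalD (fun k => mxvec (y : 'M_m) 0 k) p q.
have eM (y : zmat K m) p q : mxeval y (p * q) = mxeval y p * mxeval y q.
  by have := mevalM (fun k => mxvec (y : 'M_m) 0 k) p q.
have near_nz q : mxeval x0 q != 0 -> \forall y \near x0, mxeval y q != 0.
  by move=> qx; apply: open_nbhs_nbhs; split=> //; apply: open_nonzero; exists q.
split.
- move=> c; exists (mpolyC _ c), (mpolyC _ 1); split; first by rewrite e1 oner_neq0.
  by near=> y; rewrite e1 divr1 /mxeval mevalC.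
- move=> f g [p [q [qx Hf]]] [p' [q' [qx' Hg]]].
  exists (p * q' + p' * q), (q * q'); split; first by rewrite eM mulf_neq0.
  near=> y; have Hq : mxeval y q != 0 by near: y; exact: near_nz.
  have Hq' : mxeval y q' != 0 by near: y; exact: near_nz.
  rewrite eD !eM (near Hf y) // (near Hg y) //.
  by rewrite addf_div.
- move=> f g [p [q [qx Hf]]] [p' [q' [qx' Hg]]].
  exists (p * p'), (q * q'); split; first by rewrite eM mulf_neq0.
  near=> y; rewrite !eM (near Hf y) // (near Hg y) //.
  by rewrite mulf_div.
Unshelve. all: by end_near.
Qed.

Lemma regular_poly m (x0 : zmat K m) f : polyfun f -> regular_at x0 f.
Proof.
move=> pf; have := @fr_polyfun _ (regular_at x0) m id f (regular_ring x0).
apply => //; move=> i j; have [p Hp] := @polyfun_coord m i j.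
exists p, (mpolyC _ 1); rewrite /mxeval mevalC oner_neq0; split => //.
by near=> y; rewrite Hp mevalC divr1.
Unshelve. all: by end_near.
Qed.

Lemma regular_near m (x0 : zmat K m) f g : (\forall y \near x0, f y = g y) ->
  regular_at x0 g -> regular_at x0 f.
Proof.
move=> H [p [q [qx Hg]]]; exists p, q; split=> //.
by near=> y; rewrite (near H y) // (near Hg y).
Unshelve. all: by end_near.
Qed.

Lemma regular_inv m (x0 : zmat K m) f : f x0 != 0 -> regular_at x0 f ->
  regular_at x0 (fun x => (f x)^-1).
Proof.
move=> fx [p [q [qx Hf]]]; have := nbhs_singleton Hf => /= fxE.
have px : mxeval x0 p != 0 by move: fx; rewrite fxE mulf_eq0 negb_or => /andP[].
exists q, p; split=> //; near=> y; rewrite (near Hf y) // invf_div //.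
Unshelve. all: by end_near.
Qed.

Lemma regular_at_open m (x0 : zmat K m) f : regular_at x0 f ->
  \forall y \near x0, regular_at y f.
Proof.
move=> [p [q [qx Hf]]]; have Hf' : \forall y \near x0, \forall z \near y, f z = mxeval z p / mxeval z q.
  move: Hf => /near_open[V [oV Vx] HV]; apply/near_open; exists V => // y Vy.
  by apply/near_open; exists V.
near=> y; exists p, q; split; last exact: (near Hf' y).
near: y; apply: open_nbhs_nbhs; split=> //; apply: open_nonzero; exact: polyfun_mxeval.
Unshelve. all: by end_near.
Qed.

Lemma regular_nonzero m (x0 : zmat K m) f : regular_at x0 f -> f x0 != 0 ->
  \forall y \near x0, f y != 0.
Proof.
move=> [p [q [qx Hf]]] fx.
have := nbhs_singleton Hf => /= fxE.
have px : mxeval x0 p != 0 by move: fx; rewrite fxE mulf_eq0 negb_or => /andP[].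
near=> y; rewrite (near Hf y) //; apply: mulf_neq0; last rewrite invr_eq0.
  by near: y; apply: open_nbhs_nbhs; split=> //; apply: open_nonzero; exact: polyfun_mxeval.
by near: y; apply: open_nbhs_nbhs; split=> //; apply: open_nonzero; exact: polyfun_mxeval.
Unshelve. all: by end_near.
Qed.

Lemma regular_continuous m n (F : zmat K m -> zmat K n) x0 :
  mx_in (regular_at x0) F -> {for x0, continuous F}.
Proof.
move=> rF U; rewrite nbhsE => -[V [oV VFx] VU].
have [f pf [fFx fV]] := open_principal oV VFx.
have rf : regular_at x0 (fun x => f (F x)) by exact: (fr_polyfun (regular_ring x0)).
have := regular_nonzero rf fFx; apply: filterS => y fy; exact: VU (fV _ fy).
Qed.

Lemma regular_comp m n (F : zmat K m -> zmat K n) x0 f :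
  mx_in (regular_at x0) F -> regular_at (F x0) f -> regular_at x0 (fun x => f (F x)).
Proof.
move=> rF [p [q [qx Hf]]].
have r r' : regular_at x0 (fun x => mxeval (F x) r').
  by apply: fr_mxeval => //; exact: regular_ring.
have Hc : \forall y \near x0, f (F y) = mxeval (F y) p / mxeval (F y) q.
  exact: (regular_continuous rF Hf).
apply: (regular_near Hc); apply: (frM (regular_ring x0)); first exact: (r p).
by apply: regular_inv => //; exact: (r p).
Qed.

Lemma regular_invmx m n (F : zmat K m -> 'M[K]_n) x0 :
  mx_in (regular_at x0) F -> F x0 \in unitmx -> mx_in (regular_at x0) (fun x => invmx (F x)).
Proof.
move=> rF uF i j; have rd := fr_det (regular_ring x0) rF.
have dF : \det (F x0) != 0 by rewrite -unitfE -unitmxE.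
apply: (@regular_near _ _ _ (fun x => (\det (F x))^-1 * \adj (F x) i j)).
  have := regular_nonzero rd dF; apply: filterS => y dy.
  by rewrite /invmx unitmxE unitfE dy mxE.
apply: (frM (regular_ring x0)); first exact: regular_inv.
under eq_fun do rewrite mxE /cofactor; apply: (frM (regular_ring x0)); first exact: (frC (regular_ring x0)).
by apply: (fr_det (regular_ring x0)) => k l; under eq_fun do rewrite !mxE; exact: rF.
Qed.

End Zar.

(** * Noetherianity *)

Lemma nat_argmin (g : nat -> nat) (i : nat) :
  exists j, (i <= j)%N /\ forall l, (i <= l)%N -> (g j <= g l)%N.
Proof.
have ex : exists n, `[< exists2 j, (i <= j)%N & g j = n >].
  by exists (g i); apply/asboolP; exists i.
case: (ex_minnP ex) => n /asboolP[j ij <-] Hn; exists j; split=> // l il.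
by apply: Hn; apply/asboolP; exists l.
Qed.

(** The next position is one where [g] is minimal on the remaining tail. *)
Lemma nondecreasing_subseq (g : nat -> nat) : exists s : nat -> nat,
  (forall i j, (i < j)%N -> (s i < s j)%N) /\ forall i j, (i <= j)%N -> (g (s i) <= g (s j))%N.
Proof.
have /choice[m mP] := nat_argmin g.
pose s := fix s k := if k is k'.+1 then m (s k').+1 else m 0%N.
have sS k : (s k < s k.+1)%N by have [] := mP (s k).+1.
have sm i j : (i < j)%N -> (s i < s j)%N.
  elim: j => // j IH; rewrite ltnS leq_eqVlt => /orP[/eqP->//|/IH].
  by move/ltn_trans; apply.
exists s; split=> // i j; rewrite leq_eqVlt => /orP[/eqP->//|ij].
have sij := sm _ _ ij.
by case: i ij sij => [|i] ij sij; [have [_] := mP 0%N|have [_] := mP (s i).+1];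
  apply=> //; apply: ltn_trans (sS i) sij.
Qed.

(** Coordinates are treated one at a time, passing each time to a subsequence on which one more of
    them is nondecreasing. *)
Lemma dickson N (f : nat -> multinom N) :
  exists i j, (i < j)%N /\ mpoly.lem (f i) (f j).
Proof.
have H k : exists s : nat -> nat, (forall i j, (i < j)%N -> (s i < s j)%N) /\
    forall c : 'I_N, (c < k)%N -> forall i j, (i <= j)%N -> (f (s i) c <= f (s j) c)%N.
  elim: k => [|k [s [sm sH]]]; first by exists id.
  have [kN|kN] := ltnP k N; last first.
    exists s; split=> // c _; apply: sH.
    exact: leq_trans (ltn_ord c) kN.
  have [s' [sm' sH']] := nondecreasing_subseq (fun i => f (s i) (Ordinal kN)).
  exists (s \o s'); split=> [i j ij|c ck i j ij] /=; first by apply: sm; exact: sm'.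
  have les : (s' i <= s' j)%N.
    by move: ij; rewrite leq_eqVlt => /orP[/eqP->//|/sm'/ltnW].
  move: ck; rewrite ltnS leq_eqVlt => /orP[/eqP ck|ck]; last exact: sH.
  have -> : c = Ordinal kN by apply/val_inj.
  exact: sH'.
have [s [sm sH]] := H N; exists (s 0%N), (s 1%N); split; first exact: sm.
by apply/forallP => c; apply: sH.
Qed.

Section Noether.
Context {K : fieldType} {N : nat}.

Definition is_ideal (I : mpoly N K -> Prop) :=
  [/\ I 0, forall p q, I p -> I q -> I (p + q) & forall p q, I q -> I (p * q)].

(** Finite generation is expressed without linear combinations: an ideal containing [L] contains
    [I]. By Dickson's lemma finitely many leading monomials divide all those of [I], and division by
    the corresponding elements terminates because the monomial order is well-founded. *)
Lemma hilbert_basis (I : mpoly N K -> Prop) : is_ideal I ->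
  exists2 L : seq (mpoly N K), (forall p, p \in L -> I p) &
    forall J, is_ideal J -> (forall p, p \in L -> J p) -> forall p, I p -> J p.
Proof.
move=> [I0 ID IM].
pose good (L : seq (mpoly N K)) := forall p, I p -> p != 0 ->
  exists g, [/\ g \in L, g != 0 & mpoly.lem (mlead g) (mlead p)].
have [L [LI gL]] : exists L, (forall p, p \in L -> I p) /\ good L.
  apply: contrapT => /forallNP noL.
  have H (L : seq (mpoly N K)) : exists p, (forall p, p \in L -> I p) ->
      [/\ I p, p != 0 & forall g, g \in L -> g != 0 -> ~~ mpoly.lem (mlead g) (mlead p)].
    have [LI|] := pselect (forall p, p \in L -> I p); last by exists 0.
    have /existsNP[p] : ~ good L by move=> gL; apply: (noL L).
    move=> /not_implyP[Ip /not_implyP[p0 /forallNP Hp]]; exists p => _; split=> // g gL g0.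
    by apply/negP => le; apply: (Hp g).
  have {H} [F FP] := choice H.
  (* If no finite list is good, every list is extended by an element whose leading monomial is
     divisible by no earlier one, against Dickson's lemma. *)
  pose Ls := fix Ls k := if k is k'.+1 then F (Ls k') :: Ls k' else [::].
  have LsI k p : p \in Ls k -> I p.
    elim: k p => //= k IH p; rewrite inE => /orP[/eqP->|/IH//].
    by have [] := FP _ IH.
  have mem i j : (i < j)%N -> F (Ls i) \in Ls j.
    elim: j => //= j IH; rewrite ltnS leq_eqVlt inE => /orP[/eqP->|/IH->].
      by rewrite eqxx.
    by rewrite orbT.
  have [i [j [ij le]]] := dickson (fun k => mlead (F (Ls k))).
  have [_ _ /(_ _ (mem _ _ ij))] := FP _ (LsI j).
  by have [_ n0 _] := FP _ (LsI i) => /(_ n0); rewrite le.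
exists L => // J [J0 JD JM] LJ p.
have [m] : exists m, m = mlead p by eexists.
elim/(well_founded_induction (@ltom_wf N)): m p => m IH p mp Ip.
have [->//|p0] := eqVneq p 0.
have [g [gL0 g0 le]] := gL p Ip p0.
pose d : multinom N := mnm_sub (mlead p) (mlead g).
pose c := mcoeff (mlead p) p / mcoeff (mlead g) g.
(* The term for which [h * g] and [p] have the same leading term. *)
pose h : mpoly N K := mpolyC N c * mpolyX K d.
have lg : mcoeff (mlead g) g != 0 by rewrite mleadc_eq0.
have dg : mnm_add d (mlead g) = mlead p by rewrite /d submK.
have lead : mcoeff (mlead p) (p - h * g) = 0.
  rewrite mcoeffB -{2}dg /h.
  have -> : mpolyC N c * mpolyX K d * g = c *: (g * mpolyX K d).
    by rewrite -mulrA [X in _ * X]mulrC mul_mpolyC.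
  by rewrite mcoeffZ mcoeffMX /c divfK ?subrr.
have Jhg : J (h * g) by apply: JM; exact: LJ.
rewrite -[p](subrK (h * g)); apply: JD => //.
have [->//|q0] := eqVneq (p - h * g) 0.
apply: (IH (mlead (p - h * g)) _ _ erefl); last first.
  by apply: ID => //; rewrite -mulNr; apply: IM; exact: LI.
have : mlead (p - h * g) != mlead p.
  by apply: contra_neq q0 => e; apply/eqP; rewrite -mleadc_eq0 e lead.
rewrite mp lt_neqAle => -> /=.
apply: le_trans (mleadB_le _ _) _; rewrite leUx lexx /= -dg.
apply: le_trans (mleadM_le _ _) _; rewrite lem_add //.
by rewrite /h; apply: le_trans (mleadM_le _ _) _; rewrite mleadC add0m mleadXm.
Qed.

End Noether.

Section NoetherZ.
Context {K : fieldType} {n : nat}.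
Implicit Types Z : set (zmat K n).

Definition vanishing Z (p : mpoly (n * n) K) := forall x, Z x -> mxeval x p = 0.

Lemma vanishing_ideal Z : is_ideal (vanishing Z).
Proof.
split.
- by move=> x _; rewrite /mxeval; exact: (meval0 (fun k => mxvec (x : 'M_n) 0 k)).
- move=> p q Hp Hq x Zx; rewrite /mxeval.
  have -> := mevalD (fun k => mxvec (x : 'M_n) 0 k) p q.
  by have := Hp x Zx; have := Hq x Zx; rewrite /mxeval => -> ->; rewrite addr0.
- move=> p q Hq x Zx; rewrite /mxeval.
  have -> := mevalM (fun k => mxvec (x : 'M_n) 0 k) p q.
  by have := Hq x Zx; rewrite /mxeval => ->; rewrite mulr0.
Qed.

Lemma closed_finite Z : closed Z -> exists L : seq (mpoly (n * n) K),
  Z = [set x | forall p, p \in L -> mxeval x p = 0].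
Proof.
move=> /closedP[P ZP]; have [L LZ HL] := hilbert_basis (vanishing_ideal Z).
exists L; apply/seteqP; split=> x Zx; first by move=> p /LZ; apply.
rewrite ZP => p Pp; apply: (HL (vanishing [set x])) => //.
- exact: vanishing_ideal.
- by move=> q qL y ->; exact: Zx.
- by move=> y; rewrite ZP; apply.
Qed.

(** Along a strictly descending chain the vanishing ideals increase. Their union is a finitely
    generated ideal, so it is reached at some stage, where the chain has to stop. *)
Lemma closed_min (F : set (set (zmat K n))) : F !=set0 ->
  (forall Z, F Z -> closed Z) ->
  exists2 Z, F Z & forall Z', F Z' -> Z' `<=` Z -> Z' = Z.
Proof.
move=> [Z0 FZ0] Fc; apply: contrapT => nomin.
have H Z : exists Z', F Z -> [/\ F Z', Z' `<=` Z & Z' <> Z].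
  have [FZ|] := pselect (F Z); last by exists Z.
  have /existsNP[Z'] : ~ forall Z', F Z' -> Z' `<=` Z -> Z' = Z.
    by move=> h; apply: nomin; exists Z.
  by move=> /not_implyP[FZ' /not_implyP[sub ne]]; exists Z'.
have {H} [S SP] := choice H.
pose Zs k := iter k S Z0.
have FZs k : F (Zs k) by elim: k => //= k /SP[].
have sub i j : (i <= j)%N -> Zs j `<=` Zs i.
  move=> /subnK <-; elim: (j - i)%N => [|k IH] //=.
  by apply: subset_trans IH; have [] := SP _ (FZs (k + i)%N).
pose I p := exists k, vanishing (Zs k) p.
have II : is_ideal I.
  split; first by exists 0%N; have [] := vanishing_ideal (Zs 0%N).
    move=> p q [i Hi] [j Hj]; exists (maxn i j).
    have [_ + _] := vanishing_ideal (Zs (maxn i j)); apply.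
      by move=> x /(sub _ _ (leq_maxl i j)); exact: Hi.
    by move=> x /(sub _ _ (leq_maxr i j)); exact: Hj.
  by move=> p q [i Hi]; exists i; have [_ _] := vanishing_ideal (Zs i); apply.
have [L LI HL] := hilbert_basis II.
have [m Lm] : exists m, forall p, p \in L -> vanishing (Zs m) p.
  elim: L LI {HL} => [|p L IH] LI; first by exists 0%N.
  have [|m Hm] := IH; first by move=> q qL; apply: LI; rewrite inE qL orbT.
  have [|k Hk] := LI p; first by rewrite inE eqxx.
  exists (maxn m k) => q; rewrite inE => /orP[/eqP->|qL] x.
    by move=> /(sub _ _ (leq_maxr m k)); exact: Hk.
  by move=> /(sub _ _ (leq_maxl m k)); exact: Hm.
have IZ := HL _ (vanishing_ideal (Zs m)) Lm.
have [_ sm ne] := SP _ (FZs m); apply: ne; apply/seteqP; split=> // x Zx.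
have /closedP[P] := Fc _ (FZs m.+1).
move=> ZP; change (Zs m.+1 x); rewrite ZP => p Pp; apply: IZ => //.
by exists m.+1 => y; rewrite ZP; apply.
Qed.

End NoetherZ.

(** * Connectedness *)

Section Conn.
Context {X Y : topologicalType}.

Lemma connected_between (A E : set X) : connected A -> A `<=` E ->
  E `<=` closure A -> connected E.
Proof.
move=> cA AE EA U [z Uz] [C1 oC1 U1] [C2 cC2 U2].
have A12 : A `&` C1 = A `&` C2.
  apply/seteqP; split=> x [Ax Cx]; split=> //; have Ex := AE _ Ax.
    by have : U x by [rewrite U1]; rewrite U2 => -[].
  by have : U x by [rewrite U2]; rewrite U1 => -[].
have AC : A `&` C1 = A.
  apply: cA; [|by exists C1|by rewrite A12; exists C2].
  by move: Uz; rewrite U1 => -[/EA Az C1z]; apply: Az; apply: open_nbhs_nbhs.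
apply/seteqP; split; first by move=> x; rewrite U2 => -[].
move=> x Ex; rewrite U2; split=> //; apply: cC2.
by apply: closureS (EA _ Ex) => y; rewrite -AC A12 => -[].
Qed.

Lemma connected_image (A : set X) (F : X -> Y) : connected A ->
  (forall x, A x -> {for x, continuous F}) -> connected (F @` A).
Proof.
move=> cA cF; apply: connected_continuous_connected => //.
by apply: continuous_in_subspaceT => x /set_mem; exact: cF.
Qed.

Lemma closed_exists (T : eqType) (s : seq T) (C : T -> set X) :
  (forall t, closed (C t)) -> closed [set x | exists2 t, t \in s & C t x].
Proof.
move=> cC; elim: s => [|t s IH].
  by rewrite (_ : mkset _ = set0); [exact: closed0|apply/seteqP; split=> x // -[]].
rewrite (_ : mkset _ = C t `|` [set x | exists2 t, t \in s & C t x]); first exact: closedU.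
apply/seteqP; split=> x.
  by move=> [u]; rewrite inE => /orP[/eqP->|us] Cx; [left|right; exists u].
by move=> [Cx|[u us Cx]]; [exists t; rewrite ?mem_head|exists u; rewrite ?inE ?us ?orbT].
Qed.

(** Each fibre is closed in [A], and its complement is the finite union of the other fibres. This is
    the rigidity behind Lie-Kolchin and the fixed point theorem: a label with finitely many possible
    values, such as an eigenvalue, is constant along a connected group. *)
Lemma connected_label (T : eqType) (A : set X) (l : X -> T) (s : seq T) :
  connected A -> (forall x, A x -> l x \in s) ->
  (forall t, exists2 C, closed C & A `&` [set x | l x = t] = A `&` C) ->
  forall x y, A x -> A y -> l x = l y.
Proof.
move=> cA ls cl x y Ax Ay.
have cl' t : exists C, closed C /\ A `&` [set x | l x = t] = A `&` C.
  by have [C ? ?] := cl t; exists C.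
have [C CP] := choice cl'.
pose D := [set z | exists2 t, t \in [seq t <- s | t != l x] & C t z].
have cD : closed D.
  by apply: closed_exists => t; have [] := CP t.
have : A `&` [set z | l z = l x] = A.
  apply: cA; first by exists x.
    exists (~` D); first exact: closed_openC.
    apply/seteqP; split=> z [Az Hz]; split=> //.
      move=> [t]; rewrite mem_filter => /andP[tx _] Ctz.
      have [_ /seteqP[_ /(_ z)]] := CP t => H.
      by move/eqP: tx; apply; have [_ /= <-] := H (conj Az Ctz).
    apply: contrapT => lz; apply: Hz; exists (l z).
      by rewrite mem_filter ls // andbT; apply/eqP.
    by have [_ /seteqP[/(_ z) H _]] := CP (l z); have [] := H (conj Az erefl).
  by have [C0 c0 e0] := cl (l x); exists C0.
by move=> /seteqP[_ /(_ y Ay)] [].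
Qed.

End Conn.

Section NoetherConn.
Context {K : fieldType} {n : nat}.

(** Among the relatively clopen subsets of [A] containing [x], one with minimal closure is minimal,
    hence connected. Closures are compared because [A] itself need not be closed. *)
Lemma component_open (A : set (zmat K n)) x : A x ->
  exists2 V, open V & connected_component A x = A `&` V.
Proof.
move=> Ax.
pose clop (E : set (zmat K n)) := [/\ E x, E `<=` A,
  exists2 V, open V & E = A `&` V & exists2 C, closed C & E = A `&` C].
have [||Z [E cE EZ] Zmin] := @closed_min K n [set closure E | E in clop].
- exists (closure A); exists A => //; split=> //.
    by exists setT; [exact: openT|rewrite setIT].
  by exists setT; [exact: closedT|rewrite setIT].
- by move=> _ [E _ <-]; exact: closed_closure.
have [Ex EA [V oV EV] [C cC EC]] := cE.
have sub E' : clop E' -> E' `<=` E -> E' = E.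
  move=> cE' E'E; have [_ E'A _ [C' cC' EC']] := cE'.
  have clE : closure E' = Z by apply: Zmin; [exists E'|rewrite -EZ; exact: closureS].
  apply/seteqP; split=> // y Ey; rewrite EC'; split; first exact: EA.
  apply: cC'; have : closure E' y by rewrite clE -EZ; exact: subset_closure.
  by apply: closureS => z; rewrite EC' => -[].
have conE : connected E.
  move=> U [z Uz] [V1 oV1 U1] [C1 cC1 U1'].
  have [Ux|nUx] := pselect (U x).
    apply: sub; last by move=> y; rewrite U1 => -[].
    split=> //; first by move=> y; rewrite U1 => -[/EA].
      by exists (V `&` V1); [exact: openI|rewrite setIA -EV].
    by exists (C `&` C1); [exact: closedI|rewrite setIA -EC].
  have H : E `\` U = E.
    apply: sub; last by move=> y [].
    split=> //; first by move=> y [/EA].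
      exists (V `&` ~` C1); first by apply: openI => //; exact: closed_openC.
      apply/seteqP; split=> y; rewrite setIA -EV => -[Ey Hy]; split=> //.
        by move=> C1y; apply: Hy; rewrite U1'.
      by rewrite U1' => -[].
    exists (C `&` ~` V1); first by apply: closedI => //; exact: open_closedC.
    apply/seteqP; split=> y; rewrite setIA -EC => -[Ey Hy]; split=> //.
      by move=> V1y; apply: Hy; rewrite U1.
    by rewrite U1 => -[].
  have Ez : E z by move: Uz; rewrite U1 => -[].
  by move: Ez; rewrite -H => -[].
exists V => //; rewrite -EV; apply/seteqP; split; last exact: connected_component_max.
move=> y [D [Dx DA cD] Dy].
have : D `&` E = D.
  apply: cD; first by exists x.
    by exists V => //; rewrite EV setIA (setIidl DA).
  by exists C => //; rewrite EC setIA (setIidl DA).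
by move=> /seteqP[_ /(_ y Dy)] [].
Qed.

End NoetherConn.

(** * Matrix groups *)

Section MatGroup.
Context {K : fieldType}.
Implicit Types n m : nat.

Definition GL n : set (zmat K n) := [set x | x \in unitmx].

(** Relatively closed in [GL], as algebraic groups are; this is stronger than locally closed. *)
Definition lclosed n (Z : set (zmat K n)) := exists2 C, closed C & Z = C `&` @GL n.

Definition conjg n (g : zmat K n) (H : set (zmat K n)) : set (zmat K n) :=
  [set g *m h *m invmx g | h in H].

Lemma mxin_id m : mx_in (@polyfun K m) (fun x : zmat K m => x : 'M_m).
Proof. exact: polyfun_coord. Qed.

Lemma mxin_sandwich m a b (A : 'M[K]_(a, m)) (B : 'M_(m, b)) :
  mx_in (@polyfun K m) (fun x : zmat K m => A *m (x : 'M_m) *m B).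
Proof.
have r := @polyfun_ring K m.
by apply: (mxinM r); [apply: (mxinM r); [exact: (mxin_cst r)|exact: mxin_id]|exact: (mxin_cst r)].
Qed.

Lemma sandwich_continuous m (A B : zmat K m) :
  continuous (fun x : zmat K m => (A *m x *m B : zmat K m)).
Proof. by apply: poly_continuous; exact: mxin_sandwich. Qed.

Lemma closed_preimage m n (F : zmat K m -> zmat K n) C :
  mx_in (@polyfun K m) F -> closed C -> closed (F @^-1` C).
Proof. by move=> pF; apply: closed_comp => x _; exact: (poly_continuous pF). Qed.

Lemma lclosed_closure n (Z : set (zmat K n)) : lclosed Z -> Z = closure Z `&` @GL n.
Proof.
move=> [C cC ->]; apply/seteqP; split=> x; first by move=> Zx; split; [exact: subset_closure|case: Zx].
by move=> [Cx Gx]; split=> //; apply: cC; apply: closureS Cx => y [].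
Qed.

Lemma lclosedI n (Y Z : set (zmat K n)) : lclosed Y -> lclosed Z -> lclosed (Y `&` Z).
Proof.
move=> [C cC ->] [D cD ->]; exists (C `&` D); first exact: closedI.
by apply/seteqP; split=> x; [move=> [[? ?] []]|move=> [[? ?] ?]].
Qed.

Lemma lclosed_closedI n (C Z : set (zmat K n)) : closed C -> lclosed Z -> lclosed (C `&` Z).
Proof.
move=> cC [D cD ->]; exists (C `&` D); first exact: closedI.
by rewrite setIA.
Qed.

Lemma lclosed_GL n : lclosed (@GL n).
Proof. by exists setT; [exact: closedT|rewrite setTI]. Qed.

Lemma lclosed_min n (F : set (set (zmat K n))) : F !=set0 ->
  (forall Z, F Z -> lclosed Z) ->
  exists2 Z, F Z & forall Z', F Z' -> Z' `<=` Z -> Z' = Z.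
Proof.
move=> [Z0 FZ0] Fc; have [||_ [Z FZ <-] Zmin] := @closed_min K n [set closure Z | Z in F].
- by exists (closure Z0); exists Z0.
- by move=> _ [Z _ <-]; exact: closed_closure.
exists Z => // Z' FZ' sub; rewrite (lclosed_closure (Fc _ FZ')) (lclosed_closure (Fc _ FZ)).
by rewrite (Zmin (closure Z')) //; [exists Z'|exact: closureS].
Qed.

Lemma lclosed_left n (g : zmat K n) Z : g \in unitmx -> lclosed Z ->
  lclosed [set x : zmat K n | Z (g *m x)].
Proof.
move=> ug [C cC ->]; exists [set x : zmat K n | C (g *m x)].
  have := @closed_preimage n n (fun x => g *m x *m 1%:M) C (mxin_sandwich g 1%:M) cC.
  by congr closed; apply/seteqP; split=> x /=; rewrite mulmx1.
by apply/seteqP; split=> x [Cx]; rewrite /GL /= ?unitmx_mul ?ug /= => ux; split=> //;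
  rewrite /GL /= unitmx_mul ug.
Qed.

Lemma lclosed_right n (g : zmat K n) Z : g \in unitmx -> lclosed Z ->
  lclosed [set x : zmat K n | Z (x *m g)].
Proof.
move=> ug [C cC ->]; exists [set x : zmat K n | C (x *m g)].
  have := @closed_preimage n n (fun x => 1%:M *m x *m g) C (mxin_sandwich 1%:M g) cC.
  by congr closed; apply/seteqP; split=> x /=; rewrite mul1mx.
by apply/seteqP; split=> x [Cx]; rewrite /GL /= ?unitmx_mul ?ug ?andbT /= => ux; split=> //;
  rewrite /GL /= unitmx_mul ug ux.
Qed.

Lemma conjgE n (g : zmat K n) H x : g \in unitmx ->
  conjg g H x <-> H (invmx g *m x *m g).
Proof.
move=> ug; split=> [[h Hh <-]|Hx].
  by rewrite !mulmxA mulVmx // mul1mx mulmxKV.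
by exists (invmx g *m x *m g) => //; rewrite !mulmxA mulmxV // mul1mx mulmxK.
Qed.

Lemma conjg_inv n (g : zmat K n) H : g \in unitmx -> conjg (invmx g) (conjg g H) = H.
Proof.
move=> ug; apply/seteqP; split=> x.
  move=> /conjgE; rewrite unitmx_inv invmxK => /(_ ug) /conjgE => /(_ ug).
  by rewrite !mulmxA mulVmx // mul1mx mulmxKV.
move=> Hx; apply/conjgE; rewrite ?unitmx_inv ?invmxK //; apply/conjgE => //.
by rewrite !mulmxA mulVmx // mul1mx mulmxKV.
Qed.

Lemma conjg_mul n (g h : zmat K n) H : g \in unitmx -> h \in unitmx ->
  conjg (g *m h) H = conjg g (conjg h H).
Proof.
move=> ug uh; have ugh : g *m h \in unitmx by rewrite unitmx_mul ug.
have e : invmx (g *m h) = invmx h *m invmx g.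
  by apply: (can_inj (mulKmx ugh)); rewrite mulmxV // mulmxA mulmxK // mulmxV.
by apply/seteqP; split=> x; rewrite !conjgE // e !mulmxA.
Qed.

Lemma invmxM n (g h : 'M[K]_n) : g \in unitmx -> h \in unitmx ->
  invmx (g *m h) = invmx h *m invmx g.
Proof.
move=> ug uh; have ugh : g *m h \in unitmx by rewrite unitmx_mul ug.
by apply: (can_inj (mulKmx ugh)); rewrite mulmxV // mulmxA mulmxK // mulmxV.
Qed.

Lemma conjg1 n H : conjg (1%:M : zmat K n) H = H.
Proof.
by apply/seteqP; split=> x; rewrite conjgE ?unitmx1 // invmx1 mul1mx mulmx1.
Qed.

Lemma conjgS n (g : zmat K n) H H' : H `<=` H' -> conjg g H `<=` conjg g H'.
Proof. by move=> HH' _ [h /HH' h' <-]; exists h. Qed.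

Lemma conjg_subgroup n (g : zmat K n) H : g \in unitmx -> matrix_subgroup H ->
  matrix_subgroup (conjg g H).
Proof.
move=> ug [HG H1 HM HV]; split.
- by move=> _ [h /HG /= hu <-]; rewrite /= !unitmx_mul unitmx_inv ug hu.
- by exists 1%:M => //; rewrite mulmx1 mulmxV.
- move=> _ _ [h Hh <-] [k Hk <-]; exists (h *m k); first exact: HM.
  by rewrite !mulmxA mulmxKV.
- move=> _ [h Hh <-]; exists (invmx h); first exact: HV.
  have hu := HG _ Hh; rewrite !invmxM ?invmxK ?unitmx_inv ?unitmx_mul ?ug ?unitmx_inv //.
  by rewrite mulmxA.
Qed.

Lemma conjg_lclosed n (g : zmat K n) H : g \in unitmx -> lclosed H -> lclosed (conjg g H).
Proof.
move=> ug cH; have := lclosed_left (g := invmx g) _ (lclosed_right ug cH).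
rewrite unitmx_inv => /(_ ug); congr lclosed.
by apply/seteqP; split=> x; rewrite conjgE //= -mulmxA.
Qed.

Lemma conjg_connected n (g : zmat K n) H : connected H -> connected (conjg g H).
Proof. by move=> cH; apply: connected_image => // x _; exact: sandwich_continuous. Qed.

Lemma conjg_algebraic n (g : zmat K n) H : g \in unitmx -> algebraic_group H ->
  algebraic_group (conjg g H).
Proof.
move=> ug [gH cH]; split; first exact: conjg_subgroup.
exact: conjg_lclosed.
Qed.

Lemma translate_connected n (g : zmat K n) H : connected H -> connected (translate g H).
Proof.
move=> cH; rewrite (_ : translate g H = (fun x : zmat K n => g *m x *m 1%:M : zmat K n) @` H).
  by apply: connected_image => // x _; exact: sandwich_continuous.
by rewrite /translate; apply: eq_imagel => x _; rewrite mulmx1.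
Qed.

(** The conjugates of [A] by powers of [invmx g] form a descending chain; where it stabilizes,
    conjugating back gives equality. This does the work of comparing dimensions and numbers of
    components. *)
Lemma lclosed_noeth n (g : zmat K n) A : g \in unitmx -> lclosed A ->
  A `<=` conjg g A -> conjg g A = A.
Proof.
move=> ug cA AgA.
pose D k := iter k (conjg (invmx g)) A.
have ug' : invmx g \in unitmx by rewrite unitmx_inv.
have [||Z [k _ <-] Zmin] := @lclosed_min n (range D).
- by exists A; exists 0%N.
- move=> _ [k _ <-]; elim: k => //= k IH; exact: conjg_lclosed.
have S1 : conjg (invmx g) A `<=` A.
  by have := conjgS (g := invmx g) AgA; rewrite conjg_inv.
have {}Zmin : D k.+1 = D k.
  apply: Zmin; first by exists k.+1.
  by elim: k => // k IH /=; exact: conjgS.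
have inj H H' : conjg (invmx g) H = conjg (invmx g) H' -> H = H'.
  by move=> /(congr1 (conjg g)); rewrite -{1 3}[g]invmxK !conjg_inv.
have : D 1%N = D 0%N.
  elim: k Zmin => // k IH Zmin; apply: IH; exact: inj.
by rewrite /D /= => /(congr1 (conjg g)); rewrite -{1}[g]invmxK conjg_inv // => <-.
Qed.

Section IdComp.
Context {n : nat} (H : set (zmat K n)).
Hypothesis gH : matrix_subgroup H.
Let H0 := identity_component H.

Lemma idcomp_sub : H0 `<=` H. Proof. exact: connected_component_sub. Qed.

Lemma idcomp1 : H0 1%:M.
Proof. by apply: connected_component_refl; case: gH. Qed.

Lemma idcomp_connected : connected H0. Proof. exact: component_connected. Qed.

Lemma idcomp_max (A : set (zmat K n)) : connected A -> A 1%:M -> A `<=` H -> A `<=` H0.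
Proof. by move=> cA A1 AH; exact: connected_component_max. Qed.

Lemma idcomp_subgroup : matrix_subgroup H0.
Proof.
have [HG H1 HM HV] := gH.
have key x y : H0 x -> H0 y -> H0 (invmx x *m y).
  move=> Hx Hy; have Hx' := idcomp_sub Hx.
  apply: (@idcomp_max (translate (invmx x) H0)).
  - apply: translate_connected; exact: idcomp_connected.
  - by exists x => //; rewrite mulVmx //; exact: HG.
  - move=> _ [z /idcomp_sub Hz <-]; apply: HM => //; exact: HV.
  - by exists y.
have inv x : H0 x -> H0 (invmx x).
  by move=> Hx; rewrite -[invmx x]mulmx1; apply: key => //; exact: idcomp1.
split=> //; first by move=> x /idcomp_sub /HG.
  exact: idcomp1.
by move=> x y Hx Hy; rewrite -[x]invmxK; apply: key => //; exact: inv.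
Qed.

Lemma idcomp_lclosed : lclosed H -> lclosed H0.
Proof.
move=> [C cC HC]; exists (closure H0); first exact: closed_closure.
apply/seteqP; split=> x.
  by move=> Hx; split; [exact: subset_closure|case: gH => + _ _ _; apply; exact: idcomp_sub].
move=> Hx; apply: (@idcomp_max (closure H0 `&` @GL n)) Hx.
- apply: (connected_between idcomp_connected) => [y Hy|y []//].
  by split; [exact: subset_closure|case: gH => + _ _ _; apply; exact: idcomp_sub].
- by split; [apply: subset_closure; exact: idcomp1|rewrite /GL /= unitmx1].
- move=> y [Hy Gy]; rewrite HC; split=> //; apply: cC; apply: closureS Hy => z /idcomp_sub.
  by rewrite HC => -[].
Qed.

End IdComp.

Lemma idcomp_algebraic n (H : set (zmat K n)) : algebraic_group H ->
  algebraic_group (identity_component H).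
Proof. by move=> [gH cH]; split; [exact: idcomp_subgroup|exact: idcomp_lclosed]. Qed.

Section Derived.
Context {n : nat}.
Implicit Types H : set (zmat K n).

Lemma derived_subgroup H : matrix_subgroup H -> matrix_subgroup (derived H).
Proof.
move=> gH; split.
- move=> x /(_ [set x | x \in unitmx]); apply; split.
    split; [by []|by rewrite /= unitmx1|by move=> y z /= uy uz; rewrite unitmx_mul uy|
      by move=> y /=; rewrite unitmx_inv].
  have [HG _ _ _] := gH.
  by move=> _ [y [z [/HG yu /HG zu ->]]]; rewrite /= !unitmx_mul !unitmx_inv yu zu.
- by move=> A [[_ + _ _] _].
- by move=> x y Hx Hy A HA; have [[a b c d] _] := HA; apply: c; [exact: Hx|exact: Hy].
- by move=> x Hx A HA; have [[a b c d] _] := HA; apply: d; exact: Hx.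
Qed.

Lemma derived_min H A : matrix_subgroup A -> commutators H `<=` A -> derived H `<=` A.
Proof. by move=> gA cA x; apply. Qed.

Lemma commutators_derived H : commutators H `<=` derived H.
Proof. by move=> x Hx A [_]; apply. Qed.

Lemma derived_sub H : matrix_subgroup H -> derived H `<=` H.
Proof.
move=> gH; apply: derived_min => //; have [HG H1 HM HV] := gH.
move=> _ [y [z [Hy Hz ->]]].
exact: HM (HM _ _ (HM _ _ Hy Hz) (HV _ Hy)) (HV _ Hz).
Qed.

(** The derived group is the abstract one. For fixed [y], the commutators of [z] and [y] with [z] in
    [H] form a connected set through 1, so every commutator lies in the identity component. *)
Lemma derived_connected H : matrix_subgroup H -> connected H -> connected (derived H).
Proof.
move=> gH cH; have gD := derived_subgroup gH.
suff -> : derived H = identity_component (derived H) by exact: component_connected.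
apply/seteqP; split; last exact: idcomp_sub.
apply: derived_min; first exact: idcomp_subgroup.
have [HG H1 HM HV] := gH.
move=> _ [x [y [Hx Hy ->]]].
pose F (z : zmat K n) : zmat K n := z *m y *m invmx z *m invmx y.
apply: (@idcomp_max _ _ (F @` H)).
- apply: connected_image => // z Hz; apply: regular_continuous.
  have r := regular_ring z.
  have rid : mx_in (regular_at z) (fun z : zmat K n => z : 'M_n).
    by move=> i j; apply: regular_poly; exact: polyfun_coord.
  apply: (mxinM r); last exact: (mxin_cst r).
  apply: (mxinM r); first by apply: (mxinM r) => //; exact: (mxin_cst r).
  by apply: regular_invmx => //; exact: HG.
- exists 1%:M => //; rewrite /F mul1mx invmx1 mulmx1 mulmxV //; exact: HG.
- by move=> _ [z Hz <-]; apply: commutators_derived; exists z, y.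
- by exists x.
Qed.

Lemma iter_derived_subgroup H k : matrix_subgroup H -> matrix_subgroup (iter k (@derived K n) H).
Proof. by move=> gH; elim: k => //= k; exact: derived_subgroup. Qed.

End Derived.

(** [F] is multiplicative only on [H], so the induction also records that the derived groups stay
    inside [H]. *)
Lemma solvable_image m n (F : zmat K m -> zmat K n) H : matrix_subgroup H ->
  F 1%:M = 1%:M ->
  (forall x y, H x -> H y -> F (x *m y) = F x *m F y) ->
  matrix_subgroup (F @` H) /\ (solvable_group H -> solvable_group (F @` H)).
Proof.
move=> gH F1 FM.
have FV A x : matrix_subgroup A -> A `<=` H -> A x ->
    F x \in unitmx /\ invmx (F x) = F (invmx x).
  move=> [HG H1 HM HV] AH Ax; have e : F x *m F (invmx x) = 1%:M.
    by rewrite -FM ?mulmxV ?F1 //; [exact: HG|exact: AH|apply: AH; exact: HV].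
  have uF : F x \in unitmx by have [] := mulmx1_unit e.
  by split=> //; apply: (can_inj (mulKmx uF)); rewrite mulmxV.
have gF A : matrix_subgroup A -> A `<=` H -> matrix_subgroup (F @` A).
  move=> gA AH; have [HG H1 HM HV] := gA; split.
  - by move=> _ [x Ax <-]; have [] := FV A x gA AH Ax.
  - by exists 1%:M.
  - by move=> _ _ [x Ax <-] [y Ay <-]; exists (x *m y); [exact: HM|rewrite FM //; exact: AH].
  - by move=> _ [x Ax <-]; have [_ ->] := FV A x gA AH Ax; exists (invmx x) => //; exact: HV.
split; first by apply: gF.
move=> [k Hk]; exists k.
have sub j : matrix_subgroup (iter j (@derived K n) (F @` H)) /\
    iter j (@derived K n) (F @` H) `<=` F @` (iter j (@derived K m) H) /\
    iter j (@derived K m) H `<=` H.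
  elim: j => [|j [gj [IH IH']]] /=; first by split; [exact: (gF H gH (@subset_refl _ H))|split].
  have gjH := iter_derived_subgroup j gH.
  split; first exact: derived_subgroup.
  split; last by apply: subset_trans IH'; exact: derived_sub.
  apply: derived_min.
    apply: gF; first exact: derived_subgroup.
    by apply: subset_trans IH'; exact: derived_sub.
  move=> _ [_ [_ [/IH[x Hx <-] /IH[y Hy <-] ->]]].
  have [_ ->] := FV _ x gjH IH' Hx; have [_ ->] := FV _ y gjH IH' Hy.
  have [HG H1 HM HV] := gjH; set A := iter j _ H in Hx Hy HG H1 HM HV IH'.
  exists (x *m y *m invmx x *m invmx y); first by apply: commutators_derived; exists x, y.
  have [Hxy Hx' Hy'] : [/\ A (x *m y), A (invmx x) & A (invmx y)].
    by split; [exact: HM|exact: HV|exact: HV].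
  by rewrite !FM //; apply: IH' => //; exact: HM.
have [[_ g1 _ _] [s _]] := sub k; apply/seteqP; split; last by move=> _ ->.
by move=> x /s[y]; rewrite Hk => -> <-; rewrite F1.
Qed.

Lemma solvable_sub n (H H' : set (zmat K n)) : matrix_subgroup H ->
  H `<=` H' -> solvable_group H' -> solvable_group H.
Proof.
move=> gH HH' [k Hk]; exists k; apply/seteqP; split; last first.
  by move=> _ ->; have [] := iter_derived_subgroup k gH.
rewrite -Hk; elim: k {Hk} => //= k IH x Hx A [gA cA]; apply: Hx; split=> //.
by apply: subset_trans cA => _ [y [z [/IH Hy /IH Hz ->]]]; exists y, z.
Qed.

Lemma conjg_solvable n (g : zmat K n) H : g \in unitmx -> matrix_subgroup H ->
  solvable_group H -> solvable_group (conjg g H).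
Proof.
move=> ug gH; have [||_] // := @solvable_image n n (fun h => g *m h *m invmx g) H gH.
  by rewrite mulmx1 mulmxV.
by move=> x y _ _; rewrite !mulmxA mulmxKV.
Qed.

End MatGroup.

(** * Triangular matrices and the Lie-Kolchin theorem *)

Section Upper.
Context {K : fieldType}.
Implicit Types n : nat.

Definition upper n (x : 'M[K]_n) := forall i j : 'I_n, (j < i)%N -> x i j = 0.

Definition Bn n : set (zmat K n) := [set x | upper x /\ x \in unitmx].

Lemma upperM n (x y : 'M[K]_n) : upper x -> upper y -> upper (x *m y).
Proof.
move=> ux uy i j ji; rewrite mxE big1 // => k _.
have [ki|ik] := ltnP k i; first by rewrite ux // mul0r.
by rewrite uy ?mulr0 //; exact: leq_trans ik.
Qed.

Lemma upperM_diag n (x y : 'M[K]_n) i : upper x -> upper y -> (x *m y) i i = x i i * y i i.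
Proof.
move=> ux uy; rewrite mxE (bigD1 i) //= big1 ?addr0 // => k ki.
have [lt|] := ltnP k i; first by rewrite ux // mul0r.
by rewrite leq_eqVlt eq_sym val_eqE (negbTE ki) /= => lt; rewrite uy // mulr0.
Qed.

Lemma upper1 n : upper (1%:M : 'M[K]_n).
Proof. by move=> i j ji; rewrite mxE -val_eqE gtn_eqF. Qed.

Lemma upper_det n (x : 'M[K]_n) : upper x -> \det x = \prod_i x i i.
Proof.
move=> ux; rewrite -det_tr det_trig; last first.
  by apply/is_trig_mxP => i j ij; rewrite mxE ux.
by apply: eq_bigr => i _; rewrite mxE.
Qed.

Lemma upper_unit n (x : 'M[K]_n) : upper x -> (x \in unitmx) = [forall i, x i i != 0].
Proof.
move=> ux; rewrite unitmxE unitfE upper_det //; by apply/prodf_neq0/forallP => H i; [exact: H|move=> _; exact: H].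
Qed.

Lemma upper_inv n (x : 'M[K]_n) : upper x -> upper (invmx x).
Proof.
move=> ux; have [xu|xnu] := boolP (x \in unitmx); last first.
  by rewrite /invmx (negbTE xnu).
move=> i j; have [d] : exists d, (n - i = d)%N by eexists.
elim/ltn_ind: d i => d IH i di ji.
have := congr1 (fun m : 'M_n => m i j) (mulmxV xu).
rewrite mxE (bigD1 i) //= big1 ?addr0.
  rewrite mxE -val_eqE (gtn_eqF ji) => /eqP; rewrite mulf_eq0 => /orP[/eqP xii|/eqP//].
  by move: xu; rewrite upper_unit // => /forallP/(_ i); rewrite xii eqxx.
move=> k ki; have [lt|] := ltnP k i; first by rewrite ux // mul0r.
rewrite leq_eqVlt eq_sym val_eqE (negbTE ki) /= => lt.
rewrite (IH (n - k)%N) ?mulr0 //; last exact: ltn_trans lt.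
by rewrite -di ltn_sub2l.
Qed.

Lemma upper_inv_diag n (x : 'M[K]_n) i : upper x -> x \in unitmx ->
  (invmx x) i i = (x i i)^-1.
Proof.
move=> ux xu; have := upperM_diag i ux (upper_inv ux).
rewrite mulmxV // mxE eqxx mulr1n.
move: xu; rewrite upper_unit // => /forallP/(_ i) xi.
by move=> H; apply: (mulfI xi); rewrite -H mulfV.
Qed.

Lemma Bn_subgroup n : matrix_subgroup (@Bn n).
Proof.
split; first by move=> x [].
- by split; [exact: upper1|exact: unitmx1].
- by move=> x y [ux xu] [uy yu]; split; [exact: upperM|rewrite unitmx_mul xu].
- by move=> x [ux xu]; split; [exact: upper_inv|rewrite unitmx_inv].
Qed.

Lemma closed_upper n : closed [set x : zmat K n | upper x].
Proof.
rewrite (_ : mkset _ = [set x : zmat K n | forall ij : {ij : 'I_n * 'I_n | (ij.2 < ij.1)%N},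
    (x : 'M_n) (sval ij).1 (sval ij).2 = 0]).
  by apply: closed_all => ij; apply: closed_zero; exact: polyfun_coord.
apply/seteqP; split=> x /= H; first by move=> [[i j] /= ji]; exact: H.
by move=> i j ji; exact: (H (exist _ (i, j) ji)).
Qed.

Lemma Bn_lclosed n : lclosed (@Bn n).
Proof. by exists [set x : zmat K n | upper x]; first exact: closed_upper. Qed.

(** For [d = 0] the last condition only concerns entries below the diagonal and the group is [Bn];
    for [d > 0] the diagonal is 1 and the first [d - 1] superdiagonals vanish. *)
Definition ufilt n d : set (zmat K n) := [set x | [/\ x \in unitmx, upper x &
  forall i j : 'I_n, (j < i + d)%N -> x i j = (1%:M : 'M_n) i j]].

Lemma ufilt_gap n d (x y : 'M[K]_n) :
  (forall i j : 'I_n, (j < i + d)%N -> x i j = 0) -> upper y ->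
  (forall i j : 'I_n, (j < i + d)%N -> (x *m y) i j = 0) /\
  (forall i j : 'I_n, (j < i + d)%N -> (y *m x) i j = 0).
Proof.
move=> xd uy; split=> i j ij; rewrite mxE big1 // => k _.
  have [ki|ki] := ltnP k (i + d); first by rewrite xd // mul0r.
  by rewrite uy ?mulr0 //; exact: leq_trans ij _.
have [ki|ki] := ltnP k i; first by rewrite uy // mul0r.
by rewrite xd ?mulr0 //; apply: leq_trans ij _; rewrite leq_add2r.
Qed.

Lemma ufilt_subgroup n d : matrix_subgroup (@ufilt n d).
Proof.
split.
- by move=> x [].
- by split; [exact: unitmx1|exact: upper1|].
- move=> x y [xu ux xd] [yu uy yd]; split; [by rewrite unitmx_mul xu|exact: upperM|].
  have H : x *m y - 1%:M = (x - 1%:M) *m y + (y - 1%:M).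
    by rewrite mulmxBl mul1mx addrA subrK.
  have [|H1 _] := @ufilt_gap n d (x - 1%:M) y _ uy.
    by move=> i j ij; rewrite !mxE xd // mxE subrr.
  move=> i j ij; apply/eqP; rewrite -subr_eq0; apply/eqP.
  have := congr1 (fun m : 'M_n => m i j) H.
  rewrite [LHS]mxE [X in _ + X]mxE => ->.
  by rewrite mxE H1 // add0r !mxE yd // mxE subrr.
- move=> x [xu ux xd]; split; [by rewrite unitmx_inv|exact: upper_inv|].
  have H : invmx x - 1%:M = - ((x - 1%:M) *m invmx x).
    by rewrite mulmxBl mul1mx mulmxV // opprB.
  have [|H1 _] := @ufilt_gap n d (x - 1%:M) (invmx x) _ (upper_inv ux).
    by move=> i j ij; rewrite !mxE xd // mxE subrr.
  move=> i j ij; apply/eqP; rewrite -subr_eq0; apply/eqP.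
  have := congr1 (fun m : 'M_n => m i j) H.
  rewrite [LHS]mxE [X in _ + X]mxE => ->.
  by rewrite mxE H1 // oppr0.
Qed.

Lemma Bn_solvable n : solvable_group (@Bn n).
Proof.
have comm d x y : @ufilt n d x -> @ufilt n d y ->
    @ufilt n d.+1 (x *m y *m invmx x *m invmx y).
  move=> [xu ux xd] [yu uy yd].
  have uxy : upper (invmx x *m invmx y) by apply: upperM; exact: upper_inv.
  split; first by rewrite !unitmx_mul !unitmx_inv xu yu.
    by do ![apply: upperM => //]; exact: upper_inv.
  have H : x *m y *m invmx x *m invmx y - 1%:M =
      (x *m y - y *m x) *m (invmx x *m invmx y).
    by rewrite mulmxBl !mulmxA mulmxK // mulmxV.
  (* Each factor vanishes on the diagonals of index less than [d], so each product does up to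
     [2 * d], which is at least [d + 1] once [d > 0]. For [d = 0] it is enough that diagonal entries
     commute. *)
  have H0 : x *m y - y *m x = (x - 1%:M) *m (y - 1%:M) - (y - 1%:M) *m (x - 1%:M).
    by rewrite !mulmxBl !mulmxBr !mul1mx !mulmx1; apply/matrixP=> i j; rewrite !mxE; ring.
  have gap (a b : 'M[K]_n) : (0 < d)%N ->
      (forall i j : 'I_n, (j < i + d)%N -> a i j = 0) ->
      (forall i j : 'I_n, (j < i + d)%N -> b i j = 0) ->
      forall i j : 'I_n, (j < i + d.+1)%N -> (a *m b) i j = 0.
    move=> d0 ad bd i j ij; rewrite mxE big1 // => k _.
    have [ki|ki] := ltnP k (i + d); first by rewrite ad // mul0r.
    rewrite bd ?mulr0 //; apply: leq_trans ij _; rewrite addnS.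
    by apply: leq_trans (_ : (i + d + d <= _)%N); rewrite ?leq_add2r // -addn1 leq_add2l.
  have H1 (i j : 'I_n) : (j < i + d.+1)%N -> (x *m y - y *m x) i j = 0.
    case: d xd yd gap => [|d] xd yd gap ij.
      move: ij; rewrite addn1 ltnS leq_eqVlt => /orP[/eqP/val_inj->|ji].
        by rewrite mxE [X in _ + X]mxE !upperM_diag // mulrC subrr.
      by rewrite mxE [X in _ + X]mxE !upperM // subrr.
    have ad : forall i j : 'I_n, (j < i + d.+1)%N -> (x - 1%:M) i j = 0.
      by move=> i' j' ij'; rewrite !mxE xd // mxE subrr.
    have bd : forall i j : 'I_n, (j < i + d.+1)%N -> (y - 1%:M) i j = 0.
      by move=> i' j' ij'; rewrite !mxE yd // mxE subrr.
    by rewrite H0 mxE [X in _ + X]mxE !gap // subrr.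
  have [H2 _] := ufilt_gap H1 uxy.
  move=> i j ij; apply/eqP; rewrite -subr_eq0; apply/eqP.
  by have := H2 i j ij; rewrite -H mxE [X in _ + X]mxE.
have sub k : iter k (@derived K n) (@Bn n) `<=` @ufilt n k.
  elim: k => [|k IH] /=.
    by move=> x [ux xu]; split=> // i j; rewrite addn0 => ji; rewrite ux // upper1.
  apply: derived_min; first exact: ufilt_subgroup.
  by move=> _ [x [y [/IH Hx /IH Hy ->]]]; exact: comm.
exists n; apply/seteqP; split; last first.
  by move=> _ ->; have [] := iter_derived_subgroup n (@Bn_subgroup n).
move=> x /sub[_ _ H]; apply/matrixP => i j; apply: H.
exact: leq_trans (ltn_ord j) (leq_addl _ _).
Qed.

Lemma upper_block n (a : 'M[K]_1) (r : 'rV_n) (d : 'M_n) :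
  upper (block_mx a r 0 d : 'M_(1 + n)) <-> upper d.
Proof.
split=> H i j ji.
  have := H (rshift 1 i) (rshift 1 j); rewrite block_mxEdr; apply.
  by rewrite /= ltn_add2l.
move: ji; case: (split_ordP i) => i' ->; case: (split_ordP j) => j' -> ji.
- by move: ji; rewrite !ord1.
- by move: ji; rewrite ord1 /= .
- by rewrite block_mxEdl mxE.
- by rewrite block_mxEdr H // -(ltn_add2l 1).
Qed.

End Upper.

Section LinSet.
Context {K : fieldType} {n : nat}.

(** [W] has maximal rank among the matrices whose row space lies in [E]. *)
Lemma linear_set_mx (E : 'rV[K]_n -> Prop) :
  E 0 -> (forall a u v, E u -> E v -> E (a *: u + v)) ->
  exists W : 'M[K]_n, forall v, (v <= W)%MS <-> E v.
Proof.
move=> E0 EL.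
pose inE (W : 'M[K]_n) := forall v : 'rV_n, (v <= W)%MS -> E v.
have ex : exists k, `[< exists2 W : 'M[K]_n, inE W & \rank W = k >].
  exists 0%N; apply/asboolP; exists 0; last by rewrite mxrank0.
  by move=> v; rewrite submx0 => /eqP->.
have bd k : `[< exists2 W : 'M[K]_n, inE W & \rank W = k >] -> (k <= n)%N.
  by move=> /asboolP[W _ <-]; exact: rank_leq_row.
case: (ex_maxnP ex bd) => k /asboolP[W WE rW] maxk; exists W => v; split; first exact: WE.
move=> Ev; apply: contrapT => /negP nvW.
suff : (\rank (W + v)%MS <= k)%N.
  apply/negP; rewrite -ltnNge -rW; apply: rank_ltmx.
  rewrite ltmxE addsmxSl /=; apply: contra nvW; apply: submx_trans; exact: addsmxSr.
apply: maxk; apply/asboolP; exists (W + v)%MS => //.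
move=> u /sub_addsmxP[[w c] /= ->].
rewrite addrC; case: (mx11_scalar c) => ?.
by rewrite (mx11_scalar c) mul_scalar_mx; apply: EL => //; apply: WE; exact: submxMl.
Qed.

End LinSet.

Section LK.
Context {C : numClosedFieldType}.

Lemma poly_roots (p : {poly C}) : p != 0 -> exists s : seq C, forall x, root p x -> x \in s.
Proof.
move=> p0; have [r Hr] := closed_field_poly_normal p; exists r => x.
by rewrite Hr rootZ ?lead_coef_eq0 // root_prod_XsubC.
Qed.

Lemma spectrum_finite n (f : 'M[C]_n) : exists s : seq C, forall v a,
  v != 0 :> 'rV_n -> v *m f = a *: v -> a \in s.
Proof.
have [|s Hs] := @poly_roots (char_poly f); first exact: monic_neq0 (char_poly_monic f).
exists s => v a v0 vf; apply: Hs; rewrite -eigenvalue_root_char.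
by apply/eigenvalueP; exists v.
Qed.

Lemma stable_eigenvector n (W f : 'M[C]_n) : W != 0 -> stablemx W f ->
  exists v a, [/\ v != 0 :> 'rV_n, (v <= W)%MS & v *m f = a *: v].
Proof.
move=> W0 st; pose V := row_base W.
have stV : stablemx V f by rewrite stablemx_row_base.
have fV : row_free V by exact: row_base_free.
have [|a /eigenvalueP[w wf w0]] := eigenvalue_closed (conjmx V f); first by rewrite lt0n mxrank_eq0.
exists (w *m V), a; split.
- by rewrite mulmx_free_eq0.
- by apply: submx_trans (submxMl _ _) _; rewrite eq_row_base.
have : (w <= eigenspace (conjmx V f) a)%MS by apply/eigenspaceP.
by rewrite sub_eigenspace_conjmx // => /eigenspaceP.
Qed.

(** Commutation is demanded on [W] only, since in the application it holds just on a weight space.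
    If some [q] is not scalar on [W], one of its eigenspaces cuts [W] down to a smaller space stable
    under all of [Q]. *)
Lemma commuting_eigenvector n (Q : set (zmat C n)) (W : 'M[C]_n) : W != 0 ->
  (forall q, Q q -> stablemx W q) ->
  (forall q q' (v : 'rV_n), Q q -> Q q' -> (v <= W)%MS -> v *m q *m q' = v *m q' *m q) ->
  exists v, [/\ v != 0 :> 'rV_n, (v <= W)%MS & forall q, Q q -> exists a, v *m q = a *: v].
Proof.
have [k] : exists k, \rank W = k by eexists.
elim/ltn_ind: k W => k IH W rW W0 st comm.
have [sc|/existsNP[q /not_implyP[Qq nsc]]] :=
    pselect (forall q, Q q -> exists a, (W <= eigenspace q a)%MS).
  have /rowV0Pn[v vW v0] := W0.
  exists v; split=> // q /sc[a Wa]; exists a.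
  by apply/eigenspaceP; exact: submx_trans Wa.
have [v [a [v0 vW vq]]] := stable_eigenvector W0 (st _ Qq).
have vW' : (v <= W :&: eigenspace q a)%MS by rewrite sub_capmx vW; apply/eigenspaceP.
have [||||w [w0 wW Hw]] := IH _ _ (W :&: eigenspace q a)%MS erefl.
- rewrite -rW; apply: rank_ltmx; rewrite ltmxE capmxSl /=.
  by apply/negP; rewrite sub_capmx => /andP[_ H]; apply: nsc; exists a.
- by apply: contra_neq v0 => W'0; apply/eqP; rewrite -submx0 -W'0.
- move=> q' Qq'; apply/row_subP => i; rewrite row_mul.
  have := row_sub i (W :&: eigenspace q a)%MS; rewrite sub_capmx => /andP[uW /eigenspaceP uq].
  rewrite sub_capmx; apply/andP; split.
    by apply: submx_trans (st _ Qq'); exact: submxMr.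
  by apply/eigenspaceP; rewrite comm // uq scalemxAl.
- move=> q1 q2 u Q1 Q2; rewrite sub_capmx => /andP[uW _]; exact: comm.
by exists w; split=> //; apply: submx_trans wW _; exact: capmxSl.
Qed.

(** Induction on the derived length: the derived group has an eigenvector, with character [psi].
    Connectedness of [Q] makes [psi] invariant under conjugation, so that the weight space is
    [Q]-stable, and makes the commutators act trivially there, so that [Q] commutes on it. *)
Lemma lie_kolchin_row k n (Q : set (zmat C n)) : (0 < n)%N -> matrix_subgroup Q ->
  connected Q -> iter k (@derived C n) Q = [set 1%:M] ->
  exists2 v : 'rV_n, v != 0 & forall q, Q q -> exists a, v *m q = a *: v.
Proof.
move=> n0; elim: k Q => [|k IH] Q gQ cQ.
  move=> /= ->; exists (const_mx 1).
    by apply/negP => /eqP/rowP/(_ (Ordinal n0)); rewrite !mxE => /eqP; rewrite oner_eq0.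
  by move=> _ ->; exists 1; rewrite mulmx1 scale1r.
rewrite iterSr => /IH[||v0 v00 Hv0]; [exact: derived_subgroup|exact: derived_connected|].
have [QG Q1 QM QV] := gQ.
have HD p : exists a, derived Q p -> v0 *m p = a *: v0.
  by have [/Hv0[a Ha]|] := pselect (derived Q p); [exists a|exists 0].
have {HD} [psi Hpsi] := choice HD.
have psi_eq p a : derived Q p -> v0 *m p = a *: v0 -> psi p = a.
  move=> Dp e; have := Hpsi p Dp; rewrite e => /eqP.
  by rewrite -subr_eq0 -scalerBl scaler_eq0 (negbTE v00) orbF subr_eq0 => /eqP.
have psi_label (A : set (zmat C n)) (s : seq C) : connected A -> A `<=` derived Q ->
    (forall x, A x -> psi x \in s) -> forall x y, A x -> A y -> psi x = psi y.
  move=> cA AD As x y Ax Ay; apply: (connected_label cA As) => // t.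
  exists [set p : zmat C n | v0 *m p = t *: v0].
    have r := @polyfun_ring C n; apply: closed_mxeq; last exact: (mxin_cst r).
    by apply: (mxinM r); [exact: (mxin_cst r)|exact: mxin_id].
  apply/seteqP; split=> p [Ap /= H]; split=> //=.
    by rewrite -H; apply: Hpsi; exact: AD.
  by apply: psi_eq => //; exact: AD.
have rid (z : zmat C n) : mx_in (regular_at z) (fun z : zmat C n => z : 'M_n).
  by move=> i j; apply: regular_poly; exact: polyfun_coord.
have DQ : derived Q `<=` Q by exact: derived_sub.
(* [v0 *m x] is an eigenvector of [p] with eigenvalue [psi (x *m p *m invmx x)]; as [x] runs through
   the connected [Q], this value stays in the finite spectrum of [p]. *)
have psi_conj p q : derived Q p -> Q q ->
    derived Q (q *m p *m invmx q) /\ psi (q *m p *m invmx q) = psi p.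
  move=> Dp Qq; have Dconj x : Q x -> derived Q (x *m p *m invmx x).
    move=> Qx; have -> : x *m p *m invmx x = (x *m p *m invmx x *m invmx p) *m p.
      by rewrite mulmxKV //; apply: QG; exact: DQ.
    have [_ _ DM _] := derived_subgroup gQ; apply: DM => //; apply: commutators_derived.
    by exists x, p; split=> //; exact: DQ.
  split; first exact: Dconj.
  have [s Hs] := spectrum_finite p.
  pose F (x : zmat C n) : zmat C n := x *m p *m invmx x.
  apply: (psi_label (F @` Q) s).
  - apply: connected_image => // x Qx; apply: regular_continuous.
    have r := regular_ring x.
    apply: (mxinM r); first by apply: (mxinM r) => //; exact: (mxin_cst r).
    by apply: regular_invmx => //; exact: QG.
  - by move=> _ [x Qx <-]; exact: Dconj.
  - move=> _ [x Qx <-]; have xu := QG _ Qx.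
    apply: (Hs (v0 *m x)).
      by apply: contra_neq v00 => /(congr1 (mulmx^~ (invmx x))); rewrite mul0mx mulmxK.
    by have := Hpsi _ (Dconj _ Qx); rewrite /F -[in LHS]mulmxA => /(congr1 (mulmx^~ x));
      rewrite -scalemxAl !mulmxA mulmxKV.
  - by exists q.
  - by exists 1%:M => //; rewrite /F mul1mx invmx1 mulmx1.
pose E (v : 'rV[C]_n) := forall p, derived Q p -> v *m p = psi p *: v.
have [||W HW] := @linear_set_mx C n E.
- by move=> p _; rewrite mul0mx scaler0.
- move=> a u v Eu Ev p Dp; rewrite mulmxDl -scalemxAl Eu // Ev // scalerDr.
  by rewrite !scalerA mulrC.
have stE v q : E v -> Q q -> E (v *m q).
  move=> Ev Qq p Dp; have [Dp' e] := psi_conj p q Dp Qq.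
  have := Ev _ Dp'; rewrite e => /(congr1 (mulmx^~ q)).
  by rewrite -scalemxAl !mulmxA mulmxKV //; exact: QG.
have W0 : W != 0.
  have /HW : E v0 by move=> p /Hpsi.
  by apply: contraTneq => ->; rewrite submx0.
have stW q : Q q -> stablemx W q.
  move=> Qq; apply/row_subP => i; rewrite row_mul; apply/HW; apply: stE => //.
  by apply/HW; exact: row_sub.
have comm q q' (v : 'rV_n) : Q q -> Q q' -> (v <= W)%MS ->
    v *m q *m q' = v *m q' *m q.
  move=> Qq Qq' /HW Ev.
  pose F (x : zmat C n) : zmat C n := q *m x *m invmx q *m invmx x.
  have DF x : Q x -> derived Q (F x) by move=> Qx; apply: commutators_derived; exists q, x.
  have FE x u : Q x -> E u -> u *m q *m x = psi (F x) *: (u *m x *m q).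
    move=> Qx Eu; rewrite !scalemxAl -Eu; last exact: DF.
    by rewrite /F !mulmxA !mulmxKV //; exact: QG.
  (* For an eigenvector [w] of [q] with eigenvalue [a], [w *m x] is one with eigenvalue
     [a / psi (F x)]. The spectrum of [q] is finite, so [psi (F x)] does not depend on [x], and it
     is 1 at [x = 1]. *)
  suff psi1 : psi (F q') = 1 by rewrite FE // psi1 scale1r.
  have [w [a [w0 /HW Ew wq]]] := stable_eigenvector W0 (stW _ Qq).
  have a0 : a != 0.
    apply: contra_neq w0 => a0; move: wq; rewrite a0 scale0r.
    by move=> /(congr1 (mulmx^~ (invmx q))); rewrite mul0mx mulmxK //; exact: QG.
  have [s Hs] := spectrum_finite q.
  have psi0 x : Q x -> psi (F x) != 0.
    move=> Qx; apply: contra_neq v00 => e; have := Hpsi _ (DF _ Qx).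
    rewrite e scale0r => /(congr1 (mulmx^~ (invmx (F x)))); rewrite mul0mx mulmxK //.
    by apply: QG; apply: DQ; exact: DF.
  have D1 : derived Q 1%:M by have [] := derived_subgroup gQ.
  have -> : psi (F q') = psi 1%:M; last by apply: psi_eq; rewrite ?mulmx1 ?scale1r.
  apply: (psi_label (F @` Q) [seq a / b | b <- s]).
  - apply: connected_image => // x Qx; apply: regular_continuous.
    have r := regular_ring x.
    apply: (mxinM r); last by apply: regular_invmx => //; exact: QG.
    apply: (mxinM r); last exact: (mxin_cst r).
    by apply: (mxinM r) => //; exact: (mxin_cst r).
  - by move=> _ [x Qx <-]; exact: DF.
  - move=> _ [x Qx <-]; apply/mapP; exists (a / psi (F x)); last first.
      by rewrite invf_div mulrCA mulfV ?mulr1.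
    apply: (Hs (w *m x)).
      by apply: contra_neq w0 => /(congr1 (mulmx^~ (invmx x))); rewrite mul0mx mulmxK //; exact: QG.
    have := FE x w Qx Ew; rewrite wq -scalemxAl mulrC -scalerA => ->.
    by rewrite scalerA mulVf ?scale1r //; exact: psi0.
  - by exists q'.
  - by exists 1%:M => //; rewrite /F mulmx1 invmx1 mulmx1 mulmxV //; exact: QG.
have [v [v0' _ Hv]] := commuting_eigenvector W0 stW comm.
by exists v.
Qed.

Lemma lie_kolchin_col n (Q : set (zmat C n)) : (0 < n)%N -> matrix_subgroup Q ->
  connected Q -> solvable_group Q ->
  exists2 v : 'cV_n, v != 0 & forall q, Q q -> exists a, q *m v = a *: v.
Proof.
move=> n0 gQ cQ sQ; have [QG Q1 QM QV] := gQ.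
pose F (x : zmat C n) : zmat C n := (invmx x)^T.
have [|x y Qx Qy|gF /(_ sQ)[k Hk]] := @solvable_image C n n F Q gQ.
- by rewrite /F invmx1 trmx1.
- by rewrite /F invmxM ?trmx_mul //; exact: QG.
have [|v v0 Hv] := lie_kolchin_row n0 gF _ Hk.
  apply: connected_image => // x Qx; apply: regular_continuous => i j.
  under eq_fun do rewrite mxE; apply: regular_invmx; last exact: QG.
  by move=> a b; apply: regular_poly; exact: polyfun_coord.
exists v^T; first by rewrite trmx_eq0.
move=> q Qq; have [|a Ha] := Hv (F (invmx q)); first by exists (invmx q) => //; exact: QV.
exists a; apply: trmx_inj; rewrite trmx_mul linearZ /= !trmxK -Ha /F invmxK //.
Qed.

(** In the rank decomposition of a nonzero column the right factor is a nonzero scalar, so the first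
    column of the invertible left factor is proportional to [v]. *)
Lemma complete_column n (v : 'cV[C]_n.+1) : v != 0 ->
  exists2 g : 'M_n.+1, g \in unitmx & exists2 a, a != 0 & forall i, g i ord0 = a * v i ord0.
Proof.
move=> v0; exists (col_ebase v); first exact: col_ebase_unit.
have ru := row_ebase_unit v.
have r1 : \rank v = 1%N.
  by apply/eqP; rewrite eqn_leq rank_leq_col lt0n mxrank_eq0.
have := mulmx_ebase v; rewrite r1 (mx11_scalar (row_ebase v)) mul_mx_scalar => e.
set b := row_ebase v 0 0 in e.
have b0 : b != 0 by move: ru; rewrite unitmxE unitfE det_mx11.
exists b^-1; first by rewrite invr_eq0.
move=> i; have := congr1 (fun m : 'cV_n.+1 => m i ord0) e.
rewrite !mxE => <-; rewrite mulKf // (bigD1 ord0) //= big1 ?addr0; first by rewrite !mxE /= mulr1.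
by move=> k; rewrite -val_eqE => /negbTE /= k0; rewrite mxE /= k0 mulr0.
Qed.

Lemma block_lower0 n (q : 'M[C]_(1 + n)) : (forall i, q (rshift 1 i) ord0 = 0) ->
  q = block_mx (ulsubmx q) (ursubmx q) 0 (drsubmx q).
Proof.
move=> H; rewrite -[LHS]submxK; congr block_mx.
apply/matrixP => i j; rewrite !mxE ord1 -[RHS](H i); congr (q _ _); exact/val_inj.
Qed.

End LK.

(** * Images of closed sets *)

Section QE.
Context {C : numClosedFieldType}.

(** A weak form of constructibility: on some nonempty principal open part of [Y], membership in [E]
    is constant. As [Y] may be reducible, this part need not be dense. *)
Definition decides n (Y E : set (zmat C n)) := exists2 p, polyfun p &
  (exists2 y, Y y & p y != 0) /\
  ((forall y, Y y -> p y != 0 -> E y) \/ (forall y, Y y -> p y != 0 -> ~ E y)).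

Lemma rterm_polyfun n (env : zmat C n -> seq C) t :
  (forall k, polyfun (fun x => (env x)`_k)) -> GRing.rterm t ->
  polyfun (fun x => GRing.eval (env x) t).
Proof.
move=> penv; have r := @polyfun_ring C n; elim: t => //=.
- by move=> x _; exact: frC r _.
- by move=> k _; exact: frC r _.
- by move=> t1 IH1 t2 IH2 /andP[/IH1 p1 /IH2 p2]; exact: (frD r).
- by move=> t IH /IH; exact: (frN r).
- move=> t IH k /IH p1; under eq_fun do rewrite -mulr_natr.
  by apply: (frM r) => //; exact: frC r _.
- by move=> t1 IH1 t2 IH2 /andP[/IH1 p1 /IH2 p2]; exact: (frM r).
- by move=> t IH k /IH; exact: (fr_exp r).
Qed.

(** An equation is decided by the difference of its sides if this is nonzero somewhere on [Y], and
    by 1 otherwise. For a binary connective the second formula is decided inside the part of [Y]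
    found for the first, and the two polynomials are multiplied. *)
Lemma qf_decides n (env : zmat C n -> seq C) (f : GRing.formula C) (Y : set (zmat C n)) :
  (forall k, polyfun (fun x => (env x)`_k)) ->
  GRing.qf_form f -> GRing.rformula f -> Y !=set0 ->
  decides Y [set y | GRing.qf_eval (env y) f].
Proof.
move=> penv; have r := @polyfun_ring C n.
have one : polyfun (fun _ : zmat C n => 1) by exact: frC r _.
have comb f1 f2 g (op : bool -> bool -> bool) :
    (forall Y, GRing.qf_form f1 -> GRing.rformula f1 -> Y !=set0 ->
       decides Y [set y | GRing.qf_eval (env y) f1]) ->
    (forall Y, GRing.qf_form f2 -> GRing.rformula f2 -> Y !=set0 ->
       decides Y [set y | GRing.qf_eval (env y) f2]) ->
    (forall e, GRing.qf_eval e g = op (GRing.qf_eval e f1) (GRing.qf_eval e f2)) ->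
    forall Y, GRing.qf_form f1 && GRing.qf_form f2 -> GRing.rformula f1 && GRing.rformula f2 ->
    Y !=set0 -> decides Y [set y | GRing.qf_eval (env y) g].
  move=> D1 D2 gE Y' /andP[q1 q2] /andP[r1 r2] Y0.
  have [p1 pp1 [[y1 Yy1 p1y] H1]] := D1 Y' q1 r1 Y0.
  have [|p2 pp2 [[y [Yy p1y'] p2y] H2]] := D2 (Y' `&` [set y | p1 y != 0]) q2 r2.
    by exists y1.
  exists (fun x => p1 x * p2 x); first exact: (frM r).
  split; first by exists y => //; rewrite mulf_neq0.
  have [b1 Hb1] : exists b, forall y, Y' y -> p1 y != 0 -> GRing.qf_eval (env y) f1 = b.
    case: H1 => H; [exists true|exists false] => z Yz pz; first exact: H.
    by apply/negP; exact: H.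
  have [b2 Hb2] : exists b, forall y, Y' y -> p1 y != 0 -> p2 y != 0 -> GRing.qf_eval (env y) f2 = b.
    case: H2 => H; [exists true|exists false] => z Yz p1z p2z; first by apply: H => //; split.
    by apply/negP; apply: H => //; split.
  have Hg z : Y' z -> p1 z * p2 z != 0 -> GRing.qf_eval (env z) g = op b1 b2.
    by rewrite mulf_eq0 negb_or => Yz /andP[p1z p2z]; rewrite gE Hb1 // Hb2.
  case e : (op b1 b2); [left|right] => z Yz pz /=; by rewrite Hg // e.
elim: f Y => //=.
- move=> b Y _ _ [y Yy]; exists (fun=> 1) => //; split; first by exists y => //; exact: oner_neq0.
  by case: b; [left|right] => z _ _ /=.
- move=> t1 t2 Y _ /andP[r1 r2] [y Yy].
  pose g x := GRing.eval (env x) t1 - GRing.eval (env x) t2.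
  have pg : polyfun g by apply: (frB r); exact: rterm_polyfun.
  have [[z [Yz gz]]|H] := pselect (exists z, Y z /\ g z != 0).
    exists g => //; split; first by exists z.
    by right => x _; rewrite /g subr_eq0 /= => /negbTE->.
  exists (fun=> 1) => //; split; first by exists y => //; exact: oner_neq0.
  left=> x Yx _ /=; rewrite -subr_eq0; apply/negPn/negP => gx; apply: H; by exists x.
- by move=> f1 IH1 f2 IH2; apply: (comb f1 f2 (GRing.And f1 f2) andb).
- by move=> f1 IH1 f2 IH2; apply: (comb f1 f2 (GRing.Or f1 f2) orb).
- by move=> f1 IH1 f2 IH2; apply: (comb f1 f2 (GRing.Implies f1 f2) implb).
- move=> f IH Y qf rf Y0; have [p pp [ex H]] := IH Y qf rf Y0.
  exists p => //; split=> //; case: H => H; [right|left] => z Yz pz /=.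
    by have /= -> := H z Yz pz.
  by apply/negP; exact: H.
Qed.

Lemma holds_decides n (env : zmat C n -> seq C) (f : GRing.formula C) (Y : set (zmat C n)) :
  (forall k, polyfun (fun x => (env x)`_k)) -> GRing.rformula f -> Y !=set0 ->
  decides Y [set y | GRing.holds (env y) f].
Proof.
move=> penv rf Y0.
have ax : GRing.closed_field_axiom C := @solve_monicpoly C.
pose qe := GRing.quantifier_elim (@ClosedFieldQE.ex_elim C).
have wf := @ClosedFieldQE.wf_ex_elim C.
have ok := ClosedFieldQE.holds_ex_elim ax.
have /andP[q1 q2] := GRing.quantifier_elim_wf wf rf.
rewrite (_ : mkset _ = [set y | GRing.qf_eval (env y) (qe f)]); first exact: qf_decides.
by apply/seteqP; split=> y /= /(GRing.quantifier_elim_rformP wf ok (env y) rf).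
Qed.

(** The variables below [N] are left to the parameters of a formula; those from [N] on stand for the
    quantified point. *)
Definition mpoly_term (N M : nat) (p : mpoly M C) : GRing.term C :=
  foldr GRing.Add (GRing.NatConst _ 0)
    [seq GRing.Mul (GRing.Const (mcoeff m p))
       (foldr GRing.Mul (GRing.NatConst _ 1)
          [seq GRing.Exp (GRing.Var _ (N + i)) (m i) | i : 'I_M <- enum 'I_M]) | m <- msupp p].

Lemma mpoly_termE N M (p : mpoly M C) e :
  GRing.eval e (mpoly_term N p) = meval (fun k => e`_(N + k)) p.
Proof.
rewrite mevalE /mpoly_term; elim: (msupp p : seq _) => [|m s IH] /=.
  by rewrite big_nil.
rewrite big_cons IH; congr (_ * _ + _); rewrite -big_enum /=.
by elim: (enum 'I_M) => [|i l IHl] /=; rewrite ?big_nil // big_cons IHl.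
Qed.

Lemma mpoly_term_r N M (p : mpoly M C) : GRing.rterm (mpoly_term N p).
Proof.
rewrite /mpoly_term; elim: (msupp p : seq _) => //= m s ->; rewrite andbT.
by elim: (enum 'I_M) => //=.
Qed.

Lemma conj_map_holds (T : eqType) (e : seq C) (F : T -> GRing.formula C) (s : seq T) :
  GRing.holds e (foldr GRing.And (GRing.Bool true) (map F s)) <->
  forall x, x \in s -> GRing.holds e (F x).
Proof.
elim: s => [|x s IH] /=; first by split.
split; first by move=> [Fx /IH H] y; rewrite inE => /orP[/eqP->|/H].
move=> H; split; first by apply: H; exact: mem_head.
by apply/IH => y ys; apply: H; rewrite inE ys orbT.
Qed.

Lemma conj_map_r (T : eqType) (F : T -> GRing.formula C) (s : seq T) :
  (forall x, GRing.rformula (F x)) ->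
  GRing.rformula (foldr GRing.And (GRing.Bool true) (map F s)).
Proof. by move=> H; elim: s => //= x s ->; rewrite H. Qed.

(** A weak Chevalley theorem: [D] is cut out by finitely many polynomials, so its image is defined
    by an existential formula, and quantifiers can be eliminated over an algebraically closed
    field. *)
Lemma image_decides m n (D : set (zmat C m)) (F : zmat C m -> zmat C n) (Y : set (zmat C n)) :
  closed D -> mx_in (@polyfun C m) F -> Y !=set0 -> decides Y (F @` D).
Proof.
move=> cD pF Y0; have [L DL] := closed_finite cD.
have [q Hq] : exists q : 'I_(n * n) -> mpoly (m * m) C, forall x k,
    mxvec (F x : 'M_n) 0 k = mxeval x (q k).
  have H k : exists q : mpoly (m * m) C, forall x, mxvec (F x : 'M_n) 0 k = mxeval x q.
    by case/mxvec_indexP: k => i j; have [q Hq] := pF i j; exists q => x; rewrite mxvecE Hq.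
  by have [q Hq] := choice H; exists q.
set N := (n * n)%N; set M := (m * m)%N.
pose env (y : zmat C n) : seq C := [tuple mxvec (y : 'M_n) 0 k | k < N].
have env_lt y (k : 'I_N) : (env y)`_k = mxvec (y : 'M_n) 0 k.
  by rewrite /env -tnth_nth tnth_mktuple.
pose f := foldr GRing.Exists
  (GRing.And
    (foldr GRing.And (GRing.Bool true) [seq GRing.Equal (mpoly_term N p) (GRing.NatConst _ 0) | p <- L])
    (foldr GRing.And (GRing.Bool true)
       [seq GRing.Equal (mpoly_term N (q k)) (GRing.Var _ (k : nat)) | k : 'I_N <- enum 'I_N]))
  (iota N M).
have -> : F @` D = [set y | GRing.holds (env y) f].
  apply/seteqP; split=> y /=.
    move=> [x Dx <-]; apply/GRing.foldExistsP.
    exists (env (F x) ++ [tuple mxvec (x : 'M_m) 0 k | k < M]).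
      move=> k; rewrite !inE mem_iota negb_and -ltnNge -leqNgt => Hk.
      rewrite nth_cat size_tuple; case: ltnP => // Nk.
      move: Hk; rewrite ltnNge Nk /= => Hk.
      rewrite [LHS]nth_default ?size_tuple // nth_default // size_tuple.
      by rewrite leq_subRL ?card_ord.
    have ev p : GRing.eval (env (F x) ++ [tuple mxvec (x : 'M_m) 0 k | k < M]) (mpoly_term N p)
        = mxeval x p.
      rewrite mpoly_termE /mxeval; apply: meval_eq => k.
      rewrite nth_cat size_tuple addKn -[X in if _ then _ else X]tnth_nth tnth_mktuple.
      by rewrite ltnNge leq_addr.
    split; apply/conj_map_holds.
      by move=> p pL /=; rewrite ev; move: Dx; rewrite DL; apply.
    move=> k _ /=; rewrite ev -Hq nth_cat size_tuple ltn_ord.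
    by rewrite env_lt.
  move=> /GRing.foldExistsP[e eE [/conj_map_holds H1 /conj_map_holds H2]].
  pose x : zmat C m := vec_mx (\row_k e`_(N + k)).
  have ev p : GRing.eval e (mpoly_term N p) = mxeval x p.
    by rewrite mpoly_termE /mxeval; apply: meval_eq => k; rewrite vec_mxK mxE.
  exists x; first by rewrite DL => p pL; have /= := H1 p pL; rewrite ev.
  apply: (can_inj mxvecK); apply/rowP => k.
  have /= := H2 k; rewrite mem_enum ev -Hq => -> //.
  rewrite -env_lt -eE // !inE mem_iota negb_and -ltnNge ltn_ord //.
apply: holds_decides => //.
- move=> k; have [kN|Nk] := ltnP k N.
    under eq_fun do rewrite (env_lt _ (Ordinal kN)).
    by case/mxvec_indexP: (Ordinal kN) => i j; under eq_fun do rewrite mxvecE; exact: polyfun_coord.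
  under eq_fun do rewrite nth_default ?size_tuple //.
  exact: frC (@polyfun_ring C n) _.
- rewrite /f; elim: (iota N M) => //=.
  apply/andP; split; apply: conj_map_r => z /=; rewrite mpoly_term_r //.
Qed.

End QE.

(** * Compactness of the flag variety *)

Section QR.
Context {C : numClosedFieldType}.

(** Gram-Schmidt on the columns of [z]: every flag is represented by a unitary matrix. *)
Lemma qr_upper n (z : 'M[C]_n) : z \in unitmx -> exists b : 'M[C]_n,
  [/\ upper b, b \in unitmx, forall i j, `|(z *m b) i j| <= 1 & `|\det (z *m b)| = 1].
Proof.
move=> zu; pose Q := schmidt z^T.
have uQ : Q \is unitarymx by exact: schmidt_unitarymx.
have Qu : Q \in unitmx by exact: unitarymx_unit.
pose L := z^T *m invmx Q.
have LQ : L *m Q = z^T by rewrite mulmxKV.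
have Lu : L \in unitmx by rewrite unitmx_mul unitmx_tr zu unitmx_inv.
have uL : upper L^T.
  move=> i j ji; rewrite mxE.
  have /sub_kermxP : (row j z^T <= kermx (col i (invmx Q)))%MS.
    apply: submx_trans (row_schmidt_sub _ _) _; apply/sumsmx_subP => k kj.
    rewrite genmxE; apply/sub_kermxP.
    rewrite rowE colE mulmxA -[_ *m Q *m _]mulmxA mulmxV // mulmx1 mul_delta_mx_0 //.
    by rewrite -val_eqE /= ltn_eqF //; exact: leq_ltn_trans ji.
  move=> /matrixP/(_ 0 0); rewrite [RHS]mxE => <-.
  by rewrite !mxE; apply: eq_bigr => k _; rewrite !mxE.
have zE : z *m invmx L^T = Q^T.
  by rewrite -[z]trmxK -LQ trmx_mul mulmxK ?unitmx_tr.
exists (invmx L^T); split.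
- exact: upper_inv.
- by rewrite unitmx_inv unitmx_tr.
- move=> i j; rewrite zE mxE.
  have /matrixP/(_ j j) := unitarymxP uQ; rewrite !mxE eqxx mulr1n => s1.
  have : `|Q j i| ^+ 2 <= 1.
    rewrite -s1 (bigD1 i) //= !mxE -normCK lerDl; apply: sumr_ge0 => k _.
    by rewrite !mxE -normCK exprn_ge0.
  by rewrite expr_le1.
- have /(congr1 determinant) := unitarymxP uQ.
  rewrite zE det_tr det_mulmx det1 det_map_mx det_tr -normCK => /eqP.
  by rewrite sqrp_eq1 ?normr_ge0 // => /eqP.
Qed.

End QR.

Section Compact.
Context {R : realType}.
Local Notation C := R[i].
Implicit Types n : nat.

Definition normsq (x : C) : R := complex.Re x ^+ 2 + complex.Im x ^+ 2.

Lemma normsqE x : (normsq x)%:C%C = `|x| ^+ 2. Proof. exact: add_Re2_Im2. Qed.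

Lemma normsq_ge0 x : 0 <= normsq x. Proof. by rewrite addr_ge0 ?sqr_ge0. Qed.

Lemma normsq_eq0 x : (normsq x == 0) = (x == 0).
Proof.
apply/eqP/eqP => [H|->]; last by rewrite /normsq /= !expr0n /= addr0.
have : `|x| ^+ 2 = 0 by rewrite -normsqE H.
by move/eqP; rewrite sqrf_eq0 normr_eq0 => /eqP.
Qed.

Lemma normsqM x y : normsq (x * y) = normsq x * normsq y.
Proof. by apply: complexI; rewrite rmorphM /= !normsqE normrM exprMn. Qed.

Definition cplx_mx n (v : 'rV[R]_(n * n + n * n)) : zmat C n :=
  \matrix_(i, j) (v 0 (lshift _ (mxvec_index i j)) +i* v 0 (rshift _ (mxvec_index i j)))%C.

Definition real_vec n (z : zmat C n) : 'rV[R]_(n * n + n * n) :=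
  row_mx (map_mx (@complex.Re R) (mxvec (z : 'M_n))) (map_mx (@complex.Im R) (mxvec (z : 'M_n))).

Lemma real_vecK n (z : zmat C n) : cplx_mx (real_vec z) = z.
Proof.
apply/matrixP => i j; rewrite mxE row_mxEl row_mxEr !mxE !mxvecE.
by case: ((z : 'M_n) i j).
Qed.

Definition ccont N (f : 'rV[R]_N -> C) :=
  continuous (fun v => complex.Re (f v)) /\ continuous (fun v => complex.Im (f v)).

Lemma realcontD (T : topologicalType) (f g : T -> R) : continuous f -> continuous g ->
  continuous (fun x => f x + g x).
Proof. by move=> cf cg x; exact: (@continuousD _ _ _ f g x (cf x) (cg x)). Qed.

Lemma realcontB (T : topologicalType) (f g : T -> R) : continuous f -> continuous g ->
  continuous (fun x => f x - g x).
Proof. by move=> cf cg x; exact: (@continuousB _ _ _ f g x (cf x) (cg x)). Qed.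

Lemma realcontM (T : topologicalType) (f g : T -> R) : continuous f -> continuous g ->
  continuous (fun x => f x * g x).
Proof. by move=> cf cg x; exact: (@continuousM _ _ f g x (cf x) (cg x)). Qed.

Lemma ccont_ring N : fun_ring (@ccont N).
Proof.
split.
- by move=> c; split; exact: cst_continuous.
- move=> f g [fR fI] [gR gI]; split.
    rewrite (_ : (fun v => complex.Re (f v + g v)) = (fun v => complex.Re (f v) + complex.Re (g v))).
      exact: realcontD.
    by apply/funext => v; case: (f v); case: (g v).
  rewrite (_ : (fun v => complex.Im (f v + g v)) = (fun v => complex.Im (f v) + complex.Im (g v))).
    exact: realcontD.
  by apply/funext => v; case: (f v); case: (g v).
- move=> f g [fR fI] [gR gI]; split.
    rewrite (_ : (fun v => complex.Re (f v * g v)) =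
      (fun v => complex.Re (f v) * complex.Re (g v) - complex.Im (f v) * complex.Im (g v))).
      by apply: realcontB; exact: realcontM.
    by apply/funext => v; case: (f v); case: (g v).
  rewrite (_ : (fun v => complex.Im (f v * g v)) =
    (fun v => complex.Re (f v) * complex.Im (g v) + complex.Im (f v) * complex.Re (g v))).
    by apply: realcontD; exact: realcontM.
  by apply/funext => v; case: (f v); case: (g v).
Qed.

Lemma ccont_cplx_mx n : mx_in (@ccont _) (@cplx_mx n).
Proof.
move=> i j; split; under eq_fun do rewrite mxE /=; exact: coord_continuous.
Qed.

Lemma ccont_normsq N (f : 'rV[R]_N -> C) : ccont f -> continuous (fun v => normsq (f v)).
Proof.
move=> [fR fI]; rewrite (_ : (fun v => normsq (f v)) = (fun v => complex.Re (f v) * complex.Re (f v) + complex.Im (f v) * complex.Im (f v))) //.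
by apply: realcontD; exact: realcontM.
Qed.

Lemma normsq_bounds (x : C) : normsq x <= 1 ->
  (-1 <= complex.Re x <= 1) && (-1 <= complex.Im x <= 1).
Proof.
have key (a b : R) : a ^+ 2 + b ^+ 2 <= 1 -> -1 <= a <= 1.
  move=> H; rewrite -ler_norml -(@expr_le1 R 2 `|a|) //.
  by rewrite real_normK ?num_real //; apply: le_trans H; rewrite lerDl sqr_ge0.
by rewrite /normsq => H; rewrite (key _ _ H) (key _ (complex.Re x)) // addrC.
Qed.

(** The ratio depends only on the flag, so it can be computed on the representatives given by
    [qr_upper]. There the numerator is at most 1, and the nonvanishing denominator has a positive
    minimum by compactness. *)
Lemma bounded_ratio n (Z : set (zmat C n)) (r c i : 'I_n) : lclosed Z ->
  (forall z b, Z z -> Bn b -> Z (z *m b)) ->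
  (forall z, Z z -> (z : 'M_n) r c != 0) ->
  (forall z b, Z z -> Bn b ->
     (z *m b) i c / (z *m b) r c = (z : 'M_n) i c / (z : 'M_n) r c) ->
  exists M : R, forall z, Z z -> normsq ((z : 'M_n) i c / (z : 'M_n) r c) <= M.
Proof.
move=> lZ ZB Zr inv; have [D cD ZD] := lZ.
pose box := [set v : 'rV[R]_(n * n + n * n) | forall k, (`[(-1)%R, 1%R]%classic : set R) (v ord0 k)].
have cbox : compact box by apply: (@rV_compact R _ (fun=> `[(-1)%R, 1%R]%classic)) => _; exact: segment_compact.
(* The condition on the determinant is closed and keeps the compact set inside [GL], where [D] cuts
   out [Z]. *)
pose A := box `&` [set v | D (cplx_mx v)] `&` [set v | normsq (\det (cplx_mx v : 'M_n)) = 1].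
have rc := @ccont_ring (n * n + n * n).
have rcl (f : 'rV[R]_(n * n + n * n) -> C) : ccont f -> closed [set v | f v = 0].
  move=> cf; rewrite (_ : mkset _ = (fun v => normsq (f v)) @^-1` [set 0]).
    by apply: closed_comp; [move=> v _; exact: (ccont_normsq cf)|exact: closed_eq].
  by apply/seteqP; split=> v /=; [move=> ->; apply/eqP; rewrite normsq_eq0|move/eqP; rewrite normsq_eq0 => /eqP].
have cdet : ccont (fun v => \det (cplx_mx v : 'M_n)) by apply: (fr_det rc); exact: ccont_cplx_mx.
have cA : compact A.
  apply: (@subclosed_compact _ A box) => //; last by move=> v [[]].
  apply: closedI; last first.
    rewrite (_ : mkset _ = (fun v => normsq (\det (cplx_mx v : 'M_n))) @^-1` [set 1]) //.
    by apply: closed_comp; [move=> v _; exact: (ccont_normsq cdet)|exact: closed_eq].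
  apply: closedI.
    apply: compact_closed => //; exact: norm_hausdorff.
  have /closedP[P DP] := cD.
  rewrite (_ : mkset _ = \bigcap_(p in P) [set v | mxeval (cplx_mx v) p = 0]); last first.
    by apply/seteqP; split=> v /=; rewrite DP.
  apply: closed_bigI => p _; apply: rcl; apply: (fr_mxeval _ rc); exact: ccont_cplx_mx.
have Aprop z : Z z -> (forall i j, `|(z : 'M_n) i j| <= 1) -> `|\det (z : 'M_n)| = 1 ->
    A (real_vec z) /\ forall i j, normsq ((z : 'M_n) i j) <= 1.
  move=> Zz z1 zd.
  have z1' i' j' : normsq ((z : 'M_n) i' j') <= 1.
    by rewrite -lecR normsqE rmorph1 expr_le1.
  split=> //; split; last by rewrite /= real_vecK; apply: complexI; rewrite normsqE zd expr1n.
  split; last by rewrite /= real_vecK; move: Zz; rewrite ZD => -[].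
  move=> k; rewrite /= /real_vec.
  case: (split_ordP k) => k' ->; rewrite ?row_mxEl ?row_mxEr mxE;
    case/mxvec_indexP: k' => i' j'; rewrite mxvecE in_itv /=;
    by have /andP[] := normsq_bounds (z1' i' j').
have norm z : Z z -> exists2 b, Bn b & A (real_vec (z *m b)) /\ forall i j, normsq ((z *m b) i j) <= 1.
  move=> Zz; have zu : (z : 'M_n) \in unitmx by move: Zz; rewrite ZD => -[].
  have [b [ub bu H1 H2]] := qr_upper zu; exists b; first by split.
  by apply: Aprop => //; apply: ZB => //; split.
have [A0|A0] := pselect (A !=set0); last first.
  by exists 0 => z Zz; have [b _ [Ab _]] := norm z Zz; case: A0; exists (real_vec (z *m b)).
have cr : ccont (fun v => (cplx_mx v : 'M_n) r c) by exact: ccont_cplx_mx.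
have [|m /set_mem Am Hm] := compact_EVT_min A0 cA (f := fun v => normsq ((cplx_mx v : 'M_n) r c)).
  by apply: continuous_subspaceT; exact: ccont_normsq.
have Zm : Z (cplx_mx m).
  rewrite ZD; move: Am => [[_ Dm] dm]; split=> //=.
  change ((cplx_mx m : 'M_n) \in unitmx).
  by rewrite unitmxE unitfE -normsq_eq0 dm oner_eq0.
set mu := normsq ((cplx_mx m : 'M_n) r c) in Hm.
have mu0 : 0 < mu by rewrite lt_def normsq_ge0 normsq_eq0 Zr.
exists mu^-1 => z Zz; have [b Bb [Ab bd]] := norm z Zz.
rewrite -(inv z b) // normsqM.
have : mu <= normsq ((z *m b) r c) by have := Hm _ (mem_set Ab); rewrite real_vecK.
set w := (z *m b) r c => Hw.
have w0 : w != 0 by apply: Zr; exact: ZB.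
have -> : normsq w^-1 = (normsq w)^-1.
  by apply: complexI; rewrite fmorphV /= !normsqE normfV exprVn.
rewrite -[X in _ <= X]mul1r; apply: ler_pM => //; rewrite ?normsq_ge0 ?invr_ge0 ?normsq_ge0 //.
by rewrite lef_pV2 // posrE; exact: lt_le_trans Hw.
Qed.

End Compact.

(** * Fixed points of connected solvable groups on flags *)

Section Block.
Context {C : numClosedFieldType}.

Lemma poly_nat0 (q : {poly C}) K : (forall k, (K <= k)%N -> q.[k%:R] = 0) -> q = 0.
Proof.
move=> H; apply/eqP/negPn/negP => q0.
pose rs : seq C := [seq (K + i)%:R | i <- iota 0 (size q)].
have : (size rs < size q)%N.
  apply: max_poly_roots => //.
    by apply/allP => _ /mapP[i _ ->]; apply/rootP/H; rewrite leq_addr.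
  rewrite map_inj_uniq ?iota_uniq // => i j /eqP.
  by rewrite eqr_nat eqn_add2l => /eqP.
by rewrite /rs size_map size_iota ltnn.
Qed.

Definition poly1 (f : C -> C) := exists q : {poly C}, forall t, f t = q.[t].

Lemma poly1_ring : fun_ring poly1.
Proof.
split.
- by move=> c; exists c%:P => t; rewrite hornerC.
- by move=> f g [p fp] [q gq]; exists (p + q) => t; rewrite hornerD fp gq.
- by move=> f g [p fp] [q gq]; exists (p * q) => t; rewrite hornerM fp gq.
Qed.

Lemma poly1_id : poly1 id. Proof. by exists 'X => t; rewrite hornerX. Qed.

Lemma poly1_curve m (F : C -> zmat C m) f : mx_in poly1 F -> polyfun f ->
  poly1 (fun t => f (F t)).
Proof. by move=> pF pf; apply: (fr_polyfun poly1_ring). Qed.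

Lemma poly1_nat0 f : poly1 f -> (forall k : nat, f k%:R = 0) -> forall t, f t = 0.
Proof.
by move=> [q fq] H t; rewrite fq (@poly_nat0 q 0) ?horner0 // => k _; rewrite -fq.
Qed.

Lemma block_unit n (z : 'M[C]_n) : z \in unitmx ->
  (block_mx 1%:M 0 0 z : 'M_(1 + n)) \in unitmx /\
  invmx (block_mx 1%:M 0 0 z : 'M_(1 + n)) = block_mx 1%:M 0 0 (invmx z).
Proof.
move=> zu; have bu : (block_mx 1%:M 0 0 z : 'M_(1 + n)) \in unitmx.
  by rewrite unitmxE det_ublock det1 mul1r -unitmxE.
split=> //; apply: (can_inj (mulKmx bu)); rewrite mulmxV // (@mulmx_block _ 1 n 1 n 1 n).
by rewrite !mulmx0 !mul0mx !mul1mx !addr0 add0r mulmxV // -scalar_mx_block.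
Qed.

Section Step.
Context {n : nat} (Q : set (zmat C n.+1)) (z0 : zmat C n.+1).
Hypothesis gQ : matrix_subgroup Q.
Hypothesis uz0 : (z0 : 'M_n.+1) \in unitmx.
Hypothesis fix0 : forall q, Q q -> forall i, (invmx z0 *m q *m z0 : 'M_(1 + n)) (rshift 1 i) ord0 = 0.

(** The action of [q] on the quotient by the line of the first column of [z0], in the basis given by
    the other columns. *)
Definition dr_conj (q : zmat C n.+1) : zmat C n := drsubmx (invmx z0 *m q *m z0 : 'M_(1 + n)).

Lemma dr_conj_block q : Q q -> exists a r,
  (invmx z0 *m q *m z0 : 'M_(1 + n)) = block_mx a r 0 (dr_conj q).
Proof. by move=> Qq; eexists; eexists; exact: block_lower0 (fix0 Qq). Qed.

Lemma dr_conj_group : matrix_subgroup (dr_conj @` Q) /\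
  (solvable_group Q -> solvable_group (dr_conj @` Q)) /\
  (connected Q -> connected (dr_conj @` Q)).
Proof.
have [||g s] := @solvable_image C n.+1 n dr_conj Q gQ.
- rewrite /dr_conj mulmx1 mulVmx //.
  by rewrite (@scalar_mx_block _ 1 n 1) block_mxKdr.
- move=> x y Qx Qy; have [ax [rx Ex]] := dr_conj_block Qx; have [ay [ry Ey]] := dr_conj_block Qy.
  rewrite {1}/dr_conj.
  have -> : invmx z0 *m (x *m y) *m z0 = (invmx z0 *m x *m z0) *m (invmx z0 *m y *m z0).
    by rewrite !mulmxA mulmxK.
  by rewrite Ex Ey (@mulmx_block _ 1 n 1 n 1 n) block_mxKdr mul0mx add0r.
split=> //; split=> // cQ; apply: connected_image => // x _; apply: poly_continuous.
move=> i j; have := mxin_sandwich (invmx z0 : 'M_n.+1) z0 (rshift 1 i) (rshift 1 j).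
by congr polyfun; apply/funext => y; rewrite /dr_conj [RHS]mxE [RHS]mxE.
Qed.

Lemma dr_conj_upper q (z : 'M[C]_n) : Q q -> z \in unitmx ->
  upper (invmx z *m dr_conj q *m z) ->
  upper (invmx (z0 *m (block_mx 1%:M 0 0 z : 'M_(1 + n))) *m q *m
    (z0 *m (block_mx 1%:M 0 0 z : 'M_(1 + n)))).
Proof.
move=> Qq zu; have [bu bi] := block_unit zu; have [a [r E]] := dr_conj_block Qq.
rewrite invmxM // mulmxA -[_ *m invmx z0 *m q]mulmxA -[_ *m (invmx z0 *m q) *m z0]mulmxA.
rewrite E bi !(@mulmx_block _ 1 n 1 n 1 n).
rewrite !mul0mx !mul1mx !mulmx0 !addr0 !add0r mulmx1 => H.
by rewrite mul0mx; apply/upper_block.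
Qed.

End Step.

Lemma first_column_fix n (q z : 'M[C]_n.+1) a : z \in unitmx ->
  (forall i, (q *m z) i ord0 = a * z i ord0) ->
  forall i, (invmx z *m q *m z : 'M_(1 + n)) (rshift 1 i) ord0 = 0.
Proof.
move=> zu H i; rewrite -mulmxA mxE.
under eq_bigr do rewrite H mulrCA.
have := congr1 (fun m : 'M_n.+1 => m (rshift 1 i) ord0) (mulVmx zu).
by rewrite !mxE /= -mulr_sumr => ->; rewrite mulr0.
Qed.

Lemma lie_kolchin n (Q : set (zmat C n)) : matrix_subgroup Q ->
  connected Q -> solvable_group Q ->
  exists2 g : zmat C n, (g : 'M_n) \in unitmx & forall q, Q q -> upper (invmx g *m q *m g).
Proof.
elim: n Q => [|n IH] Q gQ cQ sQ.
  by exists 1%:M; [exact: unitmx1|move=> q _ []].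
have [v v0 Hv] := lie_kolchin_col (ltn0Sn n) gQ cQ sQ.
have [z zu [a a0 Hz]] := complete_column v0.
have fix0 q : Q q -> forall i, (invmx z *m q *m z : 'M_(1 + n)) (rshift 1 i) ord0 = 0.
  move=> Qq; have [b Hb] := Hv q Qq; apply: (@first_column_fix n q z b) => // i.
  rewrite Hz mxE; under eq_bigr do rewrite Hz mulrCA.
  rewrite -mulr_sumr mulrCA; congr (_ * _).
  by have := congr1 (fun m : 'cV_n.+1 => m i ord0) Hb; rewrite !mxE.
have [g3 [s3 c3]] := dr_conj_group gQ zu fix0.
have [g gu Hg] := IH _ g3 (c3 cQ) (s3 sQ).
exists (z *m (block_mx 1%:M 0 0 g : 'M_(1 + n))).
  by have [bu _] := block_unit gu; rewrite unitmx_mul zu.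
by move=> q Qq; apply: (dr_conj_upper (Q := Q)) => //; apply: Hg; exists q.
Qed.

End Block.

Section BFP.
Context {R : realType}.
Local Notation C := R[i].

Lemma first_column_upper n (z b : 'M[C]_n.+1) i : upper b -> (z *m b) i ord0 = z i ord0 * b ord0 ord0.
Proof.
move=> ub; rewrite mxE (bigD1 ord0) //= big1 ?addr0 // => k k0.
by rewrite ub ?mulr0 //= lt0n.
Qed.

Lemma normsq_nat k : normsq (k%:R : C) = k%:R ^+ 2.
Proof. by apply: complexI; rewrite normsqE rmorphXn /= rmorph_nat normr_nat. Qed.

(** The lines of the flags in [Z] avoid a coordinate hyperplane, so the ratio is a regular function
    on a complete variety. Its set of values is finite or cofinite by [image_decides]; a cofinite
    one would contain arbitrarily large integers, against [bounded_ratio]. *)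
Lemma finite_ratio n (Z : set (zmat C n.+1)) (r i : 'I_n.+1) : lclosed Z ->
  (forall z b, Z z -> Bn b -> Z (z *m b)) ->
  (forall z, Z z -> (z : 'M_n.+1) r ord0 != 0) ->
  exists s : seq C, forall z, Z z -> (z : 'M_n.+1) i ord0 / (z : 'M_n.+1) r ord0 \in s.
Proof.
case: n Z r i => [|n] Z r i lZ ZB Zr.
  by exists [:: 1] => z Zz; rewrite !ord1 divff ?mem_head //; have := Zr z Zz; rewrite !ord1.
have inv z b : Z z -> Bn b ->
    (z *m b) i ord0 / (z *m b) r ord0 = (z : 'M_n.+2) i ord0 / (z : 'M_n.+2) r ord0.
  move=> Zz [ub bu]; rewrite !first_column_upper // -mulf_div divff ?mulr1 //.
  by move: bu; rewrite upper_unit // => /forallP/(_ ord0).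
have [M HM] := bounded_ratio lZ ZB Zr inv.
have [D0 cD0 ZD0] := lZ.
(* [image_decides] needs a set closed among all matrices and a polynomial map; normalizing the
   determinant and the denominator provides both. *)
pose D := D0 `&` [set z : zmat C n.+2 | (z : 'M_n.+2) r ord0 = 1] `&`
  [set z : zmat C n.+2 | \det (z : 'M_n.+2) = 1].
have pr := @polyfun_ring C n.+2.
have cD : closed D.
  apply: closedI; first apply: closedI => //.
    by apply: zclosed_eq; [exact: polyfun_coord|exact: frC pr _].
  by apply: zclosed_eq; [apply: (fr_det pr); exact: polyfun_coord|exact: frC pr _].
pose F (z : zmat C n.+2) : zmat C 1 := const_mx ((z : 'M_n.+2) i ord0).
have pF : mx_in (@polyfun C n.+2) F.
  by move=> a b; under eq_fun do rewrite mxE; exact: polyfun_coord.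
have DZ z : D z -> Z z.
  by move=> [[Dz _] /= dz]; rewrite ZD0; split=> //; rewrite /GL /= unitmxE dz unitr1.
have scale z : Z z -> exists2 z', D z' &
    (z' : 'M_n.+2) i ord0 = (z : 'M_n.+2) i ord0 / (z : 'M_n.+2) r ord0.
  move=> Zz; have zr := Zr z Zz.
  have zu : \det (z : 'M_n.+2) != 0.
    by move: Zz; rewrite ZD0 => -[_]; rewrite /GL /= unitmxE unitfE.
  (* Scaling the first column normalizes the denominator, scaling the second one restores the
     determinant; so two columns are needed and size 1 is treated apart. *)
  pose a := ((z : 'M_n.+2) r ord0)^-1; pose d := (\det (z : 'M_n.+2) * a)^-1.
  have a0 : a != 0 by rewrite invr_eq0.
  pose b : 'M[C]_n.+2 := diag_mx (\row_j (if j == ord0 then a else if j == lift ord0 ord0 then d else 1)).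
  have ub : upper b by move=> k l lk; rewrite mxE -val_eqE gtn_eqF // mulr0n.
  have db : \det b = a * d.
    by rewrite det_diag !big_ord_recl !mxE /= big1 ?mulr1 // => k _; rewrite mxE.
  have Bb : Bn b.
    by split=> //; rewrite unitmxE unitfE db mulf_neq0 ?invr_eq0 ?mulf_neq0.
  have b00 : b ord0 ord0 = a by rewrite !mxE /= mulr1n.
  have Zzb := ZB z b Zz Bb.
  exists (z *m b); last by rewrite first_column_upper // b00.
  split; first split.
  - by move: Zzb; rewrite ZD0 => -[].
  - by rewrite /= first_column_upper // b00 mulfV.
  - by rewrite /= det_mulmx db /d mulrA mulfV // mulf_neq0.
have [|p pp [[y _ py] H]] := @image_decides C _ _ D F setT cD pF; first by exists 0.
have [q Hq] : poly1 (fun t => p (const_mx t)).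
  by apply: poly1_curve => // a b; under eq_fun do rewrite mxE; exact: poly1_id.
have q0 : q != 0.
  apply: contra_neq py => q0; have := Hq ((y : 'M_1) 0 0); rewrite q0 horner0 => <-.
  by congr p; apply/matrixP => a b; rewrite mxE !ord1.
case: H => H; last first.
  have [s Hs] := poly_roots q0; exists s => z /scale[z' Dz' <-]; apply: Hs.
  apply/rootP; rewrite -Hq; apply/eqP/negPn/negP => pz.
  by apply: (H _ _ pz) => //; exists z'.
exfalso; move/eqP: q0; apply; apply: (@poly_nat0 _ _ (Num.truncn `|M|).+1) => k kM.
apply/eqP/negPn/negP; rewrite -Hq => pk; have [z Dz Fz] := H _ I pk.
have := HM z (DZ z Dz); have [[_ /= zr] _] := Dz; rewrite zr divr1.
have -> : (z : 'M_n.+2) i ord0 = k%:R.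
  by have := congr1 (fun m : 'M_1 => m 0 0) Fz; rewrite !mxE.
rewrite normsq_nat; apply/negP; rewrite -ltNge.
apply: le_lt_trans (ler_norm _) _; apply: lt_le_trans (truncnS_gt _) _.
apply: le_trans (_ : k%:R <= _); first by rewrite ler_nat.
by rewrite -natrX ler_nat; case: k kM {pk Fz} => // k _; rewrite -mulnn leq_pmulr.
Qed.

(** With [Q] upper triangular, the flags in [Z] whose first column ends at the least possible row
    [k] form a closed [Q]-stable set on which entry [k] of that column never vanishes. By
    [finite_ratio] only finitely many first lines occur, so the connected [Q] fixes each of them,
    and the induction goes on in the quotient by one such line. *)
Theorem borel_fixed_point n (Q Z : set (zmat C n)) : matrix_subgroup Q ->
  connected Q -> solvable_group Q -> lclosed Z -> Z !=set0 ->
  (forall q z, Q q -> Z z -> Z (q *m z)) -> (forall z b, Z z -> Bn b -> Z (z *m b)) ->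
  exists2 z, Z z & forall q, Q q -> upper (invmx z *m q *m z).
Proof.
elim: n Q Z => [|n IH] Q Z gQ cQ sQ lZ Z0 QZ ZB.
  by have [z Zz] := Z0; exists z => // q _ [].
wlog uQ : Q Z gQ cQ sQ lZ Z0 QZ ZB / forall q, Q q -> upper (q : 'M_n.+1).
  move=> wl; have [g gu Hg] := lie_kolchin gQ cQ sQ.
  have gu' : invmx g \in unitmx by rewrite unitmx_inv.
  have conjE q : conjg (invmx g) Q q -> Q (g *m q *m invmx g).
    by move=> /(conjgE _ _ gu'); rewrite invmxK.
  have [||||||||z Zz Hz] := wl (conjg (invmx g) Q) [set x | Z (g *m x)].
  - exact: conjg_subgroup.
  - exact: conjg_connected.
  - exact: conjg_solvable.
  - exact: lclosed_left.
  - by have [z Zz] := Z0; exists (invmx g *m z); rewrite /= mulmxA mulmxV // mul1mx.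
  - move=> q z /conjE Qq /= Zz; have := QZ _ _ Qq Zz.
    by rewrite !mulmxA mulmxKV.
  - by move=> z b /= Zz Bb; rewrite mulmxA; exact: ZB.
  - by move=> _ [q Qq <-]; rewrite invmxK; exact: Hg.
  have zu : z \in unitmx.
    have [D _ ZD] := lZ; move: Zz; rewrite /= ZD => -[_].
    by rewrite /GL /= unitmx_mul gu.
  exists (g *m z) => // q Qq.
  have := Hz (invmx g *m q *m g); rewrite invmxM // !mulmxA; apply.
  by exists q => //; rewrite invmxK.
have GZ z : Z z -> z \in unitmx by have [D _ ->] := lZ => -[].
pose Zr k := Z `&` [set z : zmat C n.+1 | forall i : 'I_n.+1, (k < i)%N -> (z : 'M_n.+1) i ord0 = 0].
have exr : exists k, `[< Zr k !=set0 >].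
  exists n; apply/asboolP; have [z Zz] := Z0; exists z; split=> // i.
  by rewrite ltnNge -ltnS ltn_ord.
case: (ex_minnP exr) => k /asboolP[z0 Zz0] kmin.
have kn : (k < n.+1)%N.
  rewrite ltnS; apply: kmin; apply/asboolP; have [z Zz] := Z0; exists z; split=> // i.
  by rewrite ltnNge -ltnS ltn_ord.
pose r := Ordinal kn.
have Zrr z : Zr k z -> (z : 'M_n.+1) r ord0 != 0.
  move=> [Zz Hz]; apply/eqP => zr0.
  have [k0|k0] := posnP k.
    have zu := GZ z Zz; have := congr1 (fun m : 'M_n.+1 => m ord0 ord0) (mulVmx zu).
    rewrite !mxE eqxx mulr1n big1 => [/eqP|i _]; first by rewrite eq_sym oner_eq0.
    have [i0|i0] := posnP i; last by rewrite Hz ?mulr0 // k0.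
    by have -> : i = r; [apply/val_inj; rewrite /= i0 k0|rewrite zr0 mulr0].
  have : (k <= k.-1)%N.
    apply: kmin; apply/asboolP; exists z; split=> // i; rewrite prednK // leq_eqVlt => /orP[/eqP ki|]; last exact: Hz.
    by have <- : r = i by apply/val_inj.
  by rewrite leqNgt ltn_predL k0.
have lZr : lclosed (Zr k).
  rewrite /Zr setIC; apply: lclosed_closedI => //.
  rewrite (_ : mkset _ = [set z : zmat C n.+1 | forall i : {i : 'I_n.+1 | (k < i)%N}, (z : 'M_n.+1) (sval i) ord0 = 0]).
    by apply: closed_all => i; apply: closed_zero; exact: polyfun_coord.
  apply/seteqP; split=> z /= H; first by move=> [i ki]; exact: H.
  by move=> i ki; exact: (H (exist _ i ki)).
have ZrB z b : Zr k z -> Bn b -> Zr k (z *m b).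
  move=> [Zz Hz] Bb; split; first exact: ZB.
  by move=> i ki; have [ub _] := Bb; rewrite first_column_upper // Hz // mul0r.
have QZr q z : Q q -> Zr k z -> Zr k (q *m z).
  move=> Qq [Zz Hz]; split; first exact: QZ.
  move=> i ki; rewrite mxE big1 // => j _; have [ji|ij] := ltnP j i.
    by rewrite (uQ q Qq) // mul0r.
  by rewrite Hz ?mulr0 //; exact: leq_trans ij.
have col i q : Q q -> (q *m z0) i ord0 / (q *m z0) r ord0 = (z0 : 'M_n.+1) i ord0 / (z0 : 'M_n.+1) r ord0.
  have [s Hs] := finite_ratio i lZr ZrB Zrr.
  have [_ Q1 _ _] := gQ; have pr := @polyfun_ring C n.+1.
  have pz a : polyfun (fun q : zmat C n.+1 => (q *m z0) a ord0).
    have := mxin_sandwich (1%:M : 'M_n.+1) z0 a ord0; congr polyfun.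
    by apply/funext => x; rewrite mul1mx.
  pose l (q : zmat C n.+1) := (q *m z0) i ord0 / (q *m z0) r ord0.
  move=> Qq; transitivity (l 1%:M); last by rewrite /l mul1mx.
  apply: (@connected_label _ _ Q l s cQ) => //.
    by move=> x Qx; apply: Hs; exact: QZr.
  move=> t; exists [set q : zmat C n.+1 | (q *m z0) i ord0 = t * (q *m z0) r ord0].
    by apply: zclosed_eq => //; apply: (frM pr) => //; exact: frC pr _.
  apply/seteqP; split=> x [Qx] /= e; split=> //=.
    by rewrite -e /l divfK //; apply: Zrr; exact: QZr.
  by rewrite /l e mulfK //; apply: Zrr; exact: QZr.
have z0u : z0 \in unitmx by apply: GZ; case: Zz0.
have fix0 q : Q q -> forall i, (invmx z0 *m q *m z0 : 'M_(1 + n)) (rshift 1 i) ord0 = 0.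
  move=> Qq; apply: (@first_column_fix _ n q z0 ((q *m z0) r ord0 / (z0 : 'M_n.+1) r ord0)) => // i.
  have := col i q Qq => /(congr1 (fun x => x * (q *m z0) r ord0)).
  rewrite divfK; last by apply: Zrr; exact: QZr.
  by move=> ->; ring.
have [g3 [s3 c3]] := dr_conj_group gQ z0u fix0.
(* A flag of the quotient is completed by the fixed first column of [z0]. *)
pose inc (x : zmat C n) : zmat C n.+1 := (block_mx 1%:M 0 0 x : 'M_(1 + n)).
have pinc : mx_in (@polyfun C n) inc.
  have pr := @polyfun_ring C n.
  by apply: (mxin_block (a := 1) (c := 1)); [exact: (mxin_cst pr)|exact: (mxin_cst pr)|exact: (mxin_cst pr)|exact: mxin_id].
have inc_unit x : (inc x \in unitmx) = (x \in unitmx).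
  by rewrite !unitmxE /inc (@det_ublock _ 1 n) det1 mul1r.
have [||||z3 Zz3 Hz3] := IH (dr_conj z0 @` Q) [set x | Z (z0 *m inc x)] g3 (c3 cQ) (s3 sQ).
- have [D cD ZD] := lZ; exists [set x | D (z0 *m inc x)].
    have pF : mx_in (@polyfun C n) (fun x => z0 *m inc x).
      by apply: (mxinM (polyfun_ring n)) => //; exact: (mxin_cst (polyfun_ring n)).
    exact: closed_preimage pF cD.
  by apply/seteqP; split=> x /=; rewrite ZD /GL /setI /= unitmx_mul z0u inc_unit.
- by exists 1%:M; rewrite /= /inc -scalar_mx_block mulmx1; case: Zz0.
- move=> _ x [q Qq <-] /= Zx; have xu : x \in unitmx.
    by have := GZ _ Zx; rewrite unitmx_mul z0u inc_unit.
  have [a [c E]] := dr_conj_block fix0 Qq.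
  have au : a \in unitmx.
    have : (invmx z0 *m q *m z0) \in unitmx.
      by rewrite !unitmx_mul unitmx_inv z0u andbT /=; have [QG _ _ _] := gQ; exact: QG.
    by rewrite E unitmxE (@det_ublock _ 1 n) unitrM -unitmxE => /andP[].
  (* The element of [Bn] that brings [q *m (z0 *m inc x)] back to the form [z0 *m inc _]. *)
  pose b : 'M[C]_(1 + n) := block_mx (invmx a) (- (invmx a *m (c *m x))) 0 1%:M.
  have Bb : @Bn C n.+1 b.
    split; first by apply/upper_block; exact: upper1.
    by rewrite unitmxE (@det_ublock _ 1 n) det1 mulr1 -unitmxE unitmx_inv.
  have := ZB _ _ (QZ q _ Qq Zx) Bb; congr Z.
  have -> : q *m (z0 *m inc x) = z0 *m ((invmx z0 *m q *m z0) *m inc x).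
    by rewrite !mulmxA mulmxV // mul1mx.
  rewrite -mulmxA; congr (_ *m _); rewrite E /inc /b !(@mulmx_block _ 1 n 1 n 1 n).
  rewrite !mul0mx !mulmx0 !mulmx1 !addr0 !add0r mulmxV //.
  by rewrite mulmxN mulmxA mulmxV // mul1mx ?addNr !mul0mx add0r.
- move=> x b /= Zx [ub bu]; have := ZB _ (inc b) Zx; rewrite -mulmxA.
  have -> : inc x *m inc b = inc (x *m b).
    by rewrite /inc (@mulmx_block _ 1 n 1 n 1 n) !mul0mx !mulmx0 !mulmx1 !addr0 !add0r.
  by apply; split; [apply/upper_block|rewrite inc_unit].
exists (z0 *m inc z3) => // q Qq.
apply: (dr_conj_upper (Q := Q)) => //; last by apply: Hz3; exists q.
by have := GZ _ Zz3; rewrite unitmx_mul z0u inc_unit.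
Qed.

End BFP.

(** * Closed orbits on flags and conjugacy of Borel subgroups *)

Section AlgGroups.
Context {K : fieldType} {n : nat}.
Implicit Types G H : set (zmat K n).

Lemma algebraic_setI G H : algebraic_group G -> algebraic_group H -> algebraic_group (G `&` H).
Proof.
move=> [[GG G1 GM GV] cG] [[HG H1 HM HV] cH]; split; last first.
  exact: (lclosedI cG cH).
split; first by move=> x [/GG].
- by split.
- by move=> x y [Gx Hx] [Gy Hy]; split; [exact: GM|exact: HM].
- by move=> x [Gx Hx]; split; [exact: GV|exact: HV].
Qed.

Lemma Bn_algebraic : algebraic_group (@Bn K n).
Proof. by split; [exact: Bn_subgroup|exact: Bn_lclosed]. Qed.

Lemma conjg_setI g G H : g \in unitmx -> conjg g (G `&` H) = conjg g G `&` conjg g H.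
Proof.
move=> ug; apply/seteqP; split=> x.
  by move=> /(conjgE _ _ ug)[Gx Hx]; split; apply/conjgE.
by move=> [/(conjgE _ _ ug) Gx /(conjgE _ _ ug) Hx]; apply/conjgE.
Qed.

Lemma conjg_self g G : matrix_subgroup G -> G g -> conjg g G = G.
Proof.
move=> [GG G1 GM GV] Gg; have ug := GG _ Gg; apply/seteqP; split=> x.
  by move=> [h Gh <-]; exact: (GM _ _ (GM _ _ Gg Gh) (GV _ Gg)).
by move=> Gx; apply/conjgE => //; exact: (GM _ _ (GM _ _ (GV _ Gg) Gx) Gg).
Qed.

Lemma conjg_idcomp g G : g \in unitmx -> matrix_subgroup G ->
  conjg g (identity_component G) = identity_component (conjg g G).
Proof.
have sub h H : h \in unitmx -> matrix_subgroup H ->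
    conjg h (identity_component H) `<=` identity_component (conjg h H).
  move=> uh gH; apply: idcomp_max.
  - by apply: conjg_connected; exact: idcomp_connected.
  - by exists 1%:M; [exact: idcomp1|rewrite mulmx1 mulmxV].
  - by apply: conjgS; exact: idcomp_sub.
move=> ug gG; apply/seteqP; split; first exact: sub.
have ug' : invmx g \in unitmx by rewrite unitmx_inv.
have := conjgS (g := g) (sub _ _ ug' (conjg_subgroup ug gG)).
by rewrite conjg_inv // -{1}[g]invmxK conjg_inv.
Qed.

End AlgGroups.

(* A closed subset of the flag variety GL_n / B_n is encoded as a subset of GL_n,
   closed in GL_n and stable under right multiplication by B_n. The property is
   stated for an abstract field, but is proved over R[i], where the flag variety
   is compact for the usual topology. *)
Definition borel_property (C : numClosedFieldType) :=
  forall n (Q Z : set (zmat C n)), matrix_subgroup Q ->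
  connected Q -> solvable_group Q -> lclosed Z -> Z !=set0 ->
  (forall q z, Q q -> Z z -> Z (q *m z)) -> (forall z b, Z z -> Bn b -> Z (z *m b)) ->
  exists2 z, Z z & forall q, Q q -> upper (invmx z *m q *m z).

Section ClosedOrbit.
Context {C : numClosedFieldType} {n : nat}.
Implicit Types H B : set (zmat C n).

(** The [H]-orbit of the flag of [z], encoded in [GL]. *)
Definition dcoset H (z : zmat C n) : set (zmat C n) :=
  [set x | exists h b, [/\ H h, Bn b & x = h *m z *m b]].

(** A minimal nonempty closed stable set [Z] is the closure, in [GL], of each of its orbits. By
    [image_decides] the orbit of [z] contains or avoids a nonempty open part of [Z]; being dense, it
    cannot avoid it, and every other orbit meets that part too. So there is only one orbit. *)
Lemma closed_orbit H : algebraic_group H ->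
  exists2 z : zmat C n, z \in unitmx & lclosed (dcoset H z).
Proof.
move=> [[HG H1 HM HV] cH].
pose F (Z : set (zmat C n)) := [/\ lclosed Z, Z !=set0,
  forall h z, H h -> Z z -> Z (h *m z) & forall z b, Z z -> Bn b -> Z (z *m b)].
have [||Z FZ Zmin] := @lclosed_min C n F.
- exists (@GL C n); split.
  + exact: lclosed_GL.
  + by exists 1%:M; rewrite /GL /= unitmx1.
  + by move=> h z Hh zu; rewrite /GL /= unitmx_mul (HG _ Hh); exact: zu.
  + by move=> z b zu [_ bu]; rewrite /GL /= unitmx_mul bu andbT; exact: zu.
- by move=> Z [].
have [lZ [z Zz] HZ ZB] := FZ; have [Z0 cZ0 ZE] := lZ.
have GZ x : Z x -> (x : 'M_n) \in unitmx by rewrite ZE => -[].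
have zu := GZ _ Zz; exists z => //.
have dens x : Z x -> Z = closure (dcoset H x) `&` @GL C n.
  move=> Zx; have xu := GZ _ Zx; apply/esym/Zmin; last first.
    move=> y [cy uy]; rewrite ZE; split=> //; apply: cZ0; apply: closureS cy => w.
    move=> [h [b [Hh Bb ->]]]; have : Z (h *m x *m b) by apply: ZB => //; exact: HZ.
    by rewrite ZE => -[].
  split.
  - by exists (closure (dcoset H x)) => //; exact: closed_closure.
  - exists x; split; last exact: xu.
    apply: subset_closure; exists 1%:M, 1%:M; split; [exact: H1| |by rewrite mul1mx mulmx1].
    by have [_ B1 _ _] := @Bn_subgroup C n.
  - move=> h y Hh [cy uy]; split; last by rewrite /GL /= unitmx_mul (HG _ Hh); exact: uy.
    have /closure_id cE : closed [set y : zmat C n | closure (dcoset H x) (h *m y *m 1%:M)].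
      exact: (closed_preimage (mxin_sandwich (h : 'M_n) 1%:M) (@closed_closure _ _)).
    suff : closure (dcoset H x) (h *m y *m 1%:M) by rewrite mulmx1.
    change ([set y : zmat C n | closure (dcoset H x) (h *m y *m 1%:M)] y); rewrite cE.
    apply: closureS cy => _ [h' [b [Hh' Bb ->]]] /=; apply: subset_closure.
    exists (h *m h'), b; split=> //; first exact: HM.
    by rewrite mulmx1 !mulmxA.
  - move=> y b [cy uy] [ub bu]; split; last by rewrite /GL /= unitmx_mul bu andbT; exact: uy.
    have /closure_id cE : closed [set y : zmat C n | closure (dcoset H x) (1%:M *m y *m b)].
      exact: (closed_preimage (mxin_sandwich (1%:M : 'M_n) b) (@closed_closure _ _)).
    suff : closure (dcoset H x) (1%:M *m y *m b) by rewrite mul1mx.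
    change ([set y : zmat C n | closure (dcoset H x) (1%:M *m y *m b)] y); rewrite cE.
    apply: closureS cy => _ [h' [b' [Hh' Bb' ->]]] /=; apply: subset_closure.
    exists h', (b' *m b); split=> //; last by rewrite mul1mx !mulmxA.
    by have [_ _ BM _] := @Bn_subgroup C n; apply: BM.
(* A pair in [H] and [Bn] is encoded by two diagonal blocks. To get a closed set, [H] is replaced by
   its closure and [Bn] by all upper triangular matrices; over invertible values of [Fm] nothing is
   added. *)
pose D := [set w : zmat C (n + n) | closure H (ulsubmx (w : 'M_(n + n)))] `&`
  [set w : zmat C (n + n) | upper (drsubmx (w : 'M_(n + n)))].
have pul : mx_in (@polyfun C (n + n)) (fun w : zmat C (n + n) => ulsubmx (w : 'M_(n + n))).
  move=> i j; have := @mxin_id C (n + n) (lshift n i) (lshift n j); congr polyfun.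
  by apply/funext => x; rewrite [RHS]mxE [RHS]mxE.
have pdr : mx_in (@polyfun C (n + n)) (fun w : zmat C (n + n) => drsubmx (w : 'M_(n + n))).
  move=> i j; have := @mxin_id C (n + n) (rshift n i) (rshift n j); congr polyfun.
  by apply/funext => x; rewrite [RHS]mxE [RHS]mxE.
have cD : closed D.
  apply: closedI.
    exact: (@closed_preimage _ _ n (fun w => ulsubmx (w : 'M_(n + n))) _ pul (@closed_closure _ H)).
  exact: (@closed_preimage _ _ n (fun w => drsubmx (w : 'M_(n + n))) _ pdr (@closed_upper _ _)).
pose Fm (w : zmat C (n + n)) : zmat C n :=
  ulsubmx (w : 'M_(n + n)) *m z *m drsubmx (w : 'M_(n + n)).
have pr := @polyfun_ring C (n + n).
have pF : mx_in (@polyfun C (n + n)) Fm.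
  by apply: (mxinM pr) => //; apply: (mxinM pr) => //; exact: (mxin_cst pr).
have FD y : (y : 'M_n) \in unitmx -> (Fm @` D) y <-> dcoset H z y.
  move=> yu; split.
    move=> [w [Hw uw] wy]; exists (ulsubmx (w : 'M_(n + n))), (drsubmx (w : 'M_(n + n))).
    have := yu; rewrite -wy /Fm !unitmx_mul => /andP[/andP[u1 _] u2]; split=> //.
    rewrite (lclosed_closure cH); split=> //.
  move=> [h [b [Hh [ub bu] ->]]]; exists (block_mx h 0 0 b : 'M_(n + n)).
    by split; rewrite /= ?block_mxKul ?block_mxKdr //; exact: subset_closure.
  by rewrite /Fm block_mxKul block_mxKdr.
have [|p pp [[y Zy py] Hp]] := image_decides (Y := Z) cD pF; first by exists z.
have meet x : Z x -> exists e, dcoset H x e /\ p e != 0.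
  move=> Zx; have : Z y by []; rewrite (dens x Zx) => -[cy _].
  by have [|e [He pe]] := cy [set e | p e != 0]; [apply: open_nbhs_nbhs; split => //; exact: open_nonzero|exists e].
have dZ x e : Z x -> dcoset H x e -> Z e.
  by move=> Zx [h [b [Hh Bb ->]]]; apply: ZB => //; exact: HZ.
case: Hp => Hp; last first.
  have [e [He pe]] := meet z Zz; have Ze := dZ z e Zz He.
  by case: (Hp e Ze pe); apply/FD => //; exact: GZ.
suff -> : dcoset H z = Z by [].
apply/seteqP; split=> x; first exact: dZ.
move=> Zx; have [e [He pe]] := meet x Zx; have Ze := dZ x e Zx He.
have /FD := Hp e Ze pe => /(_ (GZ _ Ze)) [h [b [Hh [ub bu] e1]]].
have [h' [b' [Hh' [ub' bu'] e2]]] := He.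
exists (invmx h' *m h), (b *m invmx b'); split.
- by apply: HM => //; exact: HV.
- split; first by apply: upperM => //; exact: upper_inv.
  by rewrite unitmx_mul unitmx_inv bu.
have h'u := HG _ Hh'.
have -> : invmx h' *m h *m z *m (b *m invmx b') = invmx h' *m (h *m z *m b) *m invmx b'.
  by rewrite !mulmxA.
by rewrite -e1 e2 -!mulmxA mulmxV // mulmx1 mulmxA mulVmx // mul1mx.
Qed.

Hypothesis bfp : borel_property C.

(** [B] fixes some flag of the closed orbit, and the stabilizer of a flag is solvable, so [B] is its
    identity component by maximality. *)
Lemma borel_flag H B z : algebraic_group H -> borel H B -> z \in unitmx ->
  lclosed (dcoset H z) -> exists2 h, H h &
    B = identity_component (H `&` conjg (h *m z) (@Bn C n)).
Proof.
move=> aH [[aB cB sB] BH Bmax] zu lz; have [[HG H1 HM HV] cH] := aH.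
have [gB _] := aB; have [BG B1 _ _] := gB.
have [|||z' [h [b [Hh Bb z'E]]] Hz'] := bfp gB cB sB lz.
- exists z; exists 1%:M, 1%:M; split=> //; last by rewrite mul1mx mulmx1.
  by have [] := @Bn_subgroup C n.
- move=> q _ Bq [h [b [Hh Bb ->]]]; exists (q *m h), b; split=> //; last by rewrite !mulmxA.
  by apply: HM => //; exact: BH.
- move=> _ b' [h [b [Hh Bb ->]]] Bb'; exists h, (b *m b'); split=> //; last by rewrite !mulmxA.
  by have [_ _ BM _] := @Bn_subgroup C n; exact: BM.
exists h => //; have hu := HG _ Hh; have hzu : h *m z \in unitmx by rewrite unitmx_mul hu.
have [ub bu] := Bb.
have aI : algebraic_group (H `&` conjg (h *m z) (@Bn C n)).
  by apply: algebraic_setI => //; apply: conjg_algebraic => //; exact: Bn_algebraic.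
apply/esym; apply: Bmax.
- split; first exact: idcomp_algebraic.
    exact: idcomp_connected.
  have gL : matrix_subgroup (identity_component (H `&` conjg (h *m z) (@Bn C n))).
    by apply: idcomp_subgroup; case: aI.
  apply: (solvable_sub gL) (conjg_solvable hzu (@Bn_subgroup C n) (@Bn_solvable C n)).
  by move=> x /idcomp_sub[].
- by move=> x /idcomp_sub[].
- apply: idcomp_max => // q Bq; split; first exact: BH.
  apply/conjgE => //; split; last first.
    by rewrite unitmx_mul hzu andbT unitmx_mul unitmx_inv hzu; exact: BG.
  have := Hz' q Bq; rewrite z'E (invmxM hzu bu) => H2.
  have : upper (b *m (invmx b *m invmx (h *m z) *m q *m (h *m z *m b)) *m invmx b).
    by apply: upperM; [exact: upperM|exact: upper_inv].
  by rewrite !mulmxA mulmxV // mul1mx mulmxK.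
Qed.

(** By [borel_flag] both groups are identity components of stabilizers of flags in one [H]-orbit. *)
Lemma borel_conj H B B' : algebraic_group H -> borel H B -> borel H B' ->
  exists2 h, H h & B' = conjg h B.
Proof.
move=> aH bB bB'; have [z zu lz] := closed_orbit aH.
have [h1 H1 E1] := borel_flag aH bB zu lz; have [h2 H2 E2] := borel_flag aH bB' zu lz.
have [[HG Ho HM HV] cH] := aH; have gH := aH.1.
exists (h2 *m invmx h1); first by apply: HM => //; exact: HV.
have u1 := HG _ H1; have u2 := HG _ H2.
have uu : h2 *m invmx h1 \in unitmx by rewrite unitmx_mul u2 unitmx_inv.
have aI h : H h -> matrix_subgroup (H `&` conjg (h *m z) (@Bn C n)).
  move=> Hh; have [] // : algebraic_group (H `&` conjg (h *m z) (@Bn C n)).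
  apply: algebraic_setI => //; apply: conjg_algebraic; last exact: Bn_algebraic.
  by rewrite unitmx_mul zu andbT; exact: HG.
rewrite E1 E2 conjg_idcomp //; last exact: aI.
rewrite conjg_setI // -conjg_mul //; last by rewrite unitmx_mul u1.
by rewrite mulmxA mulmxKV // (conjg_self gH) //; exact: (HM _ _ H2 (HV _ H1)).
Qed.

End ClosedOrbit.

(** * Unipotent groups *)

(* Entries above the diagonal are eliminated diagonal by diagonal: [key]
   orders them, and [Nk k] is the normal subgroup of the unitriangular group
   whose entries of key less than k vanish. *)
Definition key n (i j : 'I_n) := ((j - i) * n + i)%N.

Lemma key_inj n (i j i' j' : 'I_n) : (i < j)%N -> (i' < j')%N -> key i j = key i' j' ->
  i = i' /\ j = j'.
Proof.
rewrite /key => ij ij' e.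
have ei : i = i' :> nat.
  by have := congr1 (modn^~ n) e; rewrite /= !modnMDl !modn_small.
split; apply/val_inj => //=; have n0 : (0 < n)%N by exact: leq_ltn_trans (ltn_ord i).
move/eqP: e; rewrite ei eqn_add2r eqn_pmul2r // -ei => /eqP e.
by rewrite -(subnKC (ltnW ij)) e ei subnKC // ltnW.
Qed.

Lemma key_lt1 n (i l j : 'I_n) : (i < l)%N -> (l < j)%N -> (key i l < key i j)%N.
Proof.
move=> il lj; have n0 : (0 < n)%N by exact: leq_ltn_trans (ltn_ord i).
by rewrite /key ltn_add2r ltn_pmul2r // ltn_sub2r //; exact: ltn_trans lj.
Qed.

Lemma key_lt2 n (i l j : 'I_n) : (i < l)%N -> (l < j)%N -> (key l j < key i j)%N.
Proof.
move=> il lj; rewrite /key; apply: leq_trans (_ : (j - l) * n + n <= _)%N.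
  by rewrite -addnS leq_add2l ltn_ord.
rewrite -mulSnr; apply: leq_trans (leq_addr _ _); rewrite leq_mul2r; apply/orP; right.
by rewrite ltn_sub2l //; exact: ltn_trans lj.
Qed.

Lemma key_bound n (i j : 'I_n) : (key i j < n * n)%N.
Proof.
rewrite /key; apply: leq_trans (_ : (j - i) * n + n <= _)%N.
  by rewrite -addnS leq_add2l ltn_ord.
rewrite -mulSnr leq_mul2r; apply/orP; right; exact: leq_ltn_trans (leq_subr _ _) (ltn_ord j).
Qed.

Section Uni.
Context {C : numClosedFieldType} {n : nat}.
Implicit Types (u x y : zmat C n) (k : nat).

Definition Nk k : set (zmat C n) :=
  [set x | forall i j : 'I_n, (j <= i)%N || (key i j < k)%N -> (x : 'M_n) i j = (1%:M : 'M_n) i j].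

Definition Un := Nk 0.

Lemma Nk_closed k : closed (Nk k).
Proof.
rewrite (_ : Nk k = [set x | forall ij : {ij : 'I_n * 'I_n | (ij.2 <= ij.1)%N || (key ij.1 ij.2 < k)%N},
    (x : 'M_n) (sval ij).1 (sval ij).2 = (1%:M : 'M_n) (sval ij).1 (sval ij).2]).
  apply: closed_all => ij; apply: zclosed_eq; first exact: polyfun_coord.
  exact: frC (@polyfun_ring C n) _.
apply/seteqP; split=> x /= H; first by move=> [[i j] /= ji]; exact: H.
by move=> i j ji; exact: (H (exist _ (i, j) ji)).
Qed.

Lemma NkS k k' : (k <= k')%N -> Nk k' `<=` Nk k.
Proof.
move=> kk x Hx i j /orP[ji|lt]; apply: Hx; first by rewrite ji.
by rewrite (leq_trans lt kk) orbT.
Qed.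

Lemma Nk_Un k x : Nk k x -> Un x. Proof. exact: NkS. Qed.

Lemma Nk_end x : Nk (n * n) x -> x = 1%:M.
Proof. by move=> Hx; apply/matrixP => i j; apply: Hx; rewrite key_bound orbT. Qed.

Lemma Un_upper x : Un x -> upper (x : 'M_n).
Proof. by move=> Hx i j ji; rewrite Hx ?(ltnW ji) // mxE -val_eqE gtn_eqF. Qed.

Lemma Un_diag x i : Un x -> (x : 'M_n) i i = 1.
Proof. by move=> Hx; rewrite Hx ?leqnn // mxE eqxx. Qed.

Lemma UnP x : upper (x : 'M_n) -> (forall i, (x : 'M_n) i i = 1) -> Un x.
Proof.
move=> ux dx i j; rewrite orbF leq_eqVlt => /orP[/eqP/val_inj->|ji].
  by rewrite dx mxE eqxx.
by rewrite ux // mxE -val_eqE gtn_eqF.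
Qed.

Lemma Un_unit x : Un x -> (x : 'M_n) \in unitmx.
Proof.
move=> Hx; rewrite upper_unit; last exact: Un_upper.
by apply/forallP => i; rewrite Un_diag // oner_eq0.
Qed.

Lemma UnM x y : Un x -> Un y -> Un (x *m y).
Proof.
move=> Hx Hy; apply: UnP; first by apply: upperM; exact: Un_upper.
by move=> i; rewrite upperM_diag; [rewrite !Un_diag // mulr1|exact: Un_upper|exact: Un_upper].
Qed.

Lemma UnV x : Un x -> Un (invmx x).
Proof.
move=> Hx; apply: UnP; first by apply: upper_inv; exact: Un_upper.
by move=> i; rewrite upper_inv_diag ?Un_diag ?invr1 //; [exact: Un_upper|exact: Un_unit].
Qed.

Lemma Un1 : Un 1%:M. Proof. by []. Qed.

Lemma Un_subgroup : matrix_subgroup Un.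
Proof. by split; [exact: Un_unit|exact: Un1|exact: UnM|exact: UnV]. Qed.

Lemma Un_algebraic : algebraic_group Un.
Proof.
split; first exact: Un_subgroup.
exists Un; first exact: Nk_closed.
by apply/seteqP; split=> x; [move=> Hx; split=> //; exact: Un_unit|case].
Qed.

Lemma sum2 (F : 'I_n -> C) (i j : 'I_n) : (i < j)%N ->
  (forall l : 'I_n, l != i -> l != j -> F l = 0) -> \sum_l F l = F i + F j.
Proof.
move=> ij H; rewrite (bigD1 i) //= (bigD1 j) /=; last by rewrite -val_eqE gtn_eqF.
by rewrite big1 ?addr0 // => l /andP[li lj]; exact: H.
Qed.

(** An intermediate index [l] in the matrix product contributes two entries of smaller key, and the
    one from [x] vanishes. So coordinates of key at most [k] are additive. *)
Lemma Nk_coordl k x y (i j : 'I_n) : Nk k x -> Un y -> (i < j)%N -> (key i j <= k)%N ->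
  (x *m y) i j = (x : 'M_n) i j + (y : 'M_n) i j.
Proof.
move=> Hx Hy ij kij; have Ux := Nk_Un Hx; rewrite mxE (sum2 ij) => [|l li lj].
  by rewrite !Un_diag // mul1r mulr1 addrC.
have [lti|gei] := ltnP l i; first by rewrite (Un_upper Ux) // mul0r.
have [ltj|gej] := ltnP j l; first by rewrite (Un_upper Hy) ?mulr0.
have il : (i < l)%N by rewrite ltn_neqAle gei eq_sym val_eqE li.
have lj' : (l < j)%N by rewrite ltn_neqAle gej val_eqE lj.
by rewrite Hx ?(leq_trans (key_lt1 il lj') kij) ?orbT // mxE -val_eqE ltn_eqF // mul0r.
Qed.

Lemma Nk_coordr k x y (i j : 'I_n) : Nk k x -> Un y -> (i < j)%N -> (key i j <= k)%N ->
  (y *m x) i j = (y : 'M_n) i j + (x : 'M_n) i j.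
Proof.
move=> Hx Hy ij kij; have Ux := Nk_Un Hx; rewrite mxE (sum2 ij) => [|l li lj].
  by rewrite !Un_diag // mul1r mulr1 addrC.
have [lti|gei] := ltnP l i; first by rewrite (Un_upper Hy) // mul0r.
have [ltj|gej] := ltnP j l; first by rewrite (Un_upper Ux) ?mulr0.
have il : (i < l)%N by rewrite ltn_neqAle gei eq_sym val_eqE li.
have lj' : (l < j)%N by rewrite ltn_neqAle gej val_eqE lj.
by rewrite Hx ?(leq_trans (key_lt2 il lj') kij) ?orbT // mxE -val_eqE ltn_eqF // mulr0.
Qed.

Lemma NkM k x y : Nk k x -> Nk k y -> Nk k (x *m y).
Proof.
move=> Hx Hy i j H; have [ji|ij] := leqP j i.
  by apply: UnM; [exact: Nk_Un Hx|exact: Nk_Un Hy|rewrite ji].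
move: H; rewrite leqNgt ij /= => kij.
rewrite (Nk_coordl Hx (Nk_Un Hy) ij (ltnW kij)) Hx ?kij ?orbT // Hy ?kij ?orbT //.
by rewrite mxE -val_eqE ltn_eqF // addr0.
Qed.

Lemma Nk_step k x : Nk k x ->
  (forall i j : 'I_n, (i < j)%N -> key i j = k -> (x : 'M_n) i j = 0) -> Nk k.+1 x.
Proof.
move=> Hx H i j; have [ji _|ij /=] := leqP j i; first by apply: Hx; rewrite ji.
rewrite ltnS leq_eqVlt => /orP[/eqP kij|kij]; last by apply: Hx; rewrite kij orbT.
by rewrite H // mxE -val_eqE ltn_eqF.
Qed.

Definition dmx (d : 'rV[C]_n) : zmat C n := diag_mx d.

Lemma Nk_conjd k x (d e : 'rV[C]_n) : (forall i, e 0 i * d 0 i = 1) -> Nk k x ->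
  Nk k (dmx e *m x *m dmx d) /\
  forall i j, (dmx e *m x *m dmx d) i j = e 0 i * (x : 'M_n) i j * d 0 j.
Proof.
move=> ed Hx; have E i j : (dmx e *m x *m dmx d) i j = e 0 i * (x : 'M_n) i j * d 0 j.
  by rewrite mul_mx_diag mxE mul_diag_mx mxE.
split=> // i j H; rewrite E Hx // mxE; have [->|] := eqVneq i j.
  by rewrite mulr1 ed.
by rewrite mulr0 mul0r.
Qed.

Definition bin_coef (t : C) m := (\prod_(l < m) (t - l%:R)) / m`!%:R.

Definition mxpow (u : 'M[C]_n) k : 'M[C]_n := iter k (mulmx u) 1%:M.

(** The power of a unipotent [u] with exponent [t], by the binomial series, which is finite as
    [u - 1] is nilpotent. It is polynomial in [t] and agrees with the usual power at naturals, so
    polynomial identities need only be checked there. *)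
Definition pw (u : zmat C n) (t : C) : zmat C n :=
  \sum_(m < n) bin_coef t m *: mxpow ((u : 'M_n) - 1%:M) m.

Lemma bin_coef_nat k m : bin_coef k%:R m = 'C(k, m)%:R.
Proof.
have fN0 : (m`!%:R : C) != 0 by rewrite pnatr_eq0 -lt0n fact_gt0.
apply: (mulIf fN0); rewrite divfK // -natrM bin_ffact; elim: m {fN0} => [|m IH].
  by rewrite big_ord0 ffactn0.
rewrite big_ord_recr /= IH ffactnSr natrM; have [mk|km] := leqP m k.
  by rewrite natrB.
by rewrite ffact_small // !mul0r.
Qed.

Lemma mxpowD u a b : mxpow u (a + b) = mxpow u a *m mxpow u b.
Proof. by elim: a => [|a IH] /=; rewrite ?mul1mx // IH mulmxA. Qed.

Lemma mxpow_strict x m : Un x -> forall i j : 'I_n, (j < i + m)%N -> mxpow ((x : 'M_n) - 1%:M) m i j = 0.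
Proof.
move=> Hx; elim: m => [|m IH] i j ij /=.
  by rewrite mxE -val_eqE gtn_eqF // -[X in (_ < X)%N]addn0.
rewrite mxE big1 // => l _; have [li|il] := leqP l i.
  rewrite mxE [X in _ + X]mxE [X in X + _]Hx ?li // subrr mul0r //.
by rewrite IH ?mulr0 //; apply: leq_trans ij _; rewrite addnS -addSn leq_add2r.
Qed.

Lemma pw_nat u k : Un u -> pw u k%:R = mxpow (u : 'M_n) k.
Proof.
move=> Hu; set N := (u : 'M_n) - 1%:M.
have N0 m : (n <= m)%N -> mxpow N m = 0.
  move=> nm; apply/matrixP => i j; rewrite mxpow_strict // ?mxE //.
  by apply: leq_trans (ltn_ord j) _; apply: leq_trans nm (leq_addl _ _).
(* The longer range of summation only adds zeros to either natural truncation: powers of [N] vanish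
   from [n] on, binomial coefficients beyond [k]. *)
have pwE : pw u k%:R = \sum_(m < n + k.+1) 'C(k, m)%:R *: mxpow N m.
  rewrite /pw big_split_ord /= [X in _ = _ + X]big1 ?addr0.
    by apply: eq_bigr => m _; rewrite bin_coef_nat.
  by move=> m _; rewrite N0 ?scaler0 // leq_addr.
have binE : \sum_(m < n + k.+1) 'C(k, m)%:R *: mxpow N m = \sum_(m < k.+1) 'C(k, m)%:R *: mxpow N m.
  rewrite addnC big_split_ord /= [X in _ + X]big1 ?addr0 //.
  by move=> m _; rewrite bin_small ?scale0r //= addSn ltnS leq_addr.
rewrite pwE binE {pwE binE}; elim: k => [|k IH].
  by rewrite big_ord_recl big_ord0 addr0 bin0 scale1r.
rewrite [RHS]/= -IH -[u in u *m _](subrK 1%:M) -/N mulmxDl mul1mx mulmx_sumr.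
rewrite [LHS]big_ord_recl /= bin0 scale1r.
under eq_bigr => i _ do rewrite /bump /= add1n binS natrD scalerDl.
rewrite big_split /= addrA addrC; congr (_ + _).
  by apply: eq_bigr => i _; rewrite scalemxAr.
rewrite [RHS]big_ord_recl /= bin0 scale1r; congr (_ + _).
rewrite big_ord_recr /= bin_small // scale0r addr0.
by apply: eq_bigr => i _; rewrite /bump /= add1n.
Qed.

Lemma mxin_pw (X : Type) (P : (X -> C) -> Prop) (U : zmat C n) (f : X -> C) :
  fun_ring P -> P f -> mx_in P (fun a : X => pw U (f a)).
Proof.
move=> rP Pf i j; rewrite /pw.
under eq_fun do rewrite summxE.
apply: (fr_sum rP) => m _; under eq_fun do rewrite mxE.
apply: (frM rP); last exact: (frC rP).
apply: (frM rP); last exact: (frC rP).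
by apply: (fr_prod rP) => l _; apply: (frB rP) => //; exact: (frC rP).
Qed.

Lemma pw_poly1 u : mx_in poly1 (pw u).
Proof. exact: (mxin_pw u poly1_ring poly1_id). Qed.

Lemma pw_closed (D : set (zmat C n)) u : closed D -> Un u ->
  (forall k, D (mxpow (u : 'M_n) k)) -> forall t, D (pw u t).
Proof.
move=> cD Hu H t; apply: contrapT => /(closed_sep cD)[f pf [fD /eqP]]; apply.
have := poly1_curve (pw_poly1 u) pf => /poly1_nat0; apply=> k.
by rewrite pw_nat // fD.
Qed.

Lemma pwD u s t : Un u -> pw u (s + t) = pw u s *m pw u t.
Proof.
move=> Hu; have r := @poly1_ring C.
have H1 (k : nat) : forall t, pw u (k%:R + t) = pw u k%:R *m pw u t.
  move=> t'; apply/matrixP => i j; apply/eqP; rewrite -subr_eq0; apply/eqP.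
  apply: (poly1_nat0 (f := fun t => pw u (k%:R + t) i j - (pw u k%:R *m pw u t) i j)).
    apply: (frB r); first by apply: mxin_pw => //; apply: (frD r); [exact: frC r _|exact: poly1_id].
    by apply: (mxinM r); [exact: (mxin_cst r)|exact: pw_poly1].
  by move=> l; rewrite -natrD !pw_nat // mxpowD subrr.
apply/matrixP => i j; apply/eqP; rewrite -subr_eq0; apply/eqP.
apply: (poly1_nat0 (f := fun s => pw u (s + t) i j - (pw u s *m pw u t) i j)).
  apply: (frB r); first by apply: mxin_pw => //; apply: (frD r); [exact: poly1_id|exact: frC r _].
  by apply: (mxinM r); [exact: pw_poly1|exact: (mxin_cst r)].
by move=> l; rewrite H1 subrr.
Qed.

Lemma pw0 u : Un u -> pw u 0 = 1%:M.
Proof. by move=> Hu; rewrite -(mulr0n 1) pw_nat. Qed.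

Lemma pw1 u : Un u -> pw u 1 = u.
Proof. by move=> Hu; rewrite -(mulr1n 1) pw_nat //= mulmx1. Qed.

Lemma pwN u t : Un u -> pw u (- t) *m pw u t = 1%:M.
Proof. by move=> Hu; rewrite -pwD // addNr pw0. Qed.

Lemma mxpow_group (H : set (zmat C n)) u k : matrix_subgroup H -> H u -> H (mxpow (u : 'M_n) k).
Proof. by move=> [HG H1 HM HV] Hu; elim: k => //= k IH; exact: HM. Qed.

Lemma pw_group (H : set (zmat C n)) u t : algebraic_group H -> H u -> Un u -> H (pw u t).
Proof.
move=> [gH [D cD HD]] Hu Uu; have Upw : Un (pw u t).
  apply: pw_closed => // [|k]; first exact: Nk_closed.
  exact: mxpow_group Un_subgroup Uu.
rewrite HD; split; last exact: Un_unit.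
by apply: pw_closed => // k; have := mxpow_group k gH Hu; rewrite HD => -[].
Qed.

Lemma pw_Nk k u t : Nk k u -> Nk k (pw u t).
Proof.
move=> Hu; apply: pw_closed; [exact: Nk_closed|exact: Nk_Un Hu|].
by elim=> // l IH; exact: NkM.
Qed.

Lemma pw_coord k u t (i j : 'I_n) : Nk k u -> (i < j)%N -> (key i j <= k)%N ->
  pw u t i j = t * (u : 'M_n) i j.
Proof.
move=> Hu ij kij; have Uu := Nk_Un Hu; have r := @poly1_ring C.
apply/eqP; rewrite -subr_eq0; apply/eqP.
apply: (poly1_nat0 (f := fun t => pw u t i j - t * (u : 'M_n) i j)).
  apply: (frB r); first exact: pw_poly1.
  by apply: (frM r); [exact: poly1_id|exact: frC r _].
move=> l; rewrite pw_nat //; elim: l => [|l IH] /=.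
  by rewrite mul0r subr0 mxE -val_eqE ltn_eqF.
rewrite (Nk_coordl Hu _ ij kij); last exact: mxpow_group Un_subgroup Uu.
by rewrite -natr1 mulrDl mul1r [X in X - _]addrC opprD addrACA subrr addr0 IH.
Qed.

(* When no element of [U] jumps at step [k] the curve is constant. *)
Lemma jump_curve (U : set (zmat C n)) k : algebraic_group U -> U `<=` Un ->
  exists c : C -> zmat C n, [/\ forall t, U (c t) /\ Nk k (c t),
    forall (X : Type) (P : (X -> C) -> Prop) f, fun_ring P -> P f -> mx_in P (fun a : X => c (f a)),
    forall t, c (- t) *m c t = 1%:M &
    forall i j : 'I_n, (i < j)%N -> key i j = k ->
      (forall t, (c t : 'M_n) i j = t) \/ (forall u, U u -> Nk k u -> (u : 'M_n) i j = 0)].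
Proof.
move=> aU UUn; have [gU _] := aU; have [_ U1 _ _] := gU.
have [[u [i [j [Uu Nu ij [kij uij]]]]]|nj] := pselect (exists u (i j : 'I_n),
    [/\ U u, Nk k u, (i < j)%N & key i j = k /\ (u : 'M_n) i j != 0]).
  have Unu := UUn _ Uu.
  exists (fun t => pw u (t / (u : 'M_n) i j)); split.
  - by move=> t; split; [exact: pw_group|exact: pw_Nk].
  - move=> X P f rP Pf; apply: mxin_pw => //; apply: (frM rP) => //; exact: (frC rP).
  - by move=> t; rewrite mulNr pwN.
  - move=> i' j' ij' kij'; have [-> ->] := key_inj ij' ij (etrans kij' (esym kij)).
    by left=> t; rewrite (pw_coord _ Nu ij) ?kij // divfK.
exists (fun=> 1%:M); split.
- by move=> t; split.
- by move=> X P f rP _; exact: (mxin_cst rP).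
- by move=> t; rewrite mulmx1.
- move=> i j ij kij; right=> u Uu Nu; apply/eqP/negPn/negP => uij.
  by apply: nj; exists u, i, j.
Qed.

End Uni.

(** * Exponential polynomials *)

Section ExpPoly.
Context {C : numClosedFieldType}.

(** The exponent [m] and the polynomial variable [t] are kept apart: a relation known for [t = m]
    can then be used at independent values, such as 1 and 0. *)
Definition exppoly (f : nat * C -> C) := exists2 l : seq (C * {poly C}),
  (forall x, x \in l -> x.1 != 0) &
  forall m t, f (m, t) = \sum_(x <- l) x.1 ^+ m * x.2.[t].

Lemma exppoly_ring : fun_ring exppoly.
Proof.
split.
- move=> c; exists [:: (1, c%:P)]; first by move=> x; rewrite inE => /eqP->; exact: oner_neq0.
  by move=> m t; rewrite big_seq1 expr1n mul1r hornerC.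
- move=> f g [l l0 fl] [l' l0' gl]; exists (l ++ l').
    by move=> x; rewrite mem_cat => /orP[/l0|/l0'].
  by move=> m t; rewrite big_cat fl gl.
- move=> f g [l l0 fl] [l' l0' gl].
  exists [seq (x.1 * y.1, x.2 * y.2) | x <- l, y <- l'].
    by move=> _ /allpairsP[[x y] [/l0 /= x0 /l0' /= y0 ->]] /=; rewrite mulf_neq0.
  move=> m t; rewrite fl gl big_allpairs_dep /= mulr_suml; apply: eq_bigr => x _.
  rewrite mulr_sumr; apply: eq_bigr => y _.
  by rewrite hornerM exprMn mulrACA.
Qed.

Lemma exppoly_pow (a : C) : a != 0 -> exppoly (fun x => a ^+ x.1).
Proof.
move=> a0; exists [:: (a, 1)]; first by move=> x; rewrite inE => /eqP->.
by move=> m t; rewrite big_seq1 hornerC mulr1.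
Qed.

Lemma exppoly_var : exppoly (fun x => x.2).
Proof.
exists [:: (1, 'X)]; first by move=> x; rewrite inE => /eqP->; exact: oner_neq0.
by move=> m t; rewrite big_seq1 expr1n mul1r hornerX.
Qed.

(** The operator sending [f(m)] to [f(m + 1) - r0 * f(m)] replaces [Q] by [Q'], enlarges no
    coefficient and shrinks [Q r0], so all [Q' r] vanish by induction on the total size. Leading
    coefficients then give [Q r = 0] for [r] other than [r0], and [Q r0] vanishes at every natural
    number. *)
Lemma exp_independent W (rs : seq C) (Q : C -> {poly C}) : uniq rs ->
  (forall r, r \in rs -> r != 0) ->
  (\sum_(r <- rs) size (Q r) < W)%N ->
  (forall m : nat, \sum_(r <- rs) r ^+ m * (Q r).[m%:R] = 0) ->
  forall r, r \in rs -> Q r = 0.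
Proof.
move=> urs rs0; elim: W Q => // W IH Q szW H r0 r0s.
apply/eqP/negPn/negP => Q0.
pose Q' r := r *: (Q r \Po ('X + 1)) - r0 *: Q r.
have sX : size ('X + 1 : {poly C}) = 2%N by rewrite -[1]opprK -polyC1 -polyCN size_XsubC.
have lX : lead_coef ('X + 1 : {poly C}) = 1 by rewrite -[1]opprK -polyC1 -polyCN lead_coefXsubC.
have sQ (p : {poly C}) : size (p \Po ('X + 1)) = size p by apply: size_comp_poly2; rewrite sX.
have lQ (p : {poly C}) : lead_coef (p \Po ('X + 1)) = lead_coef p.
  by rewrite lead_coef_comp ?sX // lX expr1n mulr1.
have sQ' r : (size (Q' r) <= size (Q r))%N.
  apply: leq_trans (size_polyD _ _) _; rewrite size_polyN geq_max.
  by rewrite (leq_trans (size_scale_leq _ _)) ?sQ // size_scale_leq.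
have sQ0 : (size (Q' r0) < size (Q r0))%N.
  have sp : (0 < size (Q r0))%N by rewrite lt0n size_poly_eq0.
  rewrite -(prednK sp) ltnS; apply/leq_sizeP => j.
  rewrite leq_eqVlt => /orP[/eqP <-|]; last first.
    rewrite prednK // => sj; rewrite /Q' coefB !coefZ !nth_default ?sQ // mulr0 subrr //.
  rewrite /Q' coefB !coefZ; have := lQ (Q r0); rewrite !lead_coefE sQ => ->.
  by rewrite subrr.
have Q'0 : forall r, r \in rs -> Q' r = 0.
  apply: IH.
    rewrite -ltnS; apply: leq_trans szW; rewrite ltnS.
    rewrite (big_rem r0) //= (big_rem r0 r0s) /= -addSn leq_add //.
    by apply: leq_sum => r _.
  move=> m; have := H m.+1; have := H m => H1 H2.
  transitivity (\sum_(r <- rs) r ^+ m.+1 * (Q r).[m.+1%:R] -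
      r0 * \sum_(r <- rs) r ^+ m * (Q r).[m%:R]); last by rewrite H1 H2 mulr0 subrr.
  rewrite mulr_sumr -sumrB; apply: eq_bigr => r _.
  rewrite /Q' hornerD hornerN !hornerZ horner_comp hornerD hornerX hornerC natr1 exprS.
  by ring.
have Qz r : r \in rs -> r != r0 -> Q r = 0.
  move=> rs' rr0; apply/eqP; rewrite -lead_coef_eq0; apply/eqP.
  have := Q'0 r rs'; rewrite /Q' => /eqP; rewrite subr_eq0 => /eqP /(congr1 lead_coef).
  rewrite !lead_coefZ lQ => /eqP; rewrite -subr_eq0 -mulrBl mulf_eq0 subr_eq0 (negbTE rr0) /=.
  by move/eqP.
have sum1 m : r0 ^+ m * (Q r0).[m%:R] = 0.
  have := H m; rewrite (big_rem r0) //= big1_seq ?addr0 // => r /andP[_].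
  by rewrite mem_rem_uniq // inE => /andP[rr0 rs']; rewrite Qz // horner0 mulr0.
move/eqP: Q0; apply; apply: (@poly_nat0 _ _ 0) => m _.
by have /eqP := sum1 m; rewrite mulf_eq0 expf_eq0 (negbTE (rs0 _ r0s)) andbF /= => /eqP.
Qed.

Lemma exppoly_diag0 f : exppoly f -> (forall m : nat, f (m, m%:R) = 0) -> forall x, f x = 0.
Proof.
move=> [l l0 fl] H [m t]; pose rs := undup (map fst l).
pose Q r : {poly C} := \sum_(x <- l | x.1 == r) x.2.
have E m' t' : f (m', t') = \sum_(r <- rs) r ^+ m' * (Q r).[t'].
  rewrite fl; under [RHS]eq_bigr => r _.
    rewrite /Q horner_sum mulr_sumr big_mkcond; over.
  rewrite exchange_big big_seq [RHS]big_seq; apply: eq_bigr => x xl.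
  have xr : x.1 \in rs by rewrite mem_undup map_f.
  rewrite (bigD1_seq x.1) ?undup_uniq //= eqxx big1 ?addr0 // => r.
  by rewrite eq_sym => /negbTE->.
rewrite E big_seq big1 // => r rs'.
rewrite (@exp_independent (\sum_(r <- rs) size (Q r)).+1 rs Q) ?undup_uniq //.
- by rewrite horner0 mulr0.
- by move=> a; rewrite mem_undup => /mapP[x xl ->]; exact: l0.
- by move=> m'; rewrite -E H.
Qed.

End ExpPoly.

(** * Straightening diagonalizable families *)

Section Diag.
Context {C : numClosedFieldType} {n : nat}.
Implicit Types (u x y : zmat C n) (k : nat) (d e : 'rV[C]_n).

Definition diagble (M : 'M[C]_n) := exists2 p : 'M[C]_n, p \in unitmx & is_diag_mx (invmx p *m M *m p).

Definition rinv d : 'rV[C]_n := map_mx GRing.inv d.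

Lemma dmxM d e : dmx d *m dmx e = dmx (\row_i (d 0 i * e 0 i)) :> 'M_n.
Proof. by rewrite /dmx mulmx_diag. Qed.

Lemma dmxC d e : dmx d *m dmx e = dmx e *m dmx d :> 'M_n.
Proof. by rewrite !dmxM; congr dmx; apply/rowP => i; rewrite !mxE mulrC. Qed.

Lemma dmxV d : (forall i, d 0 i != 0) -> dmx d *m dmx (rinv d) = 1%:M :> 'M_n.
Proof.
move=> d0; rewrite dmxM; apply/matrixP => i j; rewrite !mxE mulfV //.
Qed.

Lemma dmxVl d : (forall i, d 0 i != 0) -> dmx (rinv d) *m dmx d = 1%:M :> 'M_n.
Proof. by move=> d0; rewrite dmxC dmxV. Qed.

Lemma is_diag_dmx (M : 'M[C]_n) : is_diag_mx M -> M = dmx (\row_i M i i).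
Proof.
move=> /is_diag_mxP H; apply/matrixP => i j; rewrite !mxE; have [->|ij] := eqVneq i j.
  by rewrite mulr1n.
by rewrite mulr0n H.
Qed.

Lemma mxpow_conj (p M : 'M[C]_n) m : p \in unitmx ->
  mxpow (invmx p *m M *m p) m = invmx p *m mxpow M m *m p.
Proof.
move=> pu; elim: m => [|m IH] /=; first by rewrite mulmx1 mulVmx.
by rewrite IH !mulmxA mulmxK.
Qed.

Lemma mxpow_dmx d m : mxpow (dmx d) m = dmx (\row_i d 0 i ^+ m).
Proof.
elim: m => [|m IH] /=.
  by apply/matrixP => i j; rewrite !mxE expr0.
by rewrite IH dmxM; congr dmx; apply/rowP => i; rewrite !mxE exprS.
Qed.

Lemma diagble_pow (M : 'M[C]_n) : M \in unitmx -> diagble M -> forall i j,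
  exists a d : 'I_n -> C, (forall l, d l != 0) /\
    forall m, mxpow M m i j = \sum_l a l * d l ^+ m.
Proof.
move=> Mu [p pu dp] i j; have := is_diag_dmx dp; set d := \row__ _ => E.
have du : dmx d \in unitmx by rewrite -E !unitmx_mul unitmx_inv pu Mu.
exists (fun l => p i l * invmx p l j), (fun l => d 0 l); split.
  move=> l; move: du; rewrite unitmxE unitfE det_diag => /prodf_neq0; exact.
move=> m; have -> : mxpow M m = p *m mxpow (dmx d) m *m invmx p.
  by rewrite -E mxpow_conj // !mulmxA mulmxV // mul1mx mulmxK.
rewrite mxpow_dmx mxE; apply: eq_bigr => l _.
by rewrite mul_mx_diag !mxE mulrAC.
Qed.

(** As [d] has equal entries at [i] and [j], the [(i, j)] entry of the [m]-th power of [dmx d *m x]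
    is [d 0 i ^+ m * m%:R * x i j]. For a diagonalizable matrix it is a sum of exponentials with
    constant coefficients, so the factor [m] forces [x i j = 0]. *)
Lemma diagble_nojump k d x (i j : 'I_n) : (forall i, d 0 i != 0) ->
  Nk k x -> (i < j)%N -> key i j = k -> d 0 i = d 0 j ->
  diagble (dmx d *m x) -> (x : 'M_n) i j = 0.
Proof.
move=> d0 Hx ij kij dij dx.
have pow m : exists2 y, Nk k y & mxpow (dmx d *m x) m = dmx (\row_l d 0 l ^+ m) *m y /\
    (y : 'M_n) i j = m%:R * (x : 'M_n) i j.
  elim: m => [|m [y Hy [E Ey]]].
    exists 1%:M => //; split; last by rewrite mul0r mxE -val_eqE ltn_eqF.
    by rewrite mulmx1 /=; apply/matrixP => a b; rewrite !mxE expr0.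
  set dm := \row_l d 0 l ^+ m in E; set em : 'rV_n := rinv dm.
  have dm0 l : dm 0 l != 0 by rewrite mxE expf_neq0.
  have ed l : em 0 l * dm 0 l = 1 by rewrite mxE mulVf.
  have [Nx' Ex'] := Nk_conjd ed Hx.
  exists (dmx em *m x *m dmx dm *m y); first exact: NkM.
  split.
    rewrite /= E; have -> : dmx (\row_l d 0 l ^+ m.+1) = dmx d *m dmx dm :> 'M_n.
      by rewrite dmxM; congr dmx; apply/rowP => l; rewrite !mxE exprS.
    rewrite -!mulmxA; congr (_ *m _); rewrite !mulmxA (dmxV dm0) mul1mx //.
  rewrite (Nk_coordl Nx' (Nk_Un Hy) ij) ?kij // Ex' Ey !mxE dij.
  by rewrite mulrAC mulVf ?expf_neq0 // mul1r -[m.+1%:R]nat1r mulrDl mul1r.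
have xu : dmx d *m x \in unitmx.
  rewrite unitmx_mul (Un_unit (Nk_Un Hx)) andbT unitmxE unitfE det_diag.
  by apply/prodf_neq0 => l _.
have [a [b [b0 H]]] := diagble_pow xu dx i j.
pose f (z : nat * C) := \sum_l a l * b l ^+ z.1 - d 0 i ^+ z.1 * z.2 * (x : 'M_n) i j.
have r := @exppoly_ring C.
have ef : exppoly f.
  apply: (frB r).
    by apply: (fr_sum r) => l _; apply: (frM r); [exact: frC r _|exact: exppoly_pow].
  apply: (frM r); last exact: frC r _.
  by apply: (frM r); [exact: exppoly_pow|exact: exppoly_var].
have f0 := exppoly_diag0 ef.
have fz : forall z, f z = 0.
  apply: f0 => m; rewrite /f /= -H; have [y _ [-> Ey]] := pow m.
  by rewrite mul_diag_mx mxE Ey mxE mulrA subrr.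
(* With exponent 0 the two values differ by exactly [x i j]. *)
have e0 : f (0%N, 0) = f (0%N, 1) by rewrite !fz.
move: e0; rewrite /f /= !expr0 mulr0 mul0r subr0 !mul1r => /eqP.
by rewrite eq_sym subr_eq addrC -subr_eq subrr eq_sym => /eqP.
Qed.

Lemma diagble_conj (M p : 'M[C]_n) : p \in unitmx -> diagble M -> diagble (invmx p *m M *m p).
Proof.
move=> pu [q qu dq]; have pq : invmx p *m q \in unitmx by rewrite unitmx_mul unitmx_inv pu.
exists (invmx p *m q) => //.
rewrite invmxM ?unitmx_inv // invmxK !mulmxA mulmxK //.
by rewrite -[invmx q *m p *m invmx p]mulmxA mulmxV // mulmx1.
Qed.

Section Straighten.
Context {I : Type} (dl : I -> 'rV[C]_n) (U : set (zmat C n)).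
Hypothesis dl0 : forall s i, dl s 0 i != 0.
Hypothesis aU : algebraic_group U.
Hypothesis UUn : U `<=` Un.
Hypothesis Unorm : forall s u, U u -> U (dmx (rinv (dl s)) *m u *m dmx (dl s)).

Definition straightenable (th : I -> 'M[C]_n) :=
  [/\ forall s, U (dmx (rinv (dl s)) *m th s),
      forall s t, th s *m th t = th t *m th s & forall s, diagble (th s)].

(** Parametricity in the class [P] says that the entries of [F] are obtained from those of the
    family by ring operations. It gives polynomial and regular dependence at once. *)
Definition mx_natural (F : (I -> 'M[C]_n) -> 'M[C]_n) :=
  forall (X : Type) (P : (X -> C) -> Prop) (th : X -> I -> 'M[C]_n), fun_ring P ->
  (forall s, mx_in P (fun a : X => th a s)) -> mx_in P (fun a : X => F (th a)).

(** At the position of key [k]: if all [dl s] have equal entries at [i] and [j], the entry vanishes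
    because [th s] is diagonalizable. Otherwise an [s0] separating [i] from [j] fixes a conjugation
    killing its own entry, and commutation with [th s0] kills the entries of all other [s]. The
    inverse [F'] is built alongside because inversion is not a ring operation. *)
Lemma straighten_upto k : exists F F' : (I -> 'M[C]_n) -> 'M[C]_n,
  [/\ mx_natural F /\ mx_natural F', forall th, U (F th), forall th, F' th *m F th = 1%:M &
   forall th, straightenable th -> forall s,
     U (dmx (rinv (dl s)) *m (F' th *m th s *m F th)) /\
     Nk k (dmx (rinv (dl s)) *m (F' th *m th s *m F th))].
Proof.
have [gU _] := aU; have [UG U1 UM UV] := gU.
elim: k => [|k [F [F' [[nF nF'] FU FF' HF]]]].
  exists (fun=> 1%:M), (fun=> 1%:M); split=> //.
  - by split=> X P th rP _; exact: (mxin_cst rP).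
  - by move=> th; rewrite mulmx1.
  - by move=> th [H1 _ _] s; rewrite mul1mx mulmx1; split; [exact: H1|exact: UUn].
have F'F th : F th *m F' th = 1%:M by exact: mulmx1C.
have Finv th : F' th = invmx (F th).
  by apply: (can_inj (mulKmx (UG _ (FU th)))); rewrite F'F mulmxV //; exact: UG.
pose w th s := dmx (rinv (dl s)) *m (F' th *m th s *m F th).
have thE th s : F' th *m th s *m F th = dmx (dl s) *m w th s.
  by rewrite /w mulmxA (dmxV (dl0 s)) mul1mx.
have [[i [j [s0 [ij kij dij]]]]|nex] := pselect (exists (i j : 'I_n) s0,
    [/\ (i < j)%N, key i j = k & dl s0 0 i != dl s0 0 j]); last first.
  exists F, F'; split=> // th gth s; have [Uw Nw] := HF th gth s; split=> //.
  apply: Nk_step => // i j ij kij; apply: (diagble_nojump (dl0 s) Nw ij kij).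
    by apply/eqP/negPn/negP => dij; apply: nex; exists i, j, s.
  rewrite -/(w th s) -thE Finv; apply: diagble_conj; first exact: UG.
  by have [_ _] := gth.
have [c [cU cnat cV cij]] := jump_curve k aU UUn.
(* When the curve jumps, conjugation by [c t] adds [t * q s] to the [(i, j)] entry of [w th s]; this
   dictates [tau]. *)
pose q s := 1 - rinv (dl s) 0 i * dl s 0 j.
have q0 : q s0 != 0.
  rewrite /q mxE subr_eq0; apply: contra dij => /eqP e.
  by apply/eqP; rewrite -[LHS]mulr1 e mulVKf.
pose tau th := - (w th s0 i j / q s0).
have ntau X P (th : X -> I -> 'M[C]_n) : fun_ring P ->
    (forall s, mx_in P (fun a : X => th a s)) -> P (fun a : X => tau (th a)).
  move=> rP Hth; apply: (frN rP); apply: (frM rP); last exact: (frC rP).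
  apply: (mxinM rP); first exact: (mxin_cst rP).
  by apply: (mxinM rP); [apply: (mxinM rP)|]; [exact: nF'|exact: Hth|exact: nF].
exists (fun th => F th *m c (tau th)), (fun th => c (- tau th) *m F' th); split.
- split=> X P th rP Hth; apply: (mxinM rP).
  + exact: nF.
  + by apply: cnat => //; exact: ntau.
  + by apply: (cnat _ _ (fun a => - tau (th a))) => //; apply: (frN rP); exact: ntau.
  + exact: nF'.
- by move=> th; apply: UM => //; have [] := cU (tau th).
- by move=> th; rewrite -mulmxA [F' th *m _]mulmxA FF' mul1mx cV.
move=> th gth s; have [Uc Nc] := cU (tau th); have [Uc' Nc'] := cU (- tau th).
have ws t := HF th gth t.
have [Us Ns] := ws s; have [Us0 Ns0] := ws s0.
have ed t l : rinv (dl t) 0 l * dl t 0 l = 1 by rewrite mxE mulVf.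
have [NA EA] := Nk_conjd (ed s) Nc'.
have E : dmx (rinv (dl s)) *m (c (- tau th) *m F' th *m th s *m (F th *m c (tau th))) =
    (dmx (rinv (dl s)) *m c (- tau th) *m dmx (dl s)) *m (w th s *m c (tau th)).
  rewrite !mulmxA -[_ *m F' th *m th s]mulmxA -[_ *m (F' th *m th s) *m F th]mulmxA thE.
  by rewrite !mulmxA.
have Unew : U (dmx (rinv (dl s)) *m (c (- tau th) *m F' th *m th s *m (F th *m c (tau th)))).
  by rewrite E; exact: (UM _ _ (Unorm s Uc') (UM _ _ Us Uc)).
have Nnew : Nk k (dmx (rinv (dl s)) *m (c (- tau th) *m F' th *m th s *m (F th *m c (tau th)))).
  by rewrite E; apply: NkM => //; exact: NkM.
split=> //; apply: Nk_step => // i' j' ij' kij'.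
have [-> ->] := key_inj ij' ij (etrans kij' (esym kij)).
have [cijt|jz] := cij i j ij kij; last exact: jz.
have kk : (key i j <= k)%N by rewrite kij.
rewrite E (Nk_coordl NA _ ij kk); last by apply: UnM; exact: UUn.
rewrite (Nk_coordl Ns (UUn Uc) ij kk) EA !cijt -/(w th s).
(* The [(i, j)] entry of the commutation of [th s] with [th s0]: the entries of all [s] are
   proportional to [q s], so one [tau] serves for all. *)
have comm : w th s i j * q s0 = w th s0 i j * q s.
  have e1 : (dmx (rinv (dl s0)) *m w th s *m dmx (dl s0)) *m w th s0 =
      (dmx (rinv (dl s)) *m w th s0 *m dmx (dl s)) *m w th s.
    have cc : (dmx (dl s) *m w th s) *m (dmx (dl s0) *m w th s0) =
        (dmx (dl s0) *m w th s0) *m (dmx (dl s) *m w th s).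
      rewrite -!thE; have [_ cth _] := gth.
      transitivity (F' th *m (th s *m th s0) *m F th).
        by rewrite !mulmxA -[_ *m F th *m F' th]mulmxA F'F mulmx1.
      rewrite cth !mulmxA; congr (_ *m _ *m _).
      by rewrite -[_ *m F th *m F' th]mulmxA F'F mulmx1.
    have := congr1 (fun M : 'M_n => dmx (rinv (dl s0)) *m dmx (rinv (dl s)) *m M) cc.
    rewrite {2}[dmx (rinv (dl s0)) *m dmx (rinv (dl s))]dmxC !mulmxA.
    rewrite -[_ *m dmx (rinv (dl s)) *m dmx (dl s)]mulmxA (dmxVl (dl0 s)) mulmx1.
    rewrite -[_ *m dmx (rinv (dl s0)) *m dmx (dl s0)]mulmxA (dmxVl (dl0 s0)) mulmx1.
    by [].
  have [N1 E1] := Nk_conjd (ed s0) Ns; have [N2 E2] := Nk_conjd (ed s) Ns0.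
  have := congr1 (fun M : 'M_n => M i j) e1; rewrite /=.
  rewrite (Nk_coordl N1 (UUn Us0) ij kk) (Nk_coordl N2 (UUn Us) ij kk) E1 E2.
  rewrite -/(w th s) -/(w th s0) /q => e2.
  move/eqP: e2; rewrite -subr_eq0 => /eqP e2; apply/eqP; rewrite -subr_eq0; apply/eqP.
  by rewrite -[RHS]oppr0 -e2; ring.
apply: (mulIf q0); rewrite mul0r.
have -> : (rinv (dl s) 0 i * - tau th * dl s 0 j + (w th s i j + tau th)) * q s0 =
    w th s i j * q s0 + tau th * q s0 * q s by rewrite /q; ring.
by rewrite comm /tau mulNr divfK // mulNr subrr.
Qed.

Lemma straighten : exists F : (I -> 'M[C]_n) -> 'M[C]_n,
  [/\ mx_natural F, forall th, U (F th) &
   forall th, straightenable th -> forall s, invmx (F th) *m th s *m F th = dmx (dl s)].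
Proof.
have [F [F' [[nF _] FU FF' HF]]] := straighten_upto (n * n).
exists F; split=> // th gth s; have [_ /Nk_end E] := HF th gth s.
have Fu : F th \in unitmx by have [[UG _ _ _] _] := aU; exact: UG.
have <- : F' th = invmx (F th).
  by apply: (can_inj (mulKmx Fu)); rewrite mulmxV //; exact: mulmx1C.
have := congr1 (mulmx (dmx (dl s))) E; rewrite mulmxA (dmxV (dl0 s)) mul1mx mulmx1.
by [].
Qed.

End Straighten.

End Diag.

(** * Structure of solvable groups *)

Section Jordan.
Context {C : numClosedFieldType} {n : nat}.
Implicit Types (u v x y c : zmat C n) (k : nat).

Definition dgr x : 'rV[C]_n := \row_i (x : 'M_n) i i.

(** Conjugation by [1%:M + tau *: delta_mx i j] changes the [(i, j)] entry by [tau] times a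
    difference of diagonal entries, and otherwise only entries of larger key. What survives joins
    equal eigenvalues. *)
Lemma elim_upto c k : upper (c : 'M_n) -> exists2 v, Un v &
  upper (invmx v *m c *m v) /\ (forall i, (invmx v *m c *m v) i i = (c : 'M_n) i i) /\
  forall i j : 'I_n, (i < j)%N -> (key i j < k)%N -> (c : 'M_n) i i != (c : 'M_n) j j ->
    (invmx v *m c *m v) i j = 0.
Proof.
move=> uc; elim: k => [|k [v Uv [ux [dx zx]]]].
  by exists 1%:M; [exact: Un1|rewrite invmx1 mul1mx mulmx1].
have [x xdef] : exists x : 'M_n, x = invmx v *m c *m v by eexists.
rewrite -xdef in ux dx zx *.
have [[i [j [ij kij cij]]]|nex] := pselect (exists i j : 'I_n,
    [/\ (i < j)%N, key i j = k & (c : 'M_n) i i != (c : 'M_n) j j]); last first.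
  exists v => //; rewrite -xdef; split=> //; split=> // i j ij; rewrite ltnS leq_eqVlt => /orP[/eqP kij|] cij.
    by case: nex; exists i, j.
  exact: zx.
pose tau := x i j / ((c : 'M_n) j j - (c : 'M_n) i i).
pose E : 'M[C]_n := tau *: delta_mx i j.
have cji : (c : 'M_n) j j - (c : 'M_n) i i != 0 by rewrite subr_eq0 eq_sym.
have xE a b : (x *m E) a b = tau * ((b == j)%:R * x a i).
  rewrite -scalemxAr mxE; congr (_ * _).
  rewrite mxE (bigD1 i) //= big1 ?addr0; first by rewrite mxE eqxx mulrC.
  by move=> l li; rewrite mxE (negbTE li) mulr0.
have Ex (y : 'M[C]_n) a b : (E *m y) a b = tau * ((a == i)%:R * y j b).
  rewrite -scalemxAl mxE; congr (_ * _).
  rewrite mxE (bigD1 j) //= big1 ?addr0; first by rewrite mxE eqxx andbT.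
  by move=> l lj; rewrite mxE (negbTE lj) andbF mul0r.
have EE : E *m E = 0.
  have ji : (j == i) = false by rewrite -val_eqE gtn_eqF.
  by apply/matrixP => a b; rewrite Ex !mxE ji /= !mulr0.
have ExE : E *m x *m E = 0.
  rewrite -mulmxA; apply/matrixP => a b; rewrite Ex xE (ux j i ij).
  by rewrite !mulr0 mxE.
have uE : (1%:M - E) *m (1%:M + E) = 1%:M.
  by rewrite mulmxBl mul1mx mulmxDr mulmx1 EE addr0 addrK.
have [_ u1] := mulmx1_unit uE.
have inv1 : invmx (1%:M + E) = 1%:M - E.
  by apply: (can_inj (mulKmx u1)); rewrite mulmxV // mulmx1C.
have vu := Un_unit Uv.
have xnew : invmx (v *m (1%:M + E)) *m c *m (v *m (1%:M + E)) = x + x *m E - E *m x.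
  rewrite invmxM // inv1.
  have -> : (1%:M - E) *m invmx v *m c *m (v *m (1%:M + E)) = (1%:M - E) *m x *m (1%:M + E).
    by rewrite xdef !mulmxA.
  by rewrite mulmxBl mul1mx mulmxDr mulmx1 mulmxBl ExE subr0 addrAC.
have U1 : Un (1%:M + E).
  apply: UnP.
    move=> a b ba; rewrite !mxE -val_eqE gtn_eqF //= add0r.
    have [ai|_] := eqVneq a i; last by rewrite mulr0.
    have [bj|_] := eqVneq b j; last by rewrite mulr0.
    by move: ba; rewrite bj ai ltnNge (ltnW ij).
  move=> a; rewrite !mxE eqxx; have [->|_] := eqVneq a i; last by rewrite mulr0 addr0.
  by rewrite -val_eqE ltn_eqF //= mulr0 addr0.
exists (v *m (1%:M + E)); first exact: UnM.
have ent a b : (x + x *m E - E *m x) a b = x a b + tau * ((b == j)%:R * x a i) - tau * ((a == i)%:R * x j b).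
  by rewrite mxE [X in X + _]mxE [X in _ + X]mxE xE Ex.
rewrite xnew; split; [|split].
- move=> a b ba; rewrite ent (ux a b ba) add0r.
  have [bj|_] := eqVneq b j; have [ai|_] := eqVneq a i; rewrite ?mul0r ?mulr0 ?subr0 ?add0r ?oppr0 //.
  + by move: ba; rewrite bj ai ltnNge (ltnW ij).
  + by rewrite mul1r (ux a i) ?mulr0 //; apply: ltn_trans ij _; rewrite -bj.
  + by rewrite mul1r (ux j b) ?mulr0 ?oppr0 //; apply: ltn_trans ij; rewrite -ai.
- move=> a; rewrite ent dx.
  have [aj|_] := eqVneq a j; have [ai|_] := eqVneq a i; rewrite ?mul0r ?mulr0 ?subr0 ?add0r ?oppr0 ?addr0 //.
  + by move: ij; rewrite -aj -ai ltnn.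
  + by rewrite mul1r aj (ux j i) // mulr0 addr0.
  + by rewrite mul1r ai (ux j i) // mulr0 subr0.
move=> a b ab; rewrite ltnS leq_eqVlt => kab cab; rewrite ent.
have [[ai bj]|nab] := pselect (a = i /\ b = j).
  have tauE : tau * ((c : 'M_n) j j - (c : 'M_n) i i) = x i j by rewrite /tau divfK.
  by rewrite ai bj !eqxx !mul1r !dx -tauE; ring.
have kab' : (key a b < k)%N.
  case/orP: kab => // /eqP kab; case: nab; exact: (key_inj ab ij (etrans kab (esym kij))).
rewrite zx // add0r.
have [bj|_] := eqVneq b j; have [ai|_] := eqVneq a i; rewrite ?mul0r ?mulr0 ?subr0 ?add0r ?oppr0 //.
- by case: nab.
- rewrite mul1r; have [lt|] := ltnP i a; first by rewrite (ux a i) ?mulr0.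
  rewrite leq_eqVlt => /orP[/eqP/val_inj ai|ai].
    by case: nab.
  by move: kab'; rewrite bj ltnNge -kij ltnW // key_lt2.
- rewrite mul1r; have [lt|] := ltnP b j; first by rewrite (ux j b) ?mulr0 ?oppr0.
  rewrite leq_eqVlt => /orP[/eqP/val_inj bj|bj].
    by case: nab.
  by move: kab'; rewrite ai ltnNge -kij ltnW // key_lt1.
Qed.

(** [v *m dmx (dgr c) *m invmx v] is the semisimple Jordan part of [c]. In the basis [v], [c] is the
    product of a diagonal matrix and a commuting unipotent [nu]; a polynomial vanishing on all
    powers of [c] becomes an exponential polynomial vanishing at every [(m, m)], hence at
    [(1, 0)]. *)
Lemma jordan_upper c : Bn c -> exists2 v, Un v &
  (forall D : set (zmat C n), closed D -> (forall m, D (mxpow c m)) ->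
     D (v *m dmx (dgr c) *m invmx v)).
Proof.
move=> [uc cu]; have [v Uv [ux [dx zx]]] := elim_upto (n * n) uc.
exists v => // D cD Dc.
have [x xdef] : exists x : zmat C n, x = invmx v *m c *m v by eexists.
rewrite -xdef in ux dx zx.
have vu := Un_unit Uv; set d := dgr c.
have d0 i : d 0 i != 0 by move: cu; rewrite upper_unit // mxE => /forallP.
have dxC : dmx d *m x = x *m dmx d.
  apply/matrixP => i j; rewrite mul_diag_mx mul_mx_diag !mxE.
  have [ij|ij] := eqVneq ((c : 'M_n) i i) ((c : 'M_n) j j); first by rewrite ij mulrC.
  suff -> : x i j = 0 by rewrite mulr0 mul0r.
  have [lt|] := ltnP j i; first exact: ux.
  rewrite leq_eqVlt => /orP[/eqP/val_inj e|lt]; first by move: ij; rewrite e eqxx.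
  by apply: zx => //; exact: key_bound.
have [nu nudef] : exists nu : zmat C n, nu = dmx (rinv d) *m x by eexists.
have xE : x = dmx d *m nu by rewrite nudef mulmxA (dmxV d0) mul1mx.
have Unu : Un nu.
  apply: UnP.
    by move=> i j ji; rewrite nudef mul_diag_mx mxE (ux i j ji) mulr0.
  by move=> i; rewrite nudef mul_diag_mx mxE dx; have := d0 i; rewrite !mxE => di; rewrite mulVf.
have dnC : dmx d *m nu = nu *m dmx d.
  by rewrite nudef mulmxA dmxC -mulmxA dxC mulmxA.
have powx m : mxpow x m = mxpow (dmx d) m *m mxpow nu m.
  elim: m => [|m IH] /=; first by rewrite mulmx1.
  have cm : nu *m mxpow (dmx d) m = mxpow (dmx d) m *m nu.
    elim: m {IH} => [|m IH] /=; first by rewrite mulmx1 mul1mx.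
    by rewrite mulmxA -dnC -mulmxA IH mulmxA.
  by rewrite IH {1}xE -!mulmxA; congr (_ *m _); rewrite (mulmxA nu) cm mulmxA.
have cE : c = invmx (invmx v) *m x *m invmx v.
  by rewrite invmxK xdef !mulmxA mulmxV // mul1mx mulmxK.
apply: contrapT => /(closed_sep cD)[f pf [fD /eqP]]; apply.
pose F (z : nat * C) : zmat C n := v *m mxpow (dmx d) z.1 *m pw nu z.2 *m invmx v.
have r := @exppoly_ring C.
have pF : mx_in (@exppoly C) F.
  apply: (mxinM r); last exact: (mxin_cst r).
  apply: (mxinM r); last exact: (mxin_pw nu r exppoly_var).
  apply: (mxinM r); first exact: (mxin_cst r).
  move=> i j; under eq_fun do rewrite mxpow_dmx !mxE.
  have [->|ij] := eqVneq i j.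
    by under eq_fun do rewrite mulr1n; apply: exppoly_pow; have := d0 j; rewrite mxE.
  by under eq_fun do rewrite mulr0n; exact: frC r _.
have ef : exppoly (fun z => f (F z)) by exact: (fr_polyfun r).
have := exppoly_diag0 ef => /(_ _ (1%N, 0)); rewrite /F /= mulmx1 pw0 // mulmx1; apply=> m.
rewrite /F /= pw_nat // -[v *m _ *m _]mulmxA -powx.
have -> : v *m mxpow x m *m invmx v = mxpow c m.
  by rewrite cE mxpow_conj ?unitmx_inv // invmxK.
exact: fD.
Qed.

(** The line is irreducible: a polynomial vanishing on the closed piece times one supported in the
    open piece vanishes at all naturals, hence one of them is zero along the curve. *)
Lemma curve_connected (F : C -> zmat C n) : mx_in poly1 F -> connected (range F).
Proof.
move=> pF U [z Uz] [V oV UV] [D cD UD].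
have [t0 [_ Vt0]] : exists t0, True /\ V (F t0).
  by move: Uz; rewrite UV => -[[t _ <-] Vt]; exists t.
apply/seteqP; split; first by move=> y; rewrite UV => -[].
move=> _ [t1 _ <-]; rewrite UD; split; first by exists t1.
apply: contrapT => /(closed_sep cD)[f pf [fD ft1]].
have [g pg [gt0 gV]] := open_principal oV Vt0.
have [p Hp] := poly1_curve pF pf; have [q Hq] := poly1_curve pF pg.
have p0 : p != 0 by apply: contra_neq ft1 => p0; rewrite Hp p0 horner0.
have q0 : q != 0 by apply: contra_neq gt0 => q0; rewrite Hq q0 horner0.
have : p * q != 0 by rewrite mulf_neq0.
apply/negP; rewrite negbK; apply/eqP/(@poly_nat0 _ _ 0) => k _; rewrite hornerM -Hp -Hq.
have [->|gk] := eqVneq (g (F k%:R)) 0; first by rewrite mulr0.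
rewrite fD ?mul0r //.
have : U (F k%:R) by rewrite UV; split; [exists k%:R|exact: gV].
by rewrite UD => -[].
Qed.

Lemma conjd_diag x y : Un y -> upper (x : 'M_n) ->
  forall i, (invmx y *m x *m y) i i = (x : 'M_n) i i.
Proof.
move=> Uy ux i; have uy := Un_upper Uy; have uy' := upper_inv uy.
rewrite upperM_diag //; last exact: upperM.
rewrite upperM_diag // (upper_inv_diag _ uy) ?(Un_unit Uy) //.
by rewrite (Un_diag _ Uy) invr1 mul1r mulr1.
Qed.

Lemma dmx_unit (d : 'rV[C]_n) : (forall i, d 0 i != 0) -> dmx d \in unitmx.
Proof. by move=> d0; rewrite unitmxE unitfE det_diag; apply/prodf_neq0 => i _. Qed.

Lemma dmx_upper (d : 'rV[C]_n) : upper (dmx d).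
Proof. by move=> i j ji; rewrite mxE -val_eqE gtn_eqF // mulr0n. Qed.

Lemma dmx_diag (d : 'rV[C]_n) i : dmx d i i = d 0 i.
Proof. by rewrite mxE eqxx mulr1n. Qed.

Lemma upper_dmx_Un x (d : 'rV[C]_n) : (forall i, d 0 i != 0) -> upper (x : 'M_n) ->
  (forall i, (x : 'M_n) i i = d 0 i) -> Un (dmx (rinv d) *m x).
Proof.
move=> d0 ux dx; apply: UnP; first by apply: upperM => //; exact: dmx_upper.
move=> i; rewrite upperM_diag //; last exact: dmx_upper.
by rewrite dmx_diag mxE dx mulVf.
Qed.

Lemma dgr_neq0 x : Bn x -> forall i, dgr x 0 i != 0.
Proof. by move=> [ux xu] i; move: xu; rewrite upper_unit // mxE => /forallP. Qed.

Lemma conjd_norm (d : 'rV[C]_n) u : (forall i, d 0 i != 0) -> Un u ->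
  Un (dmx (rinv d) *m u *m dmx d).
Proof.
move=> d0 Uu; have [|H _] := @Nk_conjd C n 0 u d (rinv d) _ Uu; last exact: H.
by move=> i; rewrite mxE mulVf.
Qed.

(* A maximal commuting family of diagonalizable elements of [B] is, after
   straightening, the group of diagonal parts of elements of [B]: Jordan parts
   of elements commuting with the family lie in it. *)
Lemma solvable_structure (B S : set (zmat C n)) : algebraic_group B -> B `<=` @Bn C n ->
  S `<=` B -> (forall s t, S s -> S t -> s *m t = t *m s) -> (forall s, S s -> diagble s) ->
  exists b0 : zmat C n, [/\ upper (b0 : 'M_n), (b0 : 'M_n) \in unitmx,
    forall s, S s -> is_diag_mx (invmx b0 *m s *m b0) &
    forall x, conjg (invmx b0) B x -> conjg (invmx b0) B (dmx (dgr x))].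
Proof.
move=> aB BBn SB Scomm Sd; have [gB cB] := aB; have [BG B1 BM BV] := gB.
pose ok (X : set (zmat C n)) := [/\ X `<=` B, forall s t, X s -> X t -> s *m t = t *m s &
  forall s, X s -> diagble s].
pose P (X : set (zmat C n)) := ok (X `|` S).
have [F FP Ftot|A [PA Amax]] := @Zorn_bigcup _ P.
  have chain s t : (\bigcup_(X in F) X `|` S) s -> (\bigcup_(X in F) X `|` S) t ->
      exists2 X, ok X & X s /\ X t.
    move=> [[X FX Xs]|Ss] [[Y FY Yt]|St].
    - have [XY|YX] := Ftot _ _ FX FY.
        by exists (Y `|` S); [exact: FP|split; left=> //; exact: XY].
      by exists (X `|` S); [exact: FP|split; left=> //; exact: YX].
    - by exists (X `|` S); [exact: FP|split; [left|right]].
    - by exists (Y `|` S); [exact: FP|split; [right|left]].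
    - by exists S.
  split.
  - by move=> s Hs; have [X [XB _ _] [Xs _]] := chain s s Hs Hs; exact: XB.
  - by move=> s t Hs Ht; have [X [_ Xc _] [Xs Xt]] := chain s t Hs Ht; exact: Xc.
  - by move=> s Hs; have [X [_ _ Xd] [Xs _]] := chain s s Hs Hs; exact: Xd.
have [YB Yc Yd] := PA; set Y := A `|` S in YB Yc Yd.
have Ymax c : B c -> diagble c -> (forall y, Y y -> c *m y = y *m c) -> Y c.
  move=> Bc dc cc; apply: contrapT => nYc; apply: (Amax (A `|` [set c])).
    split; first by move=> x; left.
    by move=> /(_ c) H; apply: nYc; left; apply: H; right.
  have sub x : ((A `|` [set c]) `|` S) x -> Y x \/ x = c.
    by move=> [[Ax|->]|Sx]; [left; left|right|left; right].
  split.
  - by move=> x /sub[/YB|->].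
  - move=> s t /sub[Ys|->] /sub[Yt|->] //; first exact: Yc.
      by rewrite cc.
    by rewrite cc.
  - by move=> s /sub[/Yd|->].
pose I := {y : zmat C n | Y y}.
pose dl (y : I) := dgr (sval y).
have IB (y : I) : Bn (sval y) by apply: BBn; apply: YB; exact: (svalP y).
have dl0 (y : I) : forall i, dl y 0 i != 0 by exact: dgr_neq0 (IB y).
have [F [_ FU HF]] := straighten dl0 (@Un_algebraic C n) (@subset_refl _ _) (fun s u => conjd_norm (dl0 s)).
pose b0 := F sval; have Ub0 : Un b0 by exact: FU.
have b0u := Un_unit Ub0; have ub0 := Un_upper Ub0.
have Hb0 y : Y y -> invmx b0 *m y *m b0 = dmx (dgr y).
  move=> Yy; apply: (HF (fun s : I => sval s) _ (exist _ y Yy)); split.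
  - move=> s; apply: upper_dmx_Un => //; first by have [] := IB s.
    by move=> i; rewrite mxE.
  - by move=> s t; apply: Yc; [exact: (svalP s)|exact: (svalP t)].
  - by move=> s; apply: Yd; exact: (svalP s).
exists b0; split=> //.
  by move=> s Ss; rewrite Hb0; [exact: diag_mx_is_diag|right].
set B' := conjg (invmx b0) B; have b0u' : invmx b0 \in unitmx by rewrite unitmx_inv.
have aB' : algebraic_group B' by exact: conjg_algebraic.
have [gB' [DB' cDB' B'E]] := aB'; have [BG' B1' BM' BV'] := gB'.
have B'Bn : B' `<=` @Bn C n.
  move=> _ [b /BBn[ub bu] <-]; rewrite invmxK; split; last by rewrite !unitmx_mul unitmx_inv b0u bu.
  by do 2?apply: upperM => //; exact: upper_inv.
have Y'B y : Y y -> B' (dmx (dgr y)).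
  by move=> Yy; rewrite -Hb0 //; exists y; [exact: YB|rewrite invmxK].
move=> b B'b; have [ub bu] := B'Bn _ B'b.
pose U := B' `&` @Un C n.
have aU : algebraic_group U by apply: algebraic_setI => //; exact: Un_algebraic.
have Unorm (s : I) u : U u -> U (dmx (rinv (dl s)) *m u *m dmx (dl s)).
  move=> [B'u Unu]; split; last exact: conjd_norm.
  have Bs := Y'B _ (svalP s); have su := BG' _ Bs.
  have -> : dmx (rinv (dl s)) = invmx (dmx (dl s)).
    by apply: (can_inj (mulKmx su)); rewrite mulmxV // (dmxV (dl0 s)).
  exact: (BM' _ _ (BM' _ _ (BV' _ Bs) B'u) Bs).
have UUn : U `<=` Un by move=> x [].
have [G [_ GU HG]] := straighten dl0 aU UUn Unorm.
(* [b] need not commute with the family. Straightening the family conjugated by [b], inside the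
   unipotent part of [B'], replaces [b] by [c = b *m G th], which commutes with it and has the same
   diagonal. *)
pose th (s : I) : 'M[C]_n := invmx b *m dmx (dl s) *m b.
have okth : straightenable dl U th.
  split.
  - move=> s; have Bs := Y'B _ (svalP s); have su := BG' _ Bs; split.
      have -> : dmx (rinv (dl s)) = invmx (dmx (dl s)).
        by apply: (can_inj (mulKmx su)); rewrite mulmxV // (dmxV (dl0 s)).
      exact: (BM' _ _ (BV' _ Bs) (BM' _ _ (BM' _ _ (BV' _ B'b) Bs) B'b)).
    have uth : upper (th s) by do 2?apply: upperM => //; [exact: upper_inv|exact: dmx_upper].
    apply: upper_dmx_Un => // i.
    rewrite upperM_diag //; last by apply: upperM; [exact: upper_inv|exact: dmx_upper].
    rewrite upperM_diag //; [|exact: upper_inv|exact: dmx_upper].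
    rewrite upper_inv_diag // dmx_diag mulrAC mulVf ?mul1r //.
    by move: bu; rewrite upper_unit // => /forallP.
  - move=> s t; rewrite /th !mulmxA mulmxK // mulmxK //.
    by rewrite -[invmx b *m _ *m _]mulmxA dmxC mulmxA.
  - move=> s; apply: diagble_conj => //; exists 1%:M; first exact: unitmx1.
    by rewrite invmx1 mul1mx mulmx1; exact: diag_mx_is_diag.
have [c cdef] : exists c : zmat C n, c = b *m G th by eexists.
have [B'G UnG] := GU th; have Gu := Un_unit UnG.
have B'c : B' c by rewrite cdef; exact: BM'.
have cc y : Y y -> c *m dmx (dgr y) = dmx (dgr y) *m c.
  move=> Yy; have := HG th okth (exist _ y Yy); rewrite /th /dl /= => E.
  have := congr1 (fun M : 'M_n => b *m (G th *m M)) E; rewrite cdef !mulmxA mulmxK //.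
  by rewrite mulmxV // mul1mx => ->.
have [uc cu] := B'Bn _ B'c.
have [v Uv Hv] := jordan_upper (B'Bn _ B'c).
have [cs csdef] : exists cs : zmat C n, cs = v *m dmx (dgr c) *m invmx v by eexists.
rewrite -csdef in Hv.
have vu := Un_unit Uv.
have csu : cs \in unitmx.
  by rewrite csdef !unitmx_mul unitmx_inv vu (dmx_unit (dgr_neq0 (B'Bn _ B'c))).
have B'cs : B' cs.
  rewrite B'E; split=> //; apply: Hv => // m; have := mxpow_group m gB' B'c.
  by rewrite B'E => -[].
have cscomm y : Y y -> cs *m dmx (dgr y) = dmx (dgr y) *m cs.
  move=> Yy; have r := @polyfun_ring C n.
  apply: (Hv [set x : zmat C n | x *m dmx (dgr y) = dmx (dgr y) *m x]).
    by apply: closed_mxeq; apply: (mxinM r); [exact: mxin_id|exact: (mxin_cst r)|exact: (mxin_cst r)|exact: mxin_id].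
  elim=> [|m IH] /=; first by rewrite mul1mx mulmx1.
  by rewrite -mulmxA IH mulmxA cc // mulmxA.
(* The semisimple part [cs] of [c] lies in [B'] and commutes with the family, as both are closed
   conditions satisfied by the powers of [c]. By maximality it belongs to the family, hence is
   diagonal in the straightened coordinates. *)
have Ycs : Y (b0 *m cs *m invmx b0).
  apply: Ymax.
  - by have [x Bx] := B'cs; rewrite invmxK => <-; rewrite !mulmxA mulmxV // mul1mx mulmxK.
  - rewrite -{1}[b0]invmxK; apply: diagble_conj => //.
    rewrite csdef -{1}[v]invmxK; apply: diagble_conj; first by rewrite unitmx_inv.
    exists 1%:M; first exact: unitmx1.
    by rewrite invmx1 mul1mx mulmx1; exact: diag_mx_is_diag.
  - move=> y Yy; have yE : y = b0 *m dmx (dgr y) *m invmx b0.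
      by rewrite -(Hb0 _ Yy) !mulmxA mulmxV // mul1mx mulmxK.
    rewrite {1}yE {2}yE !mulmxA !mulmxKV //.
    by rewrite -[b0 *m cs *m _]mulmxA cscomm // !mulmxA.
have csd : cs = dmx (dgr (b0 *m cs *m invmx b0)).
  by rewrite -(Hb0 _ Ycs) !mulmxA mulVmx // mul1mx mulmxKV.
have csupper : upper (cs : 'M_n) by rewrite csd; exact: dmx_upper.
suff -> : dmx (dgr b) = cs by [].
rewrite {1}csd; congr dmx; apply/rowP => i; rewrite [LHS]mxE [RHS]mxE.
have -> : (b0 *m cs *m invmx b0) i i = (cs : 'M_n) i i.
  by have := conjd_diag (UnV Ub0) csupper i; rewrite invmxK.
have := conjd_diag (UnV Uv) (dmx_upper (dgr c)) i; rewrite invmxK -csdef => ->.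
rewrite dmx_diag mxE cdef upperM_diag //; last exact: Un_upper.
by rewrite (Un_diag _ UnG) mulr1.
Qed.

End Jordan.

(** * Centralizers *)

Section Centralizer.
Context {C : numClosedFieldType} {n : nat}.
Implicit Types (G H B S : set (zmat C n)).

Definition comm_diag S := (forall s t, S s -> S t -> s *m t = t *m s) /\
  (forall s, S s -> diagble s).

Lemma fixedE S H x : S `<=` @GL C n -> fixed_subgroup S H x <->
  H x /\ forall s, S s -> s *m x = x *m s.
Proof.
move=> SG; split=> -[Hx Sx]; split=> // s Ss.
  by rewrite -[in RHS](Sx s Ss) mulmxKV //; exact: SG.
by rewrite Sx // mulmxK //; exact: SG.
Qed.

Lemma fixed_algebraic S H : S `<=` @GL C n -> algebraic_group H ->
  algebraic_group (fixed_subgroup S H).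
Proof.
move=> SG [[HG H1 HM HV] cH]; split.
  split.
  - by move=> x [/HG].
  - by apply/fixedE => //; split=> // s _; rewrite mulmx1 mul1mx.
  - move=> x y /(fixedE _ _ SG)[Hx Sx] /(fixedE _ _ SG)[Hy Sy]; apply/fixedE => //.
    by split=> [|s Ss]; [exact: HM|rewrite mulmxA Sx // -mulmxA Sy // mulmxA].
  - move=> x /(fixedE _ _ SG)[Hx Sx]; apply/fixedE => //; split=> [|s Ss]; first exact: HV.
    have xu := HG _ Hx; apply: (can_inj (mulKmx xu)).
    by rewrite [in RHS]mulmxA mulmxV // mul1mx mulmxA -Sx // mulmxK.
rewrite (_ : fixed_subgroup S H = [set x : zmat C n | forall s : {s | S s}, sval s *m x = x *m sval s] `&` H).
  apply: (@lclosed_closedI C n) => //; apply: closed_all => s.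
  have r := @polyfun_ring C n.
  by apply: closed_mxeq; apply: (mxinM r); [exact: (mxin_cst r)|exact: mxin_id|exact: mxin_id|exact: (mxin_cst r)].
apply/seteqP; split=> x.
  by move=> /(fixedE _ _ SG)[Hx Sx]; split=> // -[s Ss]; exact: Sx.
by move=> [Sx Hx]; apply/fixedE => //; split=> // s Ss; exact: (Sx (exist _ s Ss)).
Qed.

Lemma fixed_conj g S H : g \in unitmx -> S `<=` @GL C n ->
  conjg g (fixed_subgroup S H) = fixed_subgroup (conjg g S) (conjg g H).
Proof.
move=> gu SG; have SG' : conjg g S `<=` @GL C n.
  by move=> _ [s /SG su <-]; rewrite /GL /= !unitmx_mul unitmx_inv gu andbT; exact: su.
apply/seteqP; split=> x.
  move=> [h /(fixedE _ _ SG)[Hh Sh] <-]; apply/fixedE => //; split; first by exists h.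
  by move=> _ [s Ss <-]; rewrite !mulmxA !mulmxKV // -[g *m s *m h]mulmxA (Sh _ Ss) !mulmxA.
move=> /(fixedE _ _ SG')[[h Hh <-] Sh]; exists h => //; apply/fixedE => //; split=> // s Ss.
have := Sh (g *m s *m invmx g); rewrite !mulmxA !mulmxKV // => H'.
have {H'} : g *m s *m h *m invmx g = g *m h *m s *m invmx g by apply: H'; exists s.
move=> /(congr1 (mulmx^~ g)); rewrite !mulmxKV // => /(congr1 (mulmx (invmx g))).
by rewrite !mulmxA mulVmx // !mul1mx.
Qed.

Lemma conjg_comm_diag g S : g \in unitmx -> comm_diag S -> comm_diag (conjg g S).
Proof.
move=> gu [Sc Sd]; split.
  move=> _ _ [s Ss <-] [t St <-]; rewrite !mulmxA !mulmxKV //.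
  by rewrite -[g *m s *m t]mulmxA (Sc _ _ Ss St) !mulmxA.
move=> _ [s Ss <-]; rewrite -{1}[g]invmxK; apply: diagble_conj; last exact: Sd.
by rewrite unitmx_inv.
Qed.

(** Coordinates in which [B] is the product of its diagonal and its unipotent part, and [S] lies in
    the diagonal part. *)
Lemma solvable_coords B S : algebraic_group B -> connected B -> solvable_group B ->
  S `<=` B -> comm_diag S -> exists w : zmat C n, [/\ (w : 'M_n) \in unitmx,
    conjg (invmx w) B `<=` @Bn C n, forall s, S s -> is_diag_mx (invmx w *m s *m w) &
    forall x, conjg (invmx w) B x -> conjg (invmx w) B (dmx (dgr x))].
Proof.
move=> aB cB sB SB dS; have [gB _] := aB; have [BG _ _ _] := gB.
have [g gu Hg] := lie_kolchin gB cB sB.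
have gu' : invmx g \in unitmx by rewrite unitmx_inv.
have B1Bn : conjg (invmx g) B `<=` @Bn C n.
  move=> _ [b Bb <-]; rewrite invmxK; split; first exact: Hg.
  by rewrite !unitmx_mul gu' gu (BG _ Bb).
have [S1c S1d] := conjg_comm_diag gu' dS.
have [b0 [ub0 b0u H1 H2]] := solvable_structure (conjg_algebraic gu' aB) B1Bn
  (conjgS SB) S1c S1d.
have b0u' : invmx b0 \in unitmx by rewrite unitmx_inv.
have E : conjg (invmx (g *m b0)) B = conjg (invmx b0) (conjg (invmx g) B).
  by rewrite (invmxM gu b0u) conjg_mul.
exists (g *m b0); split.
- by rewrite unitmx_mul gu.
- rewrite E => _ [x /B1Bn[ux xu] <-]; rewrite invmxK; split.
    by apply: upperM => //; apply: upperM => //; exact: upper_inv.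
  by rewrite !unitmx_mul b0u' b0u xu.
- move=> s Ss; have := H1 (invmx g *m s *m g); rewrite (invmxM gu b0u) !mulmxA; apply.
  by exists s => //; rewrite invmxK.
- by rewrite E.
Qed.

(** In the coordinates of [solvable_coords], an element of the centralizer is [a *m u] with [a]
    diagonal and [u] unipotent. The diagonal parts form a connected image of [B] that commutes with
    [S], and [u] is joined to 1 inside the centralizer by its powers [pw u t]. *)
Lemma centralizer_connected B S : algebraic_group B -> connected B -> solvable_group B ->
  S `<=` B -> comm_diag S -> connected (fixed_subgroup S B).
Proof.
move=> aB cB sB SB dS; have [[BG _ _ _] _] := aB.
have SG : S `<=` @GL C n by move=> s /SB /BG.
have [w [wu BBn Sdiag Bdiag]] := solvable_coords aB cB sB SB dS.
have wu' : invmx w \in unitmx by rewrite unitmx_inv.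
have -> : fixed_subgroup S B = conjg w (fixed_subgroup (conjg (invmx w) S) (conjg (invmx w) B)).
  by rewrite -fixed_conj // -{1}[w]invmxK conjg_inv.
apply: conjg_connected; set S2 := conjg _ S; set B2 := conjg _ B in BBn Bdiag *.
have aB2 : algebraic_group B2 by exact: conjg_algebraic.
have cB2 : connected B2 by exact: conjg_connected.
have S2G : S2 `<=` @GL C n by move=> s /(conjgS SB) /BBn[].
have S2d s : S2 s -> s = dmx (dgr s).
  by move=> [t /Sdiag dt <-]; rewrite invmxK [LHS]is_diag_dmx.
have [[B2G B21 B2M B2V] _] := aB2.
set F := fixed_subgroup S2 B2.
have aF : algebraic_group F by exact: fixed_algebraic.
have [gF _] := aF; have [FG F1 FM FV] := gF.
pose A := (fun x : zmat C n => dmx (dgr x) : zmat C n) @` B2.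
have cA : connected A.
  apply: connected_image => // x _; apply: poly_continuous => i j.
  have r := @polyfun_ring C n; under eq_fun do rewrite mxE.
  have [->|ij] := eqVneq i j.
    by under eq_fun do rewrite mulr1n mxE; exact: polyfun_coord.
  by under eq_fun do rewrite mulr0n; exact: frC r _.
have A1 : A 1%:M.
  exists 1%:M => //; apply/matrixP => i j; rewrite [LHS]mxE [dgr _ _ _]mxE !mxE eqxx.
  by case: (i == j).
have AF : A `<=` F.
  move=> _ [x B2x <-]; apply/fixedE => //; split; first exact: Bdiag.
  by move=> s /S2d ->; exact: dmxC.
have key x : F x -> exists2 T : set (zmat C n), connected T & [/\ T 1%:M, T x & T `<=` F].
  move=> Fx; have [B2x Sx] := (fixedE B2 x S2G).1 Fx.
  pose a := dmx (dgr x); have Aa : A a by exists x.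
  have Fa := AF _ Aa; have au := FG _ Fa.
  have [u udef] : exists u : zmat C n, u = invmx a *m x by eexists.
  have Fu : F u by rewrite udef; apply: FM => //; exact: FV.
  have Uu : Un u.
    have xBn := BBn _ B2x; have [ux xu] := xBn.
    rewrite udef (_ : invmx a = dmx (rinv (dgr x))).
      by apply: upper_dmx_Un => //; [exact: dgr_neq0|move=> i; rewrite mxE].
    apply: (can_inj (mulKmx au)); rewrite mulmxV // dmxV //; exact: dgr_neq0.
  exists (A `|` (fun y : zmat C n => a *m y *m 1%:M : zmat C n) @` range (pw u)).
    apply: connectedU => //.
      exists a; split=> //; exists 1%:M; last by rewrite !mulmx1.
      by exists 0 => //; rewrite pw0.
    apply: connected_image; first by apply: curve_connected; exact: pw_poly1.
    by move=> y _; exact: sandwich_continuous.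
  split; first by left.
    right; exists u; first by exists 1 => //; rewrite pw1.
    by rewrite mulmx1 udef mulmxA mulmxV // mul1mx.
  move=> y [/AF //|[_ [t _ <-] <-]]; rewrite mulmx1; apply: FM => //.
  exact: pw_group.
suff -> : F = identity_component F by exact: component_connected.
apply/seteqP; split; last exact: idcomp_sub.
by move=> x /key[T cT [T1 Tx TF]]; apply: (idcomp_max cT).
Qed.

Lemma diagonalize_upper S : S `<=` @Bn C n -> comm_diag S ->
  exists2 b : zmat C n, Un b & forall s, S s -> invmx b *m s *m b = dmx (dgr s).
Proof.
move=> SBn [Sc Sd]; pose I := {s : zmat C n | S s}; pose dl (s : I) := dgr (sval s).
have dl0 (s : I) : forall i, dl s 0 i != 0 by apply: dgr_neq0; apply: SBn; exact: (svalP s).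
have [F [_ FU HF]] := straighten dl0 (@Un_algebraic C n) (@subset_refl _ _) (fun s u => conjd_norm (dl0 s)).
exists (F sval) => // s Ss; apply: (HF (fun s : I => sval s) _ (exist _ s Ss)); split.
- move=> t; apply: upper_dmx_Un => //; first by have [] := SBn _ (svalP t).
  by move=> i; rewrite mxE.
- by move=> t t'; apply: Sc; [exact: (svalP t)|exact: (svalP t')].
- by move=> t; apply: Sd; exact: (svalP t).
Qed.

(* If [S] has the same diagonal characters in the flags [g z1] and [g1 z1],
   an element of [G] centralizing [S] moves the second flag to the first one;
   it depends regularly on [g]. *)
Section Transport.
Variables (G S : set (zmat C n)) (z1 g1 : zmat C n).
Hypothesis aG : algebraic_group G.
Hypothesis SGL : S `<=` G.
Hypothesis dS : comm_diag S.
Hypothesis z1u : (z1 : 'M_n) \in unitmx.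
Hypothesis Gg1 : G g1.
Hypothesis diag1 : forall s, S s -> is_diag_mx (invmx (g1 *m z1) *m s *m (g1 *m z1)).

Definition Uflag := conjg (invmx z1) G `&` @Un C n.

Definition same_chars (z : zmat C n) := forall s, S s ->
  upper (invmx z *m s *m z) /\
  forall i, (invmx z *m s *m z) i i = (invmx (g1 *m z1) *m s *m (g1 *m z1)) i i.

Lemma Uflag_algebraic : algebraic_group Uflag.
Proof.
apply: algebraic_setI; last exact: Un_algebraic.
by apply: conjg_algebraic => //; rewrite unitmx_inv.
Qed.

Lemma transport : exists k : zmat C n -> zmat C n,
  [/\ forall (X : Type) (P : (X -> C) -> Prop) (f : X -> zmat C n), fun_ring P ->
        mx_in P f -> mx_in P (fun a => invmx (f a)) -> mx_in P (fun a => k (f a)),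
      forall g, (g : 'M_n) \in unitmx -> Uflag (invmx (g *m z1) *m k g *m (g1 *m z1)) &
      forall g, G g -> same_chars (g *m z1) -> fixed_subgroup S G (k g)].
Proof.
have [gG _] := aG; have [GG G1 GM GV] := gG.
have SG : S `<=` @GL C n by move=> s /SGL /GG.
have g1u := GG _ Gg1; have gzu : g1 *m z1 \in unitmx by rewrite unitmx_mul g1u.
pose I := {s : zmat C n | S s}.
pose dl (s : I) := dgr (invmx (g1 *m z1) *m sval s *m (g1 *m z1)).
have dlE (s : I) : dmx (dl s) = invmx (g1 *m z1) *m sval s *m (g1 *m z1).
  by rewrite [RHS]is_diag_dmx //; apply: diag1; exact: (svalP s).
have dl0 (s : I) : forall i, dl s 0 i != 0.
  move=> i; have : dmx (dl s) \in unitmx.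
    by rewrite dlE !unitmx_mul unitmx_inv unitmx_mul g1u z1u (SG _ (svalP s)).
  by rewrite unitmxE unitfE det_diag => /prodf_neq0; apply.
have z1u' : invmx z1 \in unitmx by rewrite unitmx_inv.
have aU := Uflag_algebraic; have [gU _] := aU; have [UG U1 UM UV] := gU.
have UUn : Uflag `<=` @Un C n by move=> x [].
have gG' : matrix_subgroup (conjg (invmx z1) G) by exact: conjg_subgroup.
have [GG' _ GM' GV'] := gG'.
have inG' x : G x -> conjg (invmx z1) G (invmx z1 *m x *m z1) by move=> Gx; exists x => //; rewrite invmxK.
have dG (s : I) : conjg (invmx z1) G (dmx (dl s)).
  rewrite dlE (invmxM g1u z1u).
  have -> : invmx z1 *m invmx g1 *m sval s *m (g1 *m z1) = invmx z1 *m (invmx g1 *m sval s *m g1) *m z1.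
    by rewrite !mulmxA.
  apply: inG'; apply: (GM _ _ (GM _ _ (GV _ Gg1) _) Gg1); apply: SGL; exact: (svalP s).
have dlV (s : I) : dmx (rinv (dl s)) = invmx (dmx (dl s)).
  apply: (can_inj (mulKmx (GG' _ (dG s)))).
  by rewrite mulmxV ?(dmxV (dl0 s)) //; exact: GG' (dG s).
have Unorm (s : I) u : Uflag u -> Uflag (dmx (rinv (dl s)) *m u *m dmx (dl s)).
  move=> [Gu Unu]; split; last exact: conjd_norm.
  by rewrite dlV; exact: (GM' _ _ (GM' _ _ (GV' _ (dG s)) Gu) (dG s)).
have [F [nF FU HF]] := straighten dl0 aU UUn Unorm.
pose th (g : zmat C n) (s : I) : 'M[C]_n := invmx z1 *m invmx g *m sval s *m g *m z1.
(* In the frame [g *m z1 *m F (th g)] every [s] has the same matrix as in the frame [g1 *m z1], so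
   the change of frame commutes with [S]. *)
exists (fun g => g *m z1 *m F (th g) *m invmx (g1 *m z1)); split.
- move=> X P f rP Pf Pf'; have cst (a b : nat) (A : 'M[C]_(a, b)) : mx_in P (fun=> A) by exact: (mxin_cst rP).
  apply: (mxinM rP) => //; apply: (mxinM rP); first exact: (mxinM rP).
  by apply: nF => // s; do 4?[apply: (mxinM rP) => //].
- move=> g gu; have gz : g *m z1 \in unitmx by rewrite unitmx_mul gu.
  by rewrite -(mulmxA (invmx _)) mulmxKV // mulKmx //; have [] := FU (th g).
move=> g Gg Hg; have gu := GG _ Gg; have gz : g *m z1 \in unitmx by rewrite unitmx_mul gu.
have thE s : th g s = invmx (g *m z1) *m sval s *m (g *m z1) by rewrite (invmxM gu z1u) !mulmxA.
have okth : straightenable dl Uflag (th g).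
  split.
  - move=> s; have [us ds] := Hg _ (svalP s); split.
      rewrite dlV; apply: (GM' _ _ (GV' _ (dG s))).
      have -> : th g s = invmx z1 *m (invmx g *m sval s *m g) *m z1 by rewrite /th !mulmxA.
      by apply: inG'; apply: (GM _ _ (GM _ _ (GV _ Gg) _) Gg); apply: SGL; exact: (svalP s).
    rewrite thE; apply: upper_dmx_Un => // i; rewrite ds [RHS]mxE //.
  - move=> s t; rewrite !thE.
    have [K Kdef] : exists K : zmat C n, K = g *m z1 by eexists.
    rewrite -Kdef in gz *; rewrite !mulmxA !mulmxK //.
    by rewrite -[invmx K *m sval s *m sval t]mulmxA (dS.1 _ _ (svalP s) (svalP t)) !mulmxA.
  - by move=> s; rewrite thE; apply: diagble_conj => //; apply: dS.2; exact: (svalP s).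
have [[h Gh hE] UnF] := FU (th g); have Fu := Un_unit UnF.
have FE : F (th g) = invmx z1 *m h *m z1 by rewrite -hE invmxK.
have kE : g *m z1 *m F (th g) *m invmx (g1 *m z1) = g *m h *m invmx g1.
  by rewrite FE (invmxM g1u z1u) !mulmxA mulmxK // mulmxK.
apply/fixedE => //; split; first by rewrite kE; exact: (GM _ _ (GM _ _ Gg Gh) (GV _ Gg1)).
move=> s Ss; have := HF _ okth (exist _ s Ss); rewrite dlE thE /= => E.
have := congr1 (fun M : 'M_n => (g *m z1) *m F (th g) *m M *m invmx (g1 *m z1)) E.
rewrite /=; set M1 := _ *m _ *m (invmx (F (th g)) *m _ *m _) *m _.
have -> : M1 = s *m (g *m z1 *m F (th g) *m invmx (g1 *m z1)).
  rewrite /M1 !mulmxA mulmxK // -[g *m z1 *m invmx (g *m z1)]/(g *m z1 *m invmx (g *m z1)).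
  by rewrite mulmxV // mul1mx.
by move=> ->; rewrite !mulmxA -[_ *m g1 *m z1]mulmxA mulmxK.
Qed.

End Transport.

(** A unipotent element is joined to 1 by its powers [pw u t], so it lies in the identity component
    even if the whole stabilizer is disconnected. *)
Lemma Uflag_borel G z : algebraic_group G -> (z : 'M_n) \in unitmx ->
  conjg z (Uflag G z) `<=` identity_component (G `&` conjg z (@Bn C n)).
Proof.
move=> aG zu _ [u [Gu Unu] <-].
have zu' : invmx z \in unitmx by rewrite unitmx_inv.
apply: (@idcomp_max _ _ _ (conjg z (range (pw u)))).
- by apply: conjg_connected; apply: curve_connected; exact: pw_poly1.
- by exists 1%:M; [exists 0 => //; rewrite pw0|rewrite mulmx1 mulmxV].
- move=> _ [_ [t _ <-] <-]; have [Gt Unt] : Uflag G z (pw u t).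
    by apply: pw_group => //; exact: Uflag_algebraic.
  split; last by exists (pw u t) => //; split; [exact: Un_upper|exact: Un_unit].
  by case: Gt => h Gh <-; rewrite invmxK !mulmxA mulmxV // mul1mx mulmxK.
- by exists u => //; exists 1 => //; rewrite pw1.
Qed.

Lemma same_charsM S z1 g1 z (b : zmat C n) : (z : 'M_n) \in unitmx -> @Bn C n b ->
  same_chars S z1 g1 z -> same_chars S z1 g1 (z *m b).
Proof.
move=> zu [ub bu] H s Ss; have [us ds] := H s Ss; have ub' := upper_inv ub.
have E : invmx (z *m b) *m s *m (z *m b) = invmx b *m (invmx z *m s *m z) *m b.
  by rewrite (invmxM zu bu) !mulmxA.
rewrite E; split; first by apply: upperM => //; exact: upperM.
move=> i; rewrite upperM_diag //; last exact: upperM.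
rewrite upperM_diag // ds upper_inv_diag // mulrAC mulVf ?mul1r //.
by move: bu; rewrite upper_unit // => /forallP.
Qed.

(** The adjugate replaces the inverse, and the characters are multiplied by the determinant, so that
    the conditions become polynomial. *)
Lemma same_chars_closed S z1 g1 : exists2 D : set (zmat C n), closed D &
  forall z : zmat C n, (z : 'M_n) \in unitmx -> same_chars S z1 g1 z <-> D z.
Proof.
pose c (s : zmat C n) : 'M[C]_n := invmx (g1 *m z1) *m s *m (g1 *m z1).
pose D := [set z : zmat C n | forall x : {x : zmat C n * ('I_n * 'I_n) | S x.1 /\ (x.2.2 <= x.2.1)%N},
  (\adj (z : 'M_n) *m (sval x).1 *m z) (sval x).2.1 (sval x).2.2 =
  (if (sval x).2.1 == (sval x).2.2 then c (sval x).1 (sval x).2.1 (sval x).2.2 else 0) * \det (z : 'M_n)].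
exists D.
  apply: closed_all => -[[s [i j]] /= _]; have r := @polyfun_ring C n.
  apply: zclosed_eq; last by apply: (frM r); [exact: (frC r)|apply: (fr_det r); exact: mxin_id].
  apply: (mxinM r); last exact: mxin_id.
  apply: (mxinM r); last exact: (mxin_cst r).
  move=> a b; under eq_fun do rewrite mxE /cofactor; apply: (frM r); first exact: (frC r).
  by apply: (fr_det r) => a' b'; under eq_fun do rewrite !mxE; exact: mxin_id.
move=> z zu; have dz : \det z != 0 by rewrite -unitfE -unitmxE.
have E s i j : (\adj z *m s *m z) i j = (invmx z *m s *m z) i j * \det z.
  by rewrite /invmx zu -!scalemxAl [in RHS]mxE mulrC mulrA mulfV // mul1r.
split.
  move=> H [[s [i j]] /= [Ss ji]]; rewrite E; have [us ds] := H s Ss; congr (_ * _).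
  have [ij|ij] := eqVneq i j; first by rewrite -ij ds.
  by apply: us; rewrite ltn_neqAle ji eq_sym val_eqE ij.
move=> H s Ss; split=> [i j ji|i].
  have := H (exist _ (s, (i, j)) (conj Ss (ltnW ji))); rewrite /= E -val_eqE gtn_eqF // mul0r.
  by move/eqP; rewrite mulf_eq0 (negbTE dz) orbF => /eqP.
have := H (exist _ (s, (i, i)) (conj Ss (leqnn i))); rewrite /= E eqxx.
exact: (mulIf dz).
Qed.

End Centralizer.

(** * Borel subgroups of the centralizer of [S] *)

Section CentralizerBorel.
Context {C : numClosedFieldType} {n : nat}.
Implicit Types (G H B S : set (zmat C n)).

Hypothesis bfp : borel_property C.

Lemma dcoset_mul G z h b : matrix_subgroup G -> G h -> Bn b ->
  dcoset G (h *m z *m b) = dcoset G z.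
Proof.
move=> [GG G1 GM GV] Gh Bb; have hu := GG _ Gh; have bu := Bb.2.
have [_ _ BM BV] := @Bn_subgroup C n.
apply/seteqP; split=> x [g [c [Gg Bc ->]]].
  by exists (g *m h), (b *m c); split; [exact: GM|exact: BM|rewrite !mulmxA].
exists (g *m invmx h), (invmx b *m c); split.
- by apply: GM => //; exact: GV.
- by apply: BM => //; exact: BV.
- by rewrite !mulmxA mulmxK // mulmxKV.
Qed.

(** [borel_flag] provides a flag with the required stabilizer; a unitriangular change of basis,
    which does not move the flag, then diagonalizes [S]. *)
Lemma diagonal_flag G B S g1 : algebraic_group G -> borel G B -> S `<=` @GL C n ->
  comm_diag S -> G g1 -> conjg (invmx g1) S `<=` B ->
  exists z1 : zmat C n, [/\ (z1 : 'M_n) \in unitmx, lclosed (dcoset G z1),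
    B = identity_component (G `&` conjg z1 (@Bn C n)) &
    forall s, S s -> is_diag_mx (invmx (g1 *m z1) *m s *m (g1 *m z1))].
Proof.
move=> aG bB SG dS Gg1 SB; have [gG _] := aG; have [GG G1 GM GV] := gG.
have g1u := GG _ Gg1.
have [z zu lz] := closed_orbit aG; have [h Hh BE] := borel_flag bfp aG bB zu lz.
have hu := GG _ Hh; have hz : h *m z \in unitmx by rewrite unitmx_mul hu.
have gz : g1 *m (h *m z) \in unitmx by rewrite unitmx_mul g1u.
have gz' : invmx (g1 *m (h *m z)) \in unitmx by rewrite unitmx_inv.
have SBn : conjg (invmx (g1 *m (h *m z))) S `<=` @Bn C n.
  rewrite (invmxM g1u hz) conjg_mul ?unitmx_inv //.
  apply: (@subset_trans _ (conjg (invmx (h *m z)) B)); first exact: conjgS.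
  rewrite BE -[X in _ `<=` X](conjg_inv (g := h *m z)) //; apply: conjgS.
  by move=> x /idcomp_sub[].
have [b Ub Hb] := diagonalize_upper SBn (conjg_comm_diag gz' dS).
have Bb : Bn b by split; [exact: Un_upper|exact: Un_unit].
have bu := Un_unit Ub.
exists (h *m z *m b); split.
- by rewrite unitmx_mul hz.
- by rewrite dcoset_mul.
- by rewrite conjg_mul // (conjg_self (@Bn_subgroup C n)).
move=> s Ss.
have -> : invmx (g1 *m (h *m z *m b)) *m s *m (g1 *m (h *m z *m b)) =
    invmx b *m (invmx (g1 *m (h *m z)) *m s *m (g1 *m (h *m z))) *m b.
  have [K Kdef] : exists K : zmat C n, K = g1 *m (h *m z) by eexists.
  rewrite -Kdef in gz; rewrite (mulmxA g1 (h *m z) b) -Kdef (invmxM gz bu).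
  by rewrite !mulmxA.
rewrite Hb; first exact: diag_mx_is_diag.
by exists s => //; rewrite invmxK.
Qed.

(** The equality rests on the centralizer of [S] in [conjg g1 B] being connected, which puts it
    inside [H]. For maximality, the flags with prescribed characters of [S] are stable under [H]
    because [H] commutes with [S]. *)
Lemma fixed_borel G B S g1 : algebraic_group G -> borel G B -> S `<=` G ->
  comm_diag S -> G g1 -> conjg (invmx g1) S `<=` B ->
  let H := identity_component (fixed_subgroup S G) in
  [/\ H `&` conjg g1 B = fixed_subgroup S (conjg g1 B) & borel H (H `&` conjg g1 B)].
Proof.
move=> aG bB SG dS Gg1 SB H; have [gG cG] := aG; have [GG G1 GM GV] := gG.
have SGL : S `<=` @GL C n by move=> s /SG /GG.
have [[aB cB sB] BG _] := bB; have [gB _] := aB.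
have g1u := GG _ Gg1; have g1u' : invmx g1 \in unitmx by rewrite unitmx_inv.
have aF := fixed_algebraic SGL aG; have [gF _] := aF.
have aH : algebraic_group H by exact: idcomp_algebraic.
have gH := aH.1; have HF : H `<=` fixed_subgroup S G by exact: idcomp_sub.
have aB1 := conjg_algebraic g1u aB; have cB1 := conjg_connected (g := g1) cB.
have sB1 := conjg_solvable g1u gB sB.
have SB1 : S `<=` conjg g1 B.
  by have := conjgS (g := g1) SB; rewrite -{1}[g1]invmxK conjg_inv.
have B1G : conjg g1 B `<=` G by rewrite -(conjg_self gG Gg1); exact: conjgS.
have E1 : H `&` conjg g1 B = fixed_subgroup S (conjg g1 B).
  apply/seteqP; split=> x; first by move=> [/HF[_ Sx] Bx]; split.
  move=> Fx; split; last by case: Fx.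
  apply: (idcomp_max (centralizer_connected aB1 cB1 sB1 SB1 dS)) Fx.
    by split; [have [[]] := aB1|move=> s /SGL su; rewrite mulmx1 mulmxV].
  by move=> y [By Sy]; split=> //; exact: B1G.
split=> //.
have aP : algebraic_group (H `&` conjg g1 B) by exact: algebraic_setI.
have gP := aP.1.
split; [split=> //|by move=> x []|].
- by rewrite E1; exact: centralizer_connected.
- by apply: (solvable_sub gP) sB1 => x [].
move=> P' [aP' cP' sP'] P'H PP'.
have [z1 [z1u lz BE dz]] := diagonal_flag aG bB SGL dS Gg1 SB.
have g1z : g1 *m z1 \in unitmx by rewrite unitmx_mul g1u.
have [D cD HD] := same_chars_closed S z1 g1.
have dGL z : dcoset G z1 z -> (z : 'M_n) \in unitmx.
  by move=> [g [b [Gg [_ bu] ->]]]; rewrite !unitmx_mul (GG _ Gg) z1u.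
have [_ Bn1 BnM BnV] := @Bn_subgroup C n.
have [|||z [Dz [g [b [Gg Bb zE]]]] Hz] := bfp aP'.1 cP' sP' (lclosed_closedI cD lz).
- exists (g1 *m z1); have dc : dcoset G z1 (g1 *m z1).
    by exists g1, 1%:M; split => //; rewrite mulmx1.
  split=> //; apply/HD; first exact: dGL.
  move=> s Ss; split=> // i j ij; have /is_diag_mxP := dz s Ss; apply.
  by rewrite neq_ltn ij orbT.
- move=> q z P'q [Dz' dz']; have Fq := HF _ (P'H _ P'q); have [Gq _] := Fq.
  have zu := dGL _ dz'; have qu := GG _ Gq.
  have dqz : dcoset G z1 (q *m z).
    by have [g [b [Gg Bb ->]]] := dz'; exists (q *m g), b; split; [exact: GM| |rewrite !mulmxA].
  split=> //; apply/HD; first exact: dGL.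
  move=> s Ss; move/HD: Dz' => /(_ zu s Ss).
  suff -> : invmx (q *m z) *m s *m (q *m z) = invmx z *m s *m z by [].
  have [_ /(_ _ Ss) sq] := (fixedE _ _ SGL).1 Fq.
  by rewrite (invmxM qu zu) mulmxA -(mulmxA _ s) sq !mulmxA mulmxKV.
- move=> z b [Dz' dz'] Bb; have zu := dGL _ dz'.
  have dqz : dcoset G z1 (z *m b).
    have [g [b' [Gg Bb' ->]]] := dz'; exists g, (b' *m b); split => //; last by rewrite !mulmxA.
    exact: BnM.
  split=> //; apply/HD; first exact: dGL.
  by apply: same_charsM => //; apply/HD.
have gu := GG _ Gg; have gzu : g *m z1 \in unitmx by rewrite unitmx_mul gu.
have [ub bu] := Bb; have zu : (z : 'M_n) \in unitmx by rewrite zE unitmx_mul gzu.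
have gzE : g *m z1 = z *m invmx b by rewrite zE mulmxK.
have sc : same_chars S z1 g1 (g *m z1).
  by rewrite gzE; apply: same_charsM => //; [exact: BnV|apply/HD].
(* An element commuting with [S] moves the base flag [g1 *m z1] to the fixed flag [z]. It need not
   lie in [H], but it normalizes [H]. *)
have [k [_ kU kF]] := transport aG SG dS z1u Gg1 dz.
have {}kU := kU g gu; have {}kF := kF g Gg sc; have ku := GG _ kF.1.
have [c cdef] : exists c : zmat C n, c = invmx (g *m z1) *m k g *m (g1 *m z1) by eexists.
rewrite -cdef in kU; have Bc : B (z1 *m c *m invmx z1).
  by rewrite BE; apply: Uflag_borel => //; exists c.
have kE : k g *m g1 = g *m (z1 *m c *m invmx z1).
  by rewrite cdef !mulmxA mulmxK // -[g *m z1 *m _]mulmxA mulmxA mulmxV // mul1mx.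
have Ek : conjg (k g) (conjg g1 B) = conjg g B.
  rewrite -conjg_mul // kE conjg_mul //; first by rewrite (conjg_self gB).
  by have [BG' _ _ _] := gB; exact: BG'.
have P'B : P' `<=` conjg g B.
  have aI : algebraic_group (G `&` conjg z1 (@Bn C n)).
    by apply: algebraic_setI => //; apply: conjg_algebraic => //; exact: Bn_algebraic.
  rewrite BE conjg_idcomp //; last exact: aI.1.
  apply: idcomp_max => //; first by have [[]] := aP'.
  move=> q P'q; have Gq := (HF _ (P'H _ P'q)).1; apply/conjgE => //; split.
    exact: (GM _ _ (GM _ _ (GV _ Gg) Gq) Gg).
  apply/conjgE => //; split; last by rewrite !unitmx_mul !unitmx_inv z1u gu (GG _ Gq).
  have -> : invmx z1 *m (invmx g *m q *m g) *m z1 = invmx (g *m z1) *m q *m (g *m z1).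
    by rewrite (invmxM gu z1u) !mulmxA.
  rewrite gzE; have bu' : invmx b \in unitmx by rewrite unitmx_inv.
  rewrite (invmxM zu bu') invmxK.
  have -> : b *m invmx z *m q *m (z *m invmx b) = b *m (invmx z *m q *m z) *m invmx b.
    by rewrite !mulmxA.
  by apply: upperM; [apply: upperM => //; exact: Hz|exact: upper_inv].
have kH : conjg (k g) H = H by rewrite /H conjg_idcomp // (conjg_self gF kF).
have P'k : P' `<=` conjg (k g) (H `&` conjg g1 B).
  rewrite conjg_setI // kH Ek => q P'q; split; [exact: P'H|exact: P'B].
(* The group [P'] lies between [H & g1 B g1^-1] and a conjugate of it, and these coincide by
   Noetherianity. *)
have kP : conjg (k g) (H `&` conjg g1 B) = H `&` conjg g1 B.
  by apply: lclosed_noeth => //; [exact: aP.2|exact: subset_trans P'k].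
by apply/seteqP; split=> //; rewrite -kP.
Qed.

End CentralizerBorel.

(** * Local extension of functions on flags *)

Section LU.
Context {C : numClosedFieldType}.

Definition schur n (x : 'M[C]_(1 + n)) : 'M_n :=
  drsubmx x - dlsubmx x *m ((x 0 0)^-1 *: ursubmx x).

(* The unitriangular factor [v] of the decomposition [x = l v] with [l] lower
   triangular, and the set on which it exists. *)
Fixpoint lu n : 'M[C]_n -> 'M[C]_n :=
  match n return 'M[C]_n -> 'M[C]_n with
  | 0 => fun x => x
  | m.+1 => fun x : 'M[C]_(1 + m) => block_mx 1%:M ((x 0 0)^-1 *: ursubmx x) 0 (lu (schur x))
  end.

Fixpoint lu_dom n : 'M[C]_n -> bool :=
  match n return 'M[C]_n -> bool with
  | 0 => fun=> true
  | m.+1 => fun x : 'M[C]_(1 + m) => (x 0 0 != 0) && lu_dom (schur x)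
  end.

Lemma lu_Un n (x : 'M[C]_n) : Un (lu x : zmat C n).
Proof.
elim: n x => [|n IH] x; first by move=> [].
apply: UnP; first by apply/upper_block; exact: Un_upper (IH _).
move=> i /=; case: (split_ordP (i : 'I_(1 + n))) => i' ->.
  by rewrite (@block_mxEul _ 1 n 1 n) mxE eqxx.
by rewrite (@block_mxEdr _ 1 n 1 n); exact: Un_diag (IH _).
Qed.

Lemma upper_blockE n (b : 'M[C]_(1 + n)) : upper b ->
  b = block_mx (ulsubmx b) (ursubmx b) 0 (drsubmx b) /\ upper (drsubmx b).
Proof.
move=> ub; have E : b = block_mx (ulsubmx b) (ursubmx b) 0 (drsubmx b).
  rewrite -{1}[b]submxK; congr block_mx; apply/matrixP => i j.
  by rewrite [LHS]mxE [LHS]mxE [RHS]mxE ub // (ord1 j).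
by split=> //; move: ub; rewrite {1}E => /upper_block.
Qed.

(** If [x = l v] and [d] is the diagonal of [b], then [x b = (l d) (d^-1 v b)]. In the recursion,
    the Schur complement gets multiplied by the lower right block of [b]. *)
Lemma lu_mul n (x b : 'M[C]_n) : lu_dom x -> @Bn C n b ->
  lu_dom (x *m b) /\ dmx (dgr b) *m lu (x *m b) = lu x *m b.
Proof.
elim: n x b => [|n IH] x b; first by move=> _ _; split=> //; apply/matrixP => -[].
move=> /= /andP[x0 dx] [ub bu].
have [bE ub'] := @upper_blockE n b ub.
have b00 : ulsubmx (b : 'M_(1 + n)) = (b 0 0)%:M.
  by rewrite [LHS]mx11_scalar !mxE; congr (b _ _)%:M; apply/val_inj.
have x00 : ulsubmx (x : 'M_(1 + n)) = (x 0 0)%:M.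
  by rewrite [LHS]mx11_scalar !mxE; congr (x _ _)%:M; apply/val_inj.
have b0 : b 0 0 != 0 by move: bu; rewrite upper_unit // => /forallP.
have ub'' : drsubmx (b : 'M_(1 + n)) \in unitmx.
  rewrite upper_unit //; apply/forallP => i; rewrite mxE mxE.
  by move: bu; rewrite upper_unit // => /forallP; apply.
have xbE : x *m b = block_mx (x 0 0 * b 0 0)%:M
    (x 0 0 *: ursubmx (b : 'M_(1 + n)) + ursubmx (x : 'M_(1 + n)) *m drsubmx (b : 'M_(1 + n)))
    (b 0 0 *: dlsubmx (x : 'M_(1 + n)))
    (dlsubmx (x : 'M_(1 + n)) *m ursubmx (b : 'M_(1 + n)) +
     drsubmx (x : 'M_(1 + n)) *m drsubmx (b : 'M_(1 + n))) :> 'M_(1 + n).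
  rewrite {1}bE -{1}(@submxK _ 1 n 1 n x) (@mulmx_block _ 1 n 1 n 1 n) !mulmx0 !addr0.
  by rewrite b00 x00 -scalar_mxM mul_scalar_mx mul_mx_scalar.
have xb00 : (x *m b) 0 0 = x 0 0 * b 0 0.
  have := congr1 (fun M : 'M_(1 + n) => M (lshift n 0) (lshift n 0)) xbE.
  rewrite block_mxEul [X in _ = X]mxE eqxx mulr1n => <-.
  by congr ((x *m b) _ _); exact/val_inj.
have sE : schur (x *m b : 'M_(1 + n)) = schur (x : 'M_(1 + n)) *m drsubmx (b : 'M_(1 + n)).
  rewrite /schur xb00 xbE block_mxKdr block_mxKdl block_mxKur.
  rewrite -scalemxAl scalemxAr scalerA invfM mulrCA mulfV // mulr1.
  rewrite scalerDr scalerA mulVf // scale1r mulmxDr mulmxBl -!scalemxAr -scalemxAl mulmxA.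
  by rewrite opprD addrACA subrr add0r.
have [d1 E1] := IH _ _ dx (conj ub' ub'').
split; first by rewrite xb00 mulf_neq0 //= sE.
have dE : dmx (dgr b) = block_mx (b 0 0)%:M 0 0 (dmx (dgr (drsubmx (b : 'M_(1 + n))))) :> 'M_(1 + n).
  have -> : dgr b = row_mx (b 0 0)%:M (dgr (drsubmx (b : 'M_(1 + n)))) :> 'rV_(1 + n).
    apply/rowP => i; rewrite mxE; case: (split_ordP (i : 'I_(1 + n))) => i' ->.
      by rewrite row_mxEl (ord1 i') mxE eqxx mulr1n; congr (b _ _); exact/val_inj.
    by rewrite row_mxEr !mxE.
  rewrite /dmx; apply: etrans (@diag_mx_row _ n 1 _ _) _; congr block_mx; apply/matrixP => i j.
  by rewrite (ord1 i) (ord1 j) !mxE eqxx !mulr1n.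
rewrite dE xb00 sE [in RHS]bE !(@mulmx_block _ 1 n 1 n 1 n) !mulmx0 !mul0mx !addr0 !add0r E1.
rewrite !mul1mx mulmx1 b00.
suff -> : (b 0 0)%:M *m ((x 0 0 * b 0 0)^-1 *: ursubmx (x *m b : 'M_(1 + n))) =
    ursubmx (b : 'M_(1 + n)) + (x 0 0)^-1 *: ursubmx (x : 'M_(1 + n)) *m drsubmx (b : 'M_(1 + n)) by [].
rewrite mul_scalar_mx xbE block_mxKur scalerA invfM mulrCA mulfV // mulr1.
by rewrite scalerDr scalerA mulVf // scale1r scalemxAl.
Qed.

Lemma lu1 n : lu_dom (1%:M : 'M[C]_n) /\ lu (1%:M : 'M[C]_n) = 1%:M.
Proof.
elim: n => [|n [IH1 IH2]]; first by split=> //; apply/matrixP => -[].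
have E : (1%:M : 'M[C]_n.+1) = block_mx 1%:M 0 0 1%:M :> 'M_(1 + n) by rewrite -scalar_mx_block.
have sE : schur (1%:M : 'M[C]_(1 + n)) = 1%:M.
  by rewrite /schur E block_mxKdr block_mxKdl mul0mx subr0.
have U0 : ursubmx (1%:M : 'M[C]_(1 + n)) = 0 by rewrite E block_mxKur.
by rewrite /= sE IH1 IH2 U0 scaler0 mxE oner_neq0.
Qed.

Lemma lu_regular m n (x0 : zmat C m) (F : zmat C m -> 'M[C]_n) :
  mx_in (regular_at x0) F -> lu_dom (F x0) ->
  mx_in (regular_at x0) (fun x => lu (F x)) /\ \forall x \near x0, lu_dom (F x).
Proof.
have r := regular_ring x0.
elim: n F => [|n IH] F rF /=; first by split=> //; near=> x.
move=> /andP[F0 dF].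
have rV : regular_at x0 (fun x => (F x 0 0)^-1) by apply: regular_inv => //; exact: rF.
have rur : mx_in (regular_at x0) (fun x => (F x 0 0)^-1 *: ursubmx (F x : 'M_(1 + n))).
  apply: (mxinZ r) => // i j; under eq_fun do rewrite mxE mxE; exact: rF.
have rs : mx_in (regular_at x0) (fun x => schur (F x : 'M_(1 + n))).
  apply: (mxinD r); first by move=> i j; under eq_fun do rewrite mxE mxE; exact: rF.
  apply: (mxinN r); apply: (mxinM r) => // i j.
  by under eq_fun do rewrite mxE mxE; exact: rF.
have [r1 d1] := IH _ rs dF; split.
  exact: (mxin_block (mxin_cst r (1%:M : 'M_1)) rur (mxin_cst r (0 : 'M_(n, 1))) r1).
near=> x; apply/andP; split; last by near: x.
by near: x; apply: (regular_nonzero (f := fun x => F x 0 0)) => //; exact: rF.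
Unshelve. all: by end_near.
Qed.

End LU.

(** * A transversal to a unipotent subgroup *)

Section Slice.
Context {C : numClosedFieldType} {n : nat}.
Implicit Types (x y u b : zmat C n).
Variable U : set (zmat C n).
Hypothesis aU : algebraic_group U.
Hypothesis UUn : U `<=` @Un C n.

(* A set of representatives of [Un / U], stable under diagonal conjugation. *)
Definition slice y := Un y /\ forall i j : 'I_n, (i < j)%N ->
  (y : 'M_n) i j = 0 \/ (forall u, U u -> Nk (key i j) u -> (u : 'M_n) i j = 0).

(** In order of key: once [u] is trivial below [k], the entries of key [k] of [y] and [u] add up in
    [y *m u]. Where [U] can jump, those of [y] and [y *m u] are zero, hence so is that of [u]. *)
Lemma slice_unique y u : slice y -> U u -> slice (y *m u) -> u = 1%:M.
Proof.
move=> [Uy Hy] Uu [_ Hyu]; apply: Nk_end; elim: (n * n)%N => [|k IH]; first exact: UUn.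
apply: Nk_step => // i j ij kij.
have := Nk_coordr IH Uy ij; rewrite kij => /(_ (leqnn k)) E.
case: (Hyu i j ij) => [|]; last by rewrite kij; apply.
case: (Hy i j ij) => [y0|]; last by rewrite kij => + _; apply.
by rewrite E y0 add0r.
Qed.

Lemma slice_conjd y (d : 'rV[C]_n) : (forall i, d 0 i != 0) -> slice y ->
  slice (dmx (rinv d) *m y *m dmx d).
Proof.
move=> d0 [Uy Hy]; have [|H1 H2] := @Nk_conjd C n 0 y d (rinv d) _ Uy.
  by move=> i; rewrite mxE mulVf.
split=> // i j ij; case: (Hy i j ij) => [y0|]; last by right.
by left; rewrite H2 y0 mulr0 mul0r.
Qed.

(** At each key where [U] jumps, the curve of [jump_curve] cancels the current entry, leaving those
    of smaller key unchanged. *)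
Lemma to_slice : exists r : zmat C n -> zmat C n,
  [/\ forall (X : Type) (P : (X -> C) -> Prop) f, fun_ring P -> mx_in P f ->
        mx_in P (fun a : X => r (f a)),
      forall v, U (r v) & forall v, Un v -> slice (v *m r v)].
Proof.
have [gU _] := aU; have [_ U1 UM _] := gU.
suff [r [r1 r2 r3]] : exists r : zmat C n -> zmat C n,
  [/\ forall (X : Type) (P : (X -> C) -> Prop) f, fun_ring P -> mx_in P f ->
        mx_in P (fun a : X => r (f a)),
      forall v, U (r v) & forall v, Un v -> forall i j : 'I_n, (i < j)%N -> (key i j < n * n)%N ->
       (v *m r v) i j = 0 \/ (forall u, U u -> Nk (key i j) u -> (u : 'M_n) i j = 0)].
  exists r; split=> // v Uv; split; first by apply: UnM => //; exact: UUn.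
  by move=> i j ij; apply: r3 => //; exact: key_bound.
elim: (n * n)%N => [|k [r [r1 r2 r3]]].
  exists (fun=> 1%:M); split=> // X P f rP _; exact: (mxin_cst rP).
have [[i [j [ij kij]]]|nex] := pselect (exists i j : 'I_n, (i < j)%N /\ key i j = k); last first.
  exists r; split=> // v Uv i j ij; rewrite ltnS leq_eqVlt => /orP[/eqP kij|]; last exact: r3.
  by case: nex; exists i, j.
have [c [c1 c2 _ c3]] := jump_curve k aU UUn.
exists (fun v => r v *m c (- (v *m r v) i j)); split.
- move=> X P f rP Pf; apply: (mxinM rP); first exact: r1.
  apply: c2 => //; apply: (frN rP); apply: (mxinM rP) => //; exact: r1.
- by move=> v; apply: UM => //; have [] := c1 (- (v *m r v) i j).
move=> v Uv i' j' ij'.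
have [Uc Nc] := c1 (- (v *m r v) i j).
have Uvr : Un (v *m r v) by apply: UnM => //; exact: UUn.
rewrite ltnS mulmxA => kij'; rewrite (Nk_coordr Nc Uvr ij' kij').
move: kij'; rewrite leq_eqVlt => /orP[/eqP kij'|kij']; last first.
  have -> : c (- (v *m r v) i j) i' j' = 0.
    by rewrite Nc ?kij' ?orbT // mxE -val_eqE ltn_eqF.
  by rewrite addr0; exact: r3.
have [-> ->] := key_inj ij' ij (etrans kij' (esym kij)).
case: (c3 i j ij kij) => [->|H]; first by left; rewrite subrr.
by right; rewrite kij.
Qed.

End Slice.

(** * Independence of characters *)

Section Characters.
Context {C : fieldType} {I : Type} {A : Type} (op : A -> A -> A) (chi : I -> A -> C).
Hypothesis chiM : forall i a b, chi i (op a b) = chi i a * chi i b.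

Definition same_chi (i j : I) : bool := `[< forall a, chi i a = chi j a >].

(** Artin's argument: combining the relation at [a] with the one at [op a1 a], where [j] and [i0]
    differ at [a1], removes [j]. Different indices may give the same character, hence the sum over a
    class; [e] excludes the zero character. *)
Lemma char_independent (s : seq I) (c : I -> C) i0 e : chi i0 e != 0 ->
  (forall a, \sum_(i <- s) c i * chi i a = 0) -> \sum_(i <- s | same_chi i i0) c i = 0.
Proof.
move=> e0 H.
have key t : forall (c : I -> C) g,
    (forall a, \sum_(i <- t | ~~ same_chi i i0) c i * chi i a + g * chi i0 a = 0) -> g = 0.
  elim: t => [|j t IH] c' g H'.
    by have /eqP := H' e; rewrite big_nil add0r mulf_eq0 (negbTE e0) orbF => /eqP.
  have [sj|] := boolP (same_chi j i0).
    by apply: (IH c') => a; have := H' a; rewrite big_cons sj.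
  move=> nj; have := nj => /asboolPn /existsNP[a1 /eqP ja1].
  have g1 : g * (chi i0 a1 - chi j a1) = 0.
    apply: (IH (fun i => c' i * (chi i a1 - chi j a1))) => a.
    have E1 := H' (op a1 a); have E2 := H' a.
    have := congr2 (fun x y => x - chi j a1 * y) E1 E2.
    rewrite !big_cons nj !chiM /= mulr0 subr0 => {2}<-.
    under [in RHS]eq_bigr => i _ do rewrite chiM.
    rewrite !mulrDr !mulr_sumr.
    have -> : \sum_(i <- t | ~~ same_chi i i0) c' i * (chi i a1 - chi j a1) * chi i a =
        \sum_(i <- t | ~~ same_chi i i0) c' i * (chi i a1 * chi i a) -
        \sum_(i <- t | ~~ same_chi i i0) chi j a1 * (c' i * chi i a).
      by rewrite -sumrB; apply: eq_bigr => i _; ring.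
    by ring.
  by move/eqP: g1; rewrite mulf_eq0 subr_eq0 [chi i0 a1 == _]eq_sym (negbTE ja1) orbF => /eqP.
apply: (key s c) => a; apply: etrans (H a); rewrite [RHS](bigID (same_chi^~ i0)) /= addrC.
congr (_ + _); rewrite mulr_suml; apply: eq_bigr => i /asboolP Hi.
by rewrite Hi.
Qed.

Lemma class_sum_neq0 (s : seq I) (c : I -> C) : \sum_(i <- s) c i != 0 ->
  exists i0, \sum_(i <- s | same_chi i i0) c i != 0.
Proof.
have [k] := ubnP (size s); elim: k s => // k IH [|j s]; first by rewrite big_nil eqxx.
rewrite ltnS => sk s0.
have [z|nz] := eqVneq (\sum_(i <- j :: s | same_chi i j) c i) 0; last by exists j.
have jj : same_chi j j by apply/asboolP.
have [||i0 Hi0] := IH [seq i <- j :: s | ~~ same_chi i j].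
- by rewrite /= jj /= size_filter; apply: leq_ltn_trans (count_size _ _) _.
- by rewrite big_filter; move: s0; rewrite [X in X != _](bigID (same_chi^~ j)) /= z add0r.
exists i0; move: Hi0; rewrite big_filter_cond.
have [ji|nji] := boolP (same_chi j i0).
  rewrite big1 ?eqxx // => i /andP[/asboolPn ij /asboolP ii0]; case: ij => a.
  by rewrite ii0; move/asboolP: ji => ->.
rewrite (eq_bigl (same_chi^~ i0)) // => i; apply: andb_idl => /asboolP ii0.
apply: contra nji => /asboolP ij; apply/asboolP => a.
by rewrite -ij ii0.
Qed.

End Characters.

(** * Invariant extension of fractions *)

Section FlagSection.
Context {C : numClosedFieldType} {n : nat}.
Implicit Types (x y u b : zmat C n).
Variable B : set (zmat C n).
Hypothesis aB : algebraic_group B.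
Hypothesis BBn : B `<=` @Bn C n.
Hypothesis Bdiag : forall b, B b -> B (dmx (dgr b)).

(** [x] is multiplied by the element of [U] that puts its factor [lu x] into the slice. Uniqueness
    of representatives removes the unipotent part of [B]; since the slice is stable under diagonal
    conjugation, only the diagonal part of [b] remains. *)
Lemma unipotent_section : exists s : zmat C n -> zmat C n,
  [/\ s 1%:M = 1%:M,
      forall x : zmat C n, lu_dom (x : 'M_n) -> mx_in (regular_at x) s,
      forall x : zmat C n, lu_dom (x : 'M_n) -> exists2 u, B u & s x = x *m u &
      forall x b : zmat C n, lu_dom (x : 'M_n) -> B b -> s (x *m b) = s x *m dmx (dgr b)].
Proof.
have [gB _] := aB; have [BG B1 BM BV] := gB.
pose U := B `&` @Un C n.
have aU : algebraic_group U by apply: algebraic_setI => //; exact: Un_algebraic.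
have [[UG U1 UM UV] _] := aU.
have UUn : U `<=` @Un C n by move=> x [].
have [r [r1 r2 r3]] := to_slice aU UUn.
have uniq1 := slice_unique UUn.
exists (fun x => x *m r (lu (x : 'M_n))); split.
- rewrite mul1mx (lu1 n).2; apply: (uniq1 1%:M) => //; last by apply: r3; exact: Un1.
  split; first exact: Un1.
  by move=> i j ij; left; rewrite mxE -val_eqE ltn_eqF.
- move=> x dx; have rr := regular_ring x.
  have rid : mx_in (regular_at x) (fun x : zmat C n => x : 'M_n).
    by move=> i j; apply: regular_poly; exact: polyfun_coord.
  apply: (mxinM rr) => //; apply: r1 => //; exact: (lu_regular rid dx).1.
- by move=> x _; exists (r (lu (x : 'M_n))); have [] := r2 (lu (x : 'M_n)).
move=> x b dx Bb; have Bnb := BBn Bb; have [dxb E] := lu_mul dx Bnb.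
have d0 := dgr_neq0 Bnb; have Bd := Bdiag Bb.
have [d dE] : exists d : zmat C n, d = dmx (dgr b) by eexists.
have [e eE] : exists e : zmat C n, e = dmx (rinv (dgr b)) by eexists.
have du : d \in unitmx by rewrite dE; exact: BG.
have ed : e = invmx d.
  by apply: (can_inj (mulKmx du)); rewrite mulmxV // eE dE dmxV.
have Be : B e by rewrite ed; apply: BV; rewrite dE.
have [v vE] : exists v : zmat C n, v = lu (x : 'M_n) by eexists.
have [v' v'E] : exists v' : zmat C n, v' = lu (x *m b) by eexists.
rewrite -dE -vE -v'E in E *.
have Uv : Un v by rewrite vE; exact: lu_Un.
have Uv' : Un v' by rewrite v'E; exact: lu_Un.
have v'E2 : v' = e *m v *m b by rewrite -mulmxA -E ed mulKmx.
have Bru w : B (r w) /\ r w \in unitmx by have [Brw _] := r2 w; split => //; exact: BG.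
have [Brv rvu] := Bru v; have [Brv' _] := Bru v'.
have cj u : Un u -> Un (e *m u *m d) by rewrite eE dE; exact: conjd_norm.
have ebU : Un (e *m b).
  by rewrite eE; apply: upper_dmx_Un => //; [exact: Bnb.1|move=> i; rewrite mxE].
have bk : e *m invmx (r v) *m d *m (e *m b *m r v') = 1%:M.
  apply: (uniq1 (e *m (v *m r v) *m d)).
  - by rewrite eE dE; apply: slice_conjd => //; exact: r3.
  - have Ue1 : U (e *m invmx (r v) *m d).
      split; last by apply: cj; exact: UnV (UUn _ (r2 v)).
      by apply: (BM _ _ (BM _ _ Be (BV _ Brv))); rewrite dE.
    apply: (UM _ _ Ue1); apply: (UM _ _ _ (r2 v')).
    by split => //; exact: BM.
  - have -> : e *m (v *m r v) *m d *m (e *m invmx (r v) *m d *m (e *m b *m r v')) = v' *m r v'.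
      by rewrite v'E2 ed !mulmxA !mulmxK.
    exact: r3.
have {bk} : b *m r v' = r v *m d.
  have /(congr1 (mulmx (r v *m d))) := bk; rewrite mulmx1 => <-.
  by rewrite ed !mulmxA !mulmxK // mulmxV ?mul1mx.
by move=> bk; rewrite -!mulmxA bk.
Qed.

Definition mon (m : multinom (n * n)) (x : zmat C n) : C :=
  \prod_k mxvec (x : 'M_n) 0 k ^+ m k.

Lemma mon_mul m x (d : 'rV[C]_n) :
  mon m (x *m dmx d) = mon m x * mon m (\matrix_(i, j) d 0 j).
Proof.
rewrite /mon -big_split; apply: eq_bigr => k _ /=; rewrite -exprMn; congr (_ ^+ _).
by case/mxvec_indexP: k => i j; rewrite !mxvecE mul_mx_diag !mxE.
Qed.

Lemma mxeval_mon x p : mxeval x p = \sum_(m <- msupp p) mcoeff m p * mon m x.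
Proof. by rewrite /mxeval mevalE. Qed.

Lemma mon_regular x (s : zmat C n -> zmat C n) m : mx_in (regular_at x) s ->
  regular_at x (fun y => mon m (s y)).
Proof.
move=> rs; have r := regular_ring x; apply: (fr_prod r) => k _; apply: (fr_exp r).
by case/mxvec_indexP: k => i j; under eq_fun do rewrite mxvecE; exact: rs.
Qed.

(* The fraction [p / q] becomes right [B]-invariant once the unipotent part of
   [B] is divided out by [unipotent_section] and [p], [q] are replaced by their
   components of a common weight for the diagonal part of [B]. *)
Lemma extend_invariant (dom : set (zmat C n)) (phi : zmat C n -> C) p q :
  (forall x b, dom x -> B b -> dom (x *m b) /\ phi (x *m b) = phi x) ->
  (forall x, dom x -> phi x * mxeval x q = mxeval x p) ->
  mxeval (1%:M : zmat C n) q != 0 ->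
  exists (Om : set (zmat C n)) (Phi : zmat C n -> C), [/\ open Om, Om 1%:M,
    forall x b, Om x -> B b -> Om (x *m b) /\ Phi (x *m b) = Phi x,
    forall x, Om x -> regular_at x Phi & forall x, Om x -> dom x -> phi x = Phi x].
Proof.
move=> domB Hpq q1; have [gB _] := aB; have [BG B1 BM BV] := gB.
have [s [s1 sr su sB]] := unipotent_section.
pose A := {d : 'rV[C]_n | B (dmx d)}.
have opP (a b : A) : B (dmx (\row_i (sval a 0 i * sval b 0 i))).
  by rewrite -dmxM; apply: BM; [exact: (svalP a)|exact: (svalP b)].
pose op (a b : A) : A := exist _ _ (opP a b).
(* The weight of a monomial under the diagonal part of [B]. The Boolean only distinguishes monomials
   of [p] from those of [q], so that one list indexes both. *)
pose chi (i : bool * multinom (n * n)) (a : A) := mon i.2 (\matrix_(i, j) sval a 0 j).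
have chiM i (a b : A) : chi i (op a b) = chi i a * chi i b.
  rewrite /chi /mon -big_split; apply: eq_bigr => k _ /=; rewrite -exprMn; congr (_ ^+ _).
  by case/mxvec_indexP: k => k l; rewrite !mxvecE !mxE.
have chi0 i (a : A) : chi i a != 0.
  apply/prodf_neq0 => k _; apply: expf_neq0; case/mxvec_indexP: k => k l.
  rewrite mxvecE mxE; have := BG _ (svalP a); rewrite /= upper_unit; last exact: dmx_upper.
  by move=> /forallP /(_ l); rewrite dmx_diag.
have oneP : B (dmx (const_mx 1)) by rewrite /dmx diag_const_mx.
pose Lq := [seq (false, m) | m <- msupp q]; pose Lp := [seq (true, m) | m <- msupp p].
(* A weight whose component in [q] does not vanish at 1. *)
have [|i0] := @class_sum_neq0 _ _ A chi Lq (fun i => mcoeff i.2 q * mon i.2 (s 1%:M)).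
  by rewrite big_map s1 -mxeval_mon.
rewrite big_map /=.
pose Qf x := \sum_(m <- msupp q | same_chi chi (false, m) i0) mcoeff m q * mon m (s x).
pose Pf x := \sum_(m <- msupp p | same_chi chi (true, m) i0) mcoeff m p * mon m (s x).
move=> Q1.
have wt (x b : zmat C n) (dx : lu_dom (x : 'M_n)) (Bb : B b) bb m :
    same_chi chi (bb, m) i0 -> mon m (s (x *m b)) =
    mon m (s x) * chi i0 (exist _ (dgr b) (Bdiag Bb)).
  by move=> /asboolP <-; rewrite sB // mon_mul.
have Qr x : lu_dom (x : 'M_n) -> regular_at x Qf.
  move=> dx; have r := regular_ring x; apply: (fr_sum r) => m _; apply: (frM r).
    exact: (frC r).
  by apply: mon_regular; exact: sr.
have Pr x : lu_dom (x : 'M_n) -> regular_at x Pf.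
  move=> dx; have r := regular_ring x; apply: (fr_sum r) => m _; apply: (frM r).
    exact: (frC r).
  by apply: mon_regular; exact: sr.
exists [set x : zmat C n | lu_dom (x : 'M_n) /\ Qf x != 0], (fun x => Pf x / Qf x); split.
- rewrite openE => x [dx Qx].
  have rid : mx_in (regular_at x) (fun x : zmat C n => x : 'M_n).
    by move=> i j; apply: regular_poly; exact: polyfun_coord.
  near=> y; split; first by near: y; exact: (lu_regular rid dx).2.
  by near: y; apply: regular_nonzero => //; exact: Qr.
- by split; first exact: (lu1 n).1.
- move=> x b [dx Qx] Bb.
  have EQ : Qf (x *m b) = Qf x * chi i0 (exist _ (dgr b) (Bdiag Bb)).
    rewrite /Qf mulr_suml; apply: eq_bigr => m Hm.
    by rewrite (wt _ _ dx Bb _ _ Hm) mulrA.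
  have EP : Pf (x *m b) = Pf x * chi i0 (exist _ (dgr b) (Bdiag Bb)).
    rewrite /Pf mulr_suml; apply: eq_bigr => m Hm.
    by rewrite (wt _ _ dx Bb _ _ Hm) mulrA.
  split; last by rewrite EQ EP -mulf_div divff ?mulr1 //; exact: chi0.
  split; first exact: (lu_mul dx (BBn Bb)).1.
  by rewrite EQ mulf_neq0 // chi0.
- move=> x [dx Qx]; have r := regular_ring x; apply: (frM r); first exact: Pr.
  by apply: regular_inv => //; exact: Qr.
move=> x [dx Qx] domx; apply: (mulIf Qx); rewrite divfK //.
have [u Bu su'] := su x dx.
(* At the points [x *m u *m dmx (sval a)], where [phi] keeps its value, the relation [phi * q = p]
   becomes a linear relation between characters of [a]; independence isolates the weight [i0]. *)
pose c (i : bool * multinom (n * n)) :=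
  if i.1 then mcoeff i.2 p * mon i.2 (s x) else - phi x * (mcoeff i.2 q * mon i.2 (s x)).
have := @char_independent _ _ A op chi chiM (Lp ++ Lq) c i0 _ (chi0 i0 (exist _ _ oneP)).
have -> : \sum_(i <- Lp ++ Lq | same_chi chi i i0) c i = Pf x - phi x * Qf x.
  rewrite big_cat /Lp big_map /Lq /= -mulNr; congr (_ + _).
  by rewrite big_map /Qf mulr_sumr.
move=> H; apply/eqP; rewrite eq_sym -subr_eq0; apply/eqP; apply: H => a.
have Bua : B (u *m dmx (sval a)) by apply: BM => //; exact: (svalP a).
have [dy phiy] := domB x _ domx Bua.
have := Hpq _ dy; rewrite phiy mulmxA -su' !mxeval_mon.
have E pp : \sum_(m <- msupp pp) mcoeff m pp * mon m (s x *m dmx (sval a)) =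
    \sum_(m <- msupp pp) mcoeff m pp * mon m (s x) * chi (true, m) a.
  by apply: eq_bigr => m _; rewrite mon_mul mulrA.
rewrite !E big_cat /Lp big_map /= => <-.
rewrite /Lq big_map /= mulr_sumr -big_split big1 // => m _.
by rewrite /c /chi /= !mulNr !mulrA subrr.
Unshelve. all: by end_near.
Qed.

End FlagSection.

Lemma extend_at (C : numClosedFieldType) n (B dom : set (zmat C n)) (phi F : zmat C n -> C)
  (g : zmat C n) : algebraic_group B -> connected B -> solvable_group B -> (g : 'M_n) \in unitmx ->
  (forall x b, dom x -> B b -> dom (x *m b) /\ phi (x *m b) = phi x) ->
  regular_at g F -> (\forall y \near g, dom y -> phi y = F y) ->
  exists (Om : set (zmat C n)) (Phi : zmat C n -> C), [/\ open Om, Om g,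
    forall x b, Om x -> B b -> Om (x *m b) /\ Phi (x *m b) = Phi x,
    forall x, Om x -> regular_at x Phi & forall x, Om x -> dom x -> phi x = Phi x].
Proof.
move=> aB cB sB gu domB [p [q [q0 HF]]] Hphi.
have [gB _] := aB; have [BG B1 BM BV] := gB.
have [//|//|w [wu BBn _ Bd]] := @solvable_coords C n B set0 aB cB sB.
have wu' : invmx w \in unitmx by rewrite unitmx_inv.
have gu' : invmx g \in unitmx by rewrite unitmx_inv.
have : \forall y \near g, dom y -> phi y * mxeval y q = mxeval y p.
  near=> y => dy; rewrite (near Hphi y) // (near HF y) // divfK //.
  by near: y; apply: open_nbhs_nbhs; split=> //; apply: open_nonzero; exact: polyfun_mxeval.
move=> /near_open[V [oV Vg] HV]; have [r pr [rg rV]] := open_principal oV Vg.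
have pring := @polyfun_ring C n.
have tauP : mx_in (@polyfun C n) (fun x : zmat C n => g *m w *m x *m invmx w).
  exact: mxin_sandwich.
have tau'P : mx_in (@polyfun C n) (fun x : zmat C n => invmx w *m invmx g *m x *m w).
  exact: mxin_sandwich.
pose tau (x : zmat C n) : zmat C n := g *m w *m x *m invmx w.
pose tau' (x : zmat C n) : zmat C n := invmx w *m invmx g *m x *m w.
have tauK x : tau (tau' x) = x by rewrite /tau /tau' !mulmxA !mulmxK // mulmxV // mul1mx.
have tau1 : tau 1%:M = g by rewrite /tau mulmx1 mulmxK.
have tau'1 : tau' g = 1%:M by rewrite /tau' mulmxKV // mulVmx.
(* Multiplying [p] and [q] by [r], which vanishes off [V], makes [phi * q = p] hold on all of [dom]
   rather than near [g]. The coordinates [tau] send 1 to [g] and make [B] upper triangular. *)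
have [q' Hq'] : polyfun (fun x => r (tau x) * mxeval (tau x) q).
  apply: (frM pring); first exact: (fr_polyfun pring).
  exact: (fr_mxeval _ pring).
have [p' Hp'] : polyfun (fun x => r (tau x) * mxeval (tau x) p).
  apply: (frM pring); first exact: (fr_polyfun pring).
  exact: (fr_mxeval _ pring).
have [||||Om [Phi [oO O1 OB Or OE]]] := @extend_invariant C n _ (conjg_algebraic wu' aB) BBn _
    (tau @^-1` dom) (phi \o tau) p' q'.
- exact: Bd.
- move=> x _ dx [b Bb <-] /=.
  have -> : tau (x *m (invmx w *m b *m invmx (invmx w))) = tau x *m b.
    by rewrite /tau invmxK !mulmxA mulmxK.
  exact: domB.
- move=> x dx /=; rewrite -Hq' -Hp'; have [r0|r0] := eqVneq (r (tau x)) 0.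
    by rewrite r0 !mul0r mulr0.
  by rewrite mulrCA HV //; exact: rV.
- by rewrite -Hq' tau1 mulf_neq0.
have tau'B x b : B b -> conjg (invmx w) B (invmx w *m b *m w) /\
    tau' (x *m b) = tau' x *m (invmx w *m b *m w).
  move=> Bb; split; first by exists b => //; rewrite invmxK.
  by rewrite /tau' !mulmxA mulmxK.
exists (tau' @^-1` Om), (Phi \o tau'); split.
- by apply: open_comp => // x _; exact: (poly_continuous tau'P).
- by rewrite /= tau'1.
- move=> x b /= Ox Bb; have [Bb' ->] := tau'B x b Bb; exact: OB.
- move=> x Ox; apply: regular_comp; last exact: Or.
  by move=> i j; apply: regular_poly; exact: tau'P.
- by move=> x Ox dx /=; rewrite -OE //= tauK.
Unshelve. all: by end_near.
Qed.

(** * Orbits on fixed points *)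

Section LocalSection.
Context {C : numClosedFieldType} {n : nat}.
Implicit Types (G H B S : set (zmat C n)) (z w e s : zmat C n).

(** What is retained of membership in the algebra generated by [S]: every flag stabilized by [S] is
    stabilized by [e]. *)
Definition flagwise S e := forall z, (z : 'M_n) \in unitmx ->
  (forall s, S s -> upper (invmx z *m s *m z)) -> upper (invmx z *m e *m z).

Lemma flagwiseM S e s : flagwise S e -> flagwise S s -> flagwise S (e *m s).
Proof.
move=> He Hs z zu Hz; have := upperM (He z zu Hz) (Hs z zu Hz).
by rewrite !mulmxA mulmxK.
Qed.

Lemma flagwise_shift S s (a : C) : S s -> flagwise S ((s : 'M_n) - a%:M).
Proof.
move=> Ss z zu Hz; have -> : invmx z *m ((s : 'M_n) - a%:M) *m z = invmx z *m s *m z - a%:M.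
  by rewrite mulmxBr mulmxBl mul_mx_scalar -scalemxAl mulVmx // scalemx1.
move=> i j ji; have ij : (i == j) = false by rewrite -val_eqE gtn_eqF.
by rewrite mxE (Hz _ Ss) // [X in _ + X]mxE [X in _ - X]mxE ij subrr.
Qed.

(* A polynomial in [S] annihilated by [s - chi_i s] for all [s] in [S], yet
   nonzero on the i-th vector of the diagonalizing basis [w]. *)
Lemma weight_projector S w i : (w : 'M_n) \in unitmx ->
  (forall s, S s -> is_diag_mx (invmx w *m s *m w)) ->
  exists e, [/\ flagwise S e, (invmx w *m e *m w) i i != 0 &
    forall s, S s -> ((s : 'M_n) - ((invmx w *m s *m w) i i)%:M) *m e = 0].
Proof.
move=> wu Sd; pose ch s := dgr (invmx w *m s *m w).
have chE s : S s -> invmx w *m s *m w = dmx (ch s) by move=> /Sd; exact: is_diag_dmx.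
suff [e [e1 [eps [e2 ei Heps]]]] : exists e, flagwise S e /\ exists eps : 'rV[C]_n,
    [/\ invmx w *m e *m w = dmx eps, eps 0 i != 0 &
      forall l, l \in enum 'I_n -> (exists2 s, S s & ch s 0 l != ch s 0 i) -> eps 0 l = 0].
  exists e; split=> //; first by rewrite e2 dmx_diag.
  move=> s Ss; have : invmx w *m (((s : 'M_n) - ((invmx w *m s *m w) i i)%:M) *m e) *m w = 0.
    have -> : invmx w *m (((s : 'M_n) - ((invmx w *m s *m w) i i)%:M) *m e) *m w =
      (invmx w *m s *m w - ((invmx w *m s *m w) i i)%:M) *m (invmx w *m e *m w).
      rewrite !mulmxBl !mulmxBr mulmxBl !mulmxA mulmxK // !mul_scalar_mx; congr (_ - _).
      by rewrite mul_mx_scalar -!scalemxAl.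
    rewrite e2 chE // dmx_diag; apply/matrixP => a b; rewrite mul_mx_diag !mxE.
    have [->|ab] := eqVneq a b; last by rewrite !mulr0n subr0 mul0r.
    rewrite !mulr1n; have [bi|bi] := eqVneq (ch s 0 b) (ch s 0 i).
      by move: bi; rewrite !mxE => ->; rewrite subrr mul0r.
    by rewrite Heps ?mulr0 ?mem_enum //; exists s.
  move=> /(congr1 (fun M : 'M_n => w *m M *m invmx w)).
  by rewrite mulmx0 mul0mx !mulmxA mulmxV // mul1mx mulmxK.
elim: (enum 'I_n) => [|j js [e [e1 [eps [e2 ei Heps]]]]].
  exists 1%:M; split; first by move=> z zu _; rewrite mulmx1 mulVmx //; exact: Un_upper (@Un1 C n).
  exists (const_mx 1); split=> //; first by rewrite mulmx1 mulVmx // /dmx diag_const_mx.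
  by rewrite mxE oner_neq0.
have [[s Ss cs]|ns] := pselect (exists2 s, S s & ch s 0 j != ch s 0 i); last first.
  exists e; split=> //; exists eps; split=> // l; rewrite inE => /orP[/eqP->//|]; exact: Heps.
exists (((s : 'M_n) - (ch s 0 j)%:M) *m e); split.
  by apply: flagwiseM => //; exact: flagwise_shift.
exists (\row_l ((ch s 0 l - ch s 0 j) * eps 0 l)); split.
- have -> : invmx w *m (((s : 'M_n) - (ch s 0 j)%:M) *m e) *m w =
      (invmx w *m s *m w - (ch s 0 j)%:M) *m (invmx w *m e *m w).
    rewrite !mulmxBl !mulmxBr mulmxBl !mulmxA mulmxK // !mul_scalar_mx; congr (_ - _).
    by rewrite mul_mx_scalar -!scalemxAl.
  rewrite e2 chE //; apply/matrixP => a b; rewrite mul_mx_diag !mxE.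
  by have [->|ab] := eqVneq a b; rewrite ?mulr1n // !mulr0n subr0 mul0r.
- by rewrite mxE mulf_neq0 // subr_eq0 eq_sym.
move=> l; rewrite inE mxE => /orP[/eqP-> _|ljs Hl]; first by rewrite subrr mul0r.
by rewrite Heps // mulr0.
Qed.

(** Near [g] the [i]-th diagonal entry of the projector [e i] stays nonzero in the flag of [x *m z].
    As [s] minus its [i]-th character annihilates [e i], and diagonal entries of triangular matrices
    multiply, the [i]-th diagonal entry of [s] there is that character. One neighbourhood serves for
    all of [S], since there are only [n] projectors. *)
Lemma near_same_chars S z (g : zmat C n) : (z : 'M_n) \in unitmx -> (g : 'M_n) \in unitmx ->
  (forall s, S s -> is_diag_mx (invmx (g *m z) *m s *m (g *m z))) ->
  \forall x \near g, (forall s, S s -> @upper C n (invmx (x *m z) *m s *m (x *m z))) ->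
    same_chars S z g (x *m z).
Proof.
move=> zu gu dS; have gz : g *m z \in unitmx by rewrite unitmx_mul gu.
have /choice[e He] := fun i => weight_projector i gz dS.
have r := regular_ring g.
have rid : mx_in (regular_at g) (fun x : zmat C n => x : 'M_n).
  by move=> i j; apply: regular_poly; exact: polyfun_coord.
have rz : mx_in (regular_at g) (fun x : zmat C n => x *m z).
  by apply: (mxinM r) => //; exact: (mxin_cst r).
pose f (x : zmat C n) := \prod_i (invmx (x *m z) *m e i *m (x *m z)) i i.
have rf : regular_at g f.
  apply: (fr_prod r) => i _; apply: (mxinM r) => //; apply: (mxinM r); last exact: (mxin_cst r).
  exact: regular_invmx.
have f0 : f g != 0 by apply/prodf_neq0 => i _; have [] := He i.
near=> x => ux s Ss; split; first exact: ux.
have xu : x \in unitmx.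
  by near: x; apply: open_nbhs_nbhs; split; [exact: open_unitmx|exact: gu].
have xz : x *m z \in unitmx by rewrite unitmx_mul xu.
have fx : f x != 0 by near: x; exact: regular_nonzero.
have [K Kdef] : exists K : zmat C n, K = x *m z by eexists.
rewrite /f -Kdef in xz ux fx *.
move=> i; have [e1 _ /(_ s Ss) e3] := He i.
have [a adef] : exists a, a = (invmx (g *m z) *m s *m (g *m z)) i i by eexists.
rewrite -adef in e3 *; have ue := e1 _ xz ux; have us := flagwise_shift a Ss xz ux.
have := upperM_diag i us ue; rewrite !mulmxA mulmxK // -(mulmxA (invmx K) _ (e i)) e3.
rewrite mulmx0 mul0mx mxE => /esym/eqP; rewrite mulf_eq0 => /orP[|/eqP ei]; last first.
  by move/prodf_neq0: fx => /(_ i isT); rewrite ei eqxx.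
rewrite mulmxBr mulmxBl mul_mx_scalar -scalemxAl mulVmx // scalemx1.
by rewrite mxE [X in _ + X]mxE [in X in _ + X]mxE eqxx mulr1n subr_eq0 => /eqP.
Unshelve. all: by end_near.
Qed.

Hypothesis bfp : borel_property C.

Lemma local_section G B S g : algebraic_group G -> borel G B -> S `<=` G ->
  comm_diag S -> G g -> conjg (invmx g) S `<=` B ->
  exists2 h : zmat C n -> zmat C n, mx_in (regular_at g) h &
    \forall x \near g, G x -> conjg (invmx x) S `<=` B ->
      identity_component (fixed_subgroup S G) (h x) /\ B (invmx (h x *m g) *m x).
Proof.
move=> aG bB SG dS Gg SB; have [gG cG] := aG; have [GG G1 GM GV] := gG.
have SGL : S `<=` @GL C n by move=> s /SG /GG.
have [[aB cB sB] BG _] := bB; have [gB _] := aB; have [BGL B1 BM BV] := gB.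
have gu := GG _ Gg.
have [z [zu lz BE dz]] := diagonal_flag bfp aG bB SGL dS Gg SB.
have [k [k1 k2 k3]] := transport aG SG dS zu Gg dz.
have [gF _] := fixed_algebraic SGL aG; have [FG F1 FM FV] := gF.
have r := regular_ring g.
have rid : mx_in (regular_at g) (fun x : zmat C n => x : 'M_n).
  by move=> i j; apply: regular_poly; exact: polyfun_coord.
have rk : mx_in (regular_at g) k by apply: k1 => //; exact: regular_invmx.
have upx x : G x -> conjg (invmx x) S `<=` B ->
    forall s, S s -> upper (invmx (x *m z) *m s *m (x *m z)).
  move=> Gx SBx s Ss; have xu := GG _ Gx.
  have : B (invmx x *m s *m x) by apply: SBx; exists s => //; rewrite invmxK.
  rewrite BE => /idcomp_sub[_ /(conjgE _ _ zu)[ux _]].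
  by rewrite (invmxM xu zu) !mulmxA in ux *.
have Fk x : G x -> same_chars S z g (x *m z) -> fixed_subgroup S G (k x) /\
    B (invmx (k x *m g) *m x).
  move=> Gx Hx; have Fk := k3 x Gx Hx; split => //; have xu := GG _ Gx; have ku := FG _ Fk.
  have [c cdef] : exists c : zmat C n, c = invmx (x *m z) *m k x *m (g *m z) by eexists.
  have Uc := k2 x xu; rewrite -cdef in Uc.
  have Bc : B (z *m c *m invmx z) by rewrite BE; apply: Uflag_borel => //; exists c.
  have kE : k x *m g = x *m (z *m c *m invmx z).
    by rewrite cdef (invmxM xu zu) !mulmxA !mulmxK // mulmxV // mul1mx.
  rewrite kE (invmxM xu); last exact: BGL.
  by rewrite mulmxKV //; exact: BV.
have scg : same_chars S z g (g *m z) by move=> s Ss; split=> //; exact: upx.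
have [Fkg Bkg] := Fk g Gg scg; have kgu := FG _ Fkg.
(* Dividing by [k g] gives the value 1 at [g]; near [g] the map then stays in the identity
   component, which is open in the fixed subgroup. *)
exists (fun x => k x *m invmx (k g)).
  by apply: (mxinM r) => //; exact: (mxin_cst r).
have [V oV HV] := @component_open C n (fixed_subgroup S G) 1%:M F1.
have VF : V 1%:M by have : identity_component (fixed_subgroup S G) 1%:M; [exact: idcomp1|rewrite /identity_component HV => -[]].
have nV : \forall x \near g, V (k x *m invmx (k g)).
  have : {for g, continuous (fun x => k x *m invmx (k g) : zmat C n)}.
    by apply: regular_continuous; apply: (mxinM r) => //; exact: (mxin_cst r).
  apply; rewrite mulmxV //; exact: open_nbhs_nbhs.
have nS := near_same_chars zu gu dz.
near=> x => Gx SBx; have sx : same_chars S z g (x *m z) by apply: (near nS x) => //; exact: upx.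
have [Fkx Bkx] := Fk x Gx sx; have kxu := FG _ Fkx; split.
  rewrite /identity_component HV; split; last exact: (near nV x).
  exact: (FM _ _ Fkx (FV _ Fkg)).
have kg'u : invmx (k g) \in unitmx by rewrite unitmx_inv.
have gu' : invmx g \in unitmx by rewrite unitmx_inv.
have kk : k x *m invmx (k g) \in unitmx by rewrite unitmx_mul kxu.
have gk : invmx g *m invmx (k g) \in unitmx by rewrite unitmx_mul gu'.
have -> : invmx (k x *m invmx (k g) *m g) *m x =
    invmx (invmx (k g *m g) *m g) *m (invmx (k x *m g) *m x).
  rewrite (invmxM kk gu) (invmxM kxu kg'u) invmxK (invmxM kgu gu) (invmxM gk gu).
  by rewrite (invmxM gu' kg'u) !invmxK (invmxM kxu gu) !mulmxA mulmxK.
by apply: BM => //; exact: BV.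
Unshelve. all: by end_near.
Qed.

End LocalSection.

(** * Coset spaces *)

Section Subspace.
Context {K : fieldType} (X : fspace K) (A : set X).

Lemma sub_open (U : set (sub_fspace A)) :
  open U <-> exists2 W : set X, open W & forall y, U y <-> W (val y).
Proof.
split; first by move=> [W oW <-]; exists W.
by move=> [W oW WU]; exists W => //; apply/seteqP; split=> y /WU.
Qed.

End Subspace.

Section CosetSpace.
Context {K : fieldType} {n : nat} (G B : set (zmat K n)).
Hypothesis gG : matrix_subgroup G.
Hypothesis gB : matrix_subgroup B.
Hypothesis BG : B `<=` G.
Implicit Types g h x y : zmat K n.
Local Notation X := (coset_space G B).

Definition in_group g : group_fspace G :=
  match pselect (G g) with
  | left Gg => exist _ g (mem_set Gg)
  | right _ => exist _ 1%:M (mem_set (let: And4 _ G1 _ _ := gG in G1))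
  end.

Lemma in_groupK g : G g -> val (in_group g) = g.
Proof. by rewrite /in_group; case: pselect. Qed.

Lemma in_group_val (a : group_fspace G) : in_group (val a) = a.
Proof.
have Ga : G (val a) by exact: set_mem (valP a).
by apply: val_inj; rewrite in_groupK.
Qed.

(* A junk value when [g] is not in [G]. *)
Definition pc g : X := \pi_(quotient_topology {eq_quot coset_equiv G B}) (in_group g).

Definition rp (x : X) : zmat K n :=
  val (repr (x : quotient_topology {eq_quot coset_equiv G B})).

Lemma rpG (x : X) : G (rp x).
Proof. exact: set_mem (valP (repr (x : quotient_topology {eq_quot coset_equiv G B}))). Qed.

Lemma rpK (x : X) : pc (rp x) = x.
Proof. by rewrite /pc /rp in_group_val reprK. Qed.

Lemma translate_eq g h : (g : 'M_n) \in unitmx -> (h : 'M_n) \in unitmx ->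
  translate g B = translate h B <-> B (invmx g *m h).
Proof.
have [BU B1 BM BV] := gB; move=> gu hu; split.
  move=> E; have : translate h B h by exists 1%:M => //; rewrite mulmx1.
  by rewrite -E => -[b Bb <-]; rewrite mulKmx.
move=> Bgh; apply/seteqP; split=> _ [b Bb <-].
  exists (invmx (invmx g *m h) *m b); first by apply: BM => //; exact: BV.
  have gu' : invmx g \in unitmx by rewrite unitmx_inv.
  by rewrite (invmxM gu' hu) invmxK !mulmxA mulmxV // mul1mx.
by exists (invmx g *m h *m b); [exact: BM|rewrite !mulmxA mulmxV // mul1mx].
Qed.

Lemma pcE g h : G g -> G h -> pc g = pc h <-> B (invmx g *m h).
Proof.
have [GU _ _ _] := gG; move=> Gg Gh.
rewrite -translate_eq; [|exact: GU|exact: GU].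
have E : (pc g = pc h) <-> (in_group g == in_group h %[mod {eq_quot coset_equiv G B}]).
  by split=> [e|/eqP //]; apply/eqP.
rewrite E eqmodE /= /same_coset; split=> [/asboolP|e]; first by rewrite !in_groupK.
by apply/asboolP; rewrite !in_groupK.
Qed.

Lemma pcMr g b : G g -> B b -> pc (g *m b) = pc g.
Proof.
have [GU _ GM _] := gG; have [_ _ _ BV] := gB; move=> Gg Bb; have gu := GU _ Gg.
by apply/esym/pcE => //; [apply: GM => //; exact: BG|rewrite mulKmx].
Qed.

Lemma rp_pc g : G g -> exists2 b, B b & rp (pc g) = g *m b.
Proof.
have [GU _ _ _] := gG; move=> Gg; have gu := GU _ Gg.
exists (invmx g *m rp (pc g)); last by rewrite mulKVmx.
by apply/pcE => //; [exact: rpG|rewrite rpK].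
Qed.

Lemma pcMl g h k : G k -> G g -> G h -> pc g = pc h -> pc (k *m g) = pc (k *m h).
Proof.
have [GU _ GM _] := gG; move=> Gk Gg Gh /pcE H; apply/pcE; [exact: GM|exact: GM|].
have ku := GU _ Gk; have gu := GU _ Gg.
by rewrite (invmxM ku gu) mulmxA mulmxKV //; exact: H.
Qed.

Lemma coset_pc g : G g -> coset (pc g) = translate g B.
Proof.
have [GU _ _ _] := gG; move=> Gg; apply/translate_eq.
- exact: GU (rpG (pc g)).
- exact: GU.
- by apply/pcE; [exact: rpG|done|rewrite rpK].
Qed.

Lemma translateM g h : translate g (translate h B) = translate (g *m h) B.
Proof.
apply/seteqP; split=> [_ [_ [b Bb <-] <-]|_ [b Bb <-]].
  by exists b => //; rewrite mulmxA.
by exists (h *m b); [exists b|rewrite mulmxA].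
Qed.

Lemma open_pc_sat (W : set X) : open W ->
  exists2 V : set (zmat K n), open V & forall g, G g -> W (pc g) <-> V g.
Proof.
move=> [V oV VE]; exists V => // g Gg.
have := in_groupK Gg; move: (in_group g) => a <-.
have -> : W (pc (val a)) = W (\pi_(quotient_topology {eq_quot coset_equiv G B}) a).
  by rewrite /pc in_group_val.
by move: VE => /seteqP[/(_ a) V1 /(_ a) V2]; split.
Qed.

Lemma open_pc (W : set X) :
  (forall g, G g -> W (pc g) -> \forall y \near g, G y -> W (pc y)) -> open W.
Proof.
move=> HW; pose V : set (zmat K n) := [set y | \forall z \near y, G z -> W (pc z)].
exists V.
  rewrite openE => y; rewrite /V /= => /near_open[O [oO Oy] HO].
  by apply/near_open; exists O => // z Oz; apply/near_open; exists O.
apply/seteqP; split=> a.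
  move=> Va; have := nbhs_singleton Va => /(_ (set_mem (valP a))).
  by rewrite /pc in_group_val.
by move=> Wa; apply: HW; [exact: set_mem (valP a)|rewrite /pc in_group_val].
Qed.

Lemma near_pc (W : set X) g : open W -> G g -> W (pc g) ->
  \forall y \near g, G y -> W (pc y).
Proof.
move=> /open_pc_sat[V oV HV] Gg Wg; apply/near_open; exists V.
  by split=> //; apply/HV.
by move=> y Vy Gy; apply/HV.
Qed.

(** Unfolds the quotient and the induced structure together: regularity on the coset space becomes a
    condition on functions of matrices near each representative. *)
Lemma regular_pc (W : set X) f : open W ->
  fs_regular W f <-> forall g, G g -> W (pc g) ->
    exists2 F, regular_at g F & \forall y \near g, G y -> f (pc y) = F y.
Proof.
move=> oW; split=> [rf g Gg Wg|H].
  have [|U [F [oU Ug rF HF]]] := rf (in_group g); first exact: Wg.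
  rewrite in_groupK // in Ug; exists F; first exact: rF.
  have nW := near_pc oW Gg Wg; near=> y => Gy; rewrite -(in_groupK Gy) /pc in_group_val.
  apply: HF; first exact: (near nW y).
  by rewrite in_groupK //; near: y; apply: open_nbhs_nbhs.
move=> a Wa; have Ga := set_mem (valP a).
have [|F rF HF] := H (val a) Ga; first by rewrite /pc in_group_val.
have : \forall y \near val a, regular_at y F /\ (G y -> f (pc y) = F y).
  have nr := regular_at_open rF.
  by near=> y; split; [exact: (near nr y)|exact: (near HF y)].
move=> /near_open[U [oU Ua] HU]; exists U, F; split=> //.
  by move=> y /HU[].
move=> y _ /HU[_ /(_ (set_mem (valP y)))].
by rewrite /pc in_group_val.
Unshelve. all: by end_near.
Qed.

End CosetSpace.

(** * Orbits as components of the fixed points *)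

Section Components.
Context {C : numClosedFieldType} {n : nat} (G B S : set (zmat C n)).
Hypothesis bfp : borel_property C.
Hypothesis aG : algebraic_group G.
Hypothesis bB : borel G B.
Hypothesis SB : S `<=` B.
Hypothesis dS : comm_diag S.
Implicit Types g h x y : zmat C n.

Let gG : matrix_subgroup G := aG.1.
Let aB : algebraic_group B. Proof. by case: bB => -[]. Qed.
Let gB : matrix_subgroup B := aB.1.
Let BG : B `<=` G. Proof. by case: bB. Qed.
Let SG : S `<=` G. Proof. by move=> s /SB /BG. Qed.
Let SGL : S `<=` @GL C n.
Proof. by have [GU _ _ _] := gG; move=> s /SG /GU. Qed.
Let F := fixed_subgroup S G.
Let H := identity_component F.
Let BS := fixed_subgroup S B.
Let XS := fixed_points (G := G) (B := B) S.
Let aF : algebraic_group F. Proof. exact: fixed_algebraic. Qed.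
Let aH : algebraic_group H. Proof. exact: idcomp_algebraic. Qed.
Let gH : matrix_subgroup H := aH.1.
Let HF : H `<=` F. Proof. exact: idcomp_sub. Qed.
Let HG : H `<=` G. Proof. by move=> h /HF[]. Qed.

Lemma fixed_conj1 : H `&` B = BS /\ borel H BS.
Proof.
have [_ G1 _ _] := gG.
have := fixed_borel bfp aG bB SG dS G1; rewrite invmx1 !conjg1 => /(_ SB)[E].
by rewrite E.
Qed.

Let gBS : matrix_subgroup BS.
Proof. by have [_ [[[]]]] := fixed_conj1. Qed.

Local Notation pcG := (pc B gG).
Local Notation pcH := (pc BS gH).

Lemma fixed_pc g : G g -> XS (pcG g) <-> conjg (invmx g) S `<=` B.
Proof.
have [GU _ GM _] := gG; move=> Gg; have gu := GU _ Gg.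
have E s : S s -> translate s (coset (pcG g)) = coset (pcG g) <-> B (invmx g *m s *m g).
  move=> Ss; rewrite coset_pc // translateM; have Gsg := GM _ _ (SG Ss) Gg.
  by rewrite -mulmxA -translate_eq //; last exact: GU.
split; first by move=> Hs _ [s Ss <-]; rewrite invmxK; apply/E => //; exact: Hs.
by move=> Hs s Ss; apply/E => //; apply: Hs; exists s => //; rewrite invmxK.
Qed.

Lemma near_unfixed g : G g -> ~ XS (pcG g) -> \forall y \near g, G y -> ~ XS (pcG y).
Proof.
have [GU _ GM GV] := gG; move=> Gg; have gu := GU _ Gg.
move=> nX; have [s Ss nB] : exists2 s, S s & ~ B (invmx g *m s *m g).
  apply: contrapT => Hn; apply: nX; apply/fixed_pc => // _ [s Ss <-]; rewrite invmxK.
  by apply: contrapT => nB; apply: Hn; exists s.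
have [Z cZ BE] := aB.2; have r := regular_ring g.
have rid : mx_in (regular_at g) (fun x : zmat C n => x : 'M_n).
  by move=> i j; apply: regular_poly; exact: polyfun_coord.
have cF : {for g, continuous (fun x => invmx x *m s *m x : zmat C n)}.
  apply: regular_continuous; apply: (mxinM r) => //; apply: (mxinM r); last exact: (mxin_cst r).
  exact: regular_invmx.
have nZ : (~` Z) (invmx g *m s *m g).
  move=> Zg; apply: nB; rewrite BE; split=> //=.
  by rewrite !unitmx_mul unitmx_inv gu (SGL Ss).
have : \forall y \near g, (~` Z) (invmx y *m s *m y).
  by apply: cF; apply: open_nbhs_nbhs; split=> //; exact: closed_openC.
apply: filterS => y nZy Gy /fixed_pc => /(_ Gy) Hy; apply: nZy.
have : B (invmx y *m s *m y) by apply: Hy; exists s => //; rewrite invmxK.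
by rewrite BE => -[].
Qed.

Lemma orbit_fixed h g : H h -> G g -> XS (pcG g) -> XS (pcG (h *m g)).
Proof.
have [GU _ GM GV] := gG; move=> Hh Gg /fixed_pc => /(_ Gg) Hg; have Gh := HG Hh.
apply/fixed_pc; first exact: GM.
have hu := GU _ Gh; have gu := GU _ Gg; have [_ hS] := (fixedE _ _ SGL).1 (HF Hh).
move=> _ [s Ss <-]; rewrite invmxK (invmxM hu gu).
have -> : invmx g *m invmx h *m s *m (h *m g) = invmx g *m s *m g.
  by rewrite -!mulmxA (mulmxA s) hS // !mulmxA mulmxKV.
by apply: Hg; exists s => //; rewrite invmxK.
Qed.

Definition orbit g : set (coset_space G B) := [set pcG (h *m g) | h in H].

Lemma orbit_section g : G g -> XS (pcG g) ->
  exists2 h : zmat C n -> zmat C n, mx_in (regular_at g) h &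
    \forall y \near g, G y -> XS (pcG y) -> H (h y) /\ pcG y = pcG (h y *m g).
Proof.
have [GU _ GM GV] := gG; move=> Gg /fixed_pc => /(_ Gg) Hg.
have [h rh Hh] := local_section bfp aG bB SG dS Gg Hg; exists h => //.
apply: filterS Hh => y Hy Gy /fixed_pc => /(_ Gy) /(Hy Gy)[Hhy Bhy]; split=> //.
by apply/esym/pcE => //; exact: (GM _ _ (HG Hhy) Gg).
Qed.

Lemma orbit_sub g : G g -> XS (pcG g) -> orbit g `<=` XS.
Proof. by move=> Gg Xg _ [h Hh <-]; exact: orbit_fixed. Qed.

(** All fixed points near a fixed point [k] lie in the orbit of [k], so none of them is in an orbit
    missing [k]; around a point that is not fixed, no point is. *)
Lemma orbit_closed g : G g -> XS (pcG g) -> closed (orbit g).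
Proof.
have [GU _ GM GV] := gG; have [_ _ HM HV] := gH.
move=> Gg Xg; rewrite -openC; apply: (open_pc (gG := gG)) => k Gk nO.
have [Xk|nX] := pselect (XS (pcG k)); last first.
  by apply: filterS (near_unfixed Gk nX) => y nXy Gy /(orbit_sub Gg Xg); exact: nXy.
have [h rh] := orbit_section Gk Xk; apply: filterS => y Hy Gy [h' Hh' e].
have Xy : XS (pcG y) by rewrite -e; exact: orbit_fixed.
have [Hhy ey] := Hy Gy Xy; apply: nO; have Ghy := HG Hhy.
exists (invmx (h y) *m h'); first by apply: HM => //; exact: HV.
have hyu := GU _ Ghy.
have := pcMl gB (GV _ Ghy) (GM _ _ (HG Hh') Gg) (GM _ _ Ghy Gk) (etrans e ey).
by rewrite mulKmx // mulmxA.
Qed.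

(** Relative openness of the orbit in [XS], expressed by an open set of the whole coset space. *)
Lemma orbit_open g : G g -> XS (pcG g) -> open (~` (XS `\` orbit g)).
Proof.
have [GU _ GM GV] := gG; have [_ _ HM HV] := gH.
move=> Gg Xg; apply: (open_pc (gG := gG)) => k Gk /not_andP nO.
have [Xk|nX] := pselect (XS (pcG k)); last first.
  by apply: filterS (near_unfixed Gk nX) => y nXy Gy [Xy _]; exact: nXy Gy Xy.
have {nO} [h1 Hh1 e1] : orbit g (pcG k) by case: nO => // /contrapT.
have [h rh] := orbit_section Gk Xk; apply: filterS => y Hy Gy [Xy]; apply.
have [Hhy ey] := Hy Gy Xy; exists (h y *m h1); first exact: HM.
by rewrite ey -mulmxA; apply: pcMl => //; [exact: HG|exact: GM _ _ (HG Hh1) Gg].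
Qed.

Lemma orbit_connected g : G g -> connected (orbit g).
Proof.
have [GU _ GM GV] := gG; have [_ H1 _ _] := gH; move=> Gg.
pose rg (x : zmat C n) : zmat C n := x *m g.
have cr : continuous rg.
  by apply: poly_continuous; apply: (mxinM (@polyfun_ring C n)) (mxin_cst (@polyfun_ring C n) _); exact: mxin_id.
move=> U [x Ux] [W oW UW] [Z cZ UZ].
have [V oV HV] := open_pc_sat gG oW.
have [V' oV' HV'] := open_pc_sat gG (closed_openC cZ).
have UO (y : coset_space G B) : U y -> orbit g y by rewrite UW => -[].
have : H `&` [set h | U (pcG (h *m g))] = H.
  apply: (@idcomp_connected C n F).
  - by have [h Hh e] := UO _ Ux; exists h; split=> //=; rewrite e.
  - exists (rg @^-1` V); first by apply: open_comp => // y _; exact: cr.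
    apply/seteqP; split=> h [Hh]; have Ghg := GM _ _ (HG Hh) Gg => /= Uh; split=> //=.
      by apply/(HV _ Ghg); move: Uh; rewrite UW => -[].
    by rewrite UW; split; [exists h|apply/HV].
  - exists (rg @^-1` (~` V')).
      by apply: closed_comp; [move=> y _; exact: cr|exact: open_closedC].
    apply/seteqP; split=> h [Hh]; have Ghg := GM _ _ (HG Hh) Gg => /= Uh; split=> //=.
      by move=> /(HV' _ Ghg); apply; move: Uh; rewrite UZ => -[].
    by rewrite UZ; split; [exists h|apply: contrapT => nZ; apply: Uh; apply/HV'].
move=> HE; apply/seteqP; split=> y; first exact: UO.
by move=> [h Hh <-]; move: Hh; rewrite -HE => -[].
Qed.

Lemma orbit_component g : G g -> XS (pcG g) -> connected_component XS (pcG g) = orbit g.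
Proof.
have [GU _ GM GV] := gG; have [_ H1 _ _] := gH.
move=> Gg Xg; have Og : orbit g (pcG g) by exists 1%:M => //; rewrite mul1mx.
apply/seteqP; split; last first.
  by apply: connected_component_max => //; [exact: orbit_sub|exact: orbit_connected].
move=> y [D [Dg DX cD] Dy].
have : D `&` orbit g = D.
  apply: cD; first by exists (pcG g).
    exists (~` (XS `\` orbit g)); first exact: orbit_open.
    apply/seteqP; split=> x [Dx Ox]; split=> //; first by move=> [].
    by apply: contrapT => nO; apply: Ox; split=> //; exact: DX.
  by exists (orbit g) => //; exact: orbit_closed.
by move=> /seteqP[_ /(_ y Dy)] [].
Qed.

Lemma orbit_base g : G g -> XS (pcG g) -> exists g1, [/\ G g1, XS (pcG g1),
  orbit g1 = orbit g & H `&` conjg g1 B = BS].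
Proof.
have [GU _ GM GV] := gG; have [HU H1 HM HV] := gH.
move=> Gg Xg; have Sg := (fixed_pc Gg).1 Xg.
have [_ bH] := fixed_borel bfp aG bB SG dS Gg Sg.
have [E1 bBS] := fixed_conj1.
have [h Hh E] := borel_conj bfp aH bH bBS; have hu := HU _ Hh; have gu := GU _ Gg.
exists (h *m g); split.
- exact: (GM _ _ (HG Hh) Gg).
- exact: orbit_fixed.
- apply/seteqP; split=> _ [k Hk <-].
    by exists (k *m h); [exact: HM|rewrite mulmxA].
  exists (k *m invmx h); first by apply: HM => //; exact: HV.
  by rewrite !mulmxA mulmxKV.
by rewrite conjg_mul // E conjg_setI // (conjg_self gH Hh).
Qed.

(** * The orbit map and its inverse *)

Section OrbitIso.
Variable g1 : zmat C n.
Hypothesis Gg1 : G g1.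
Hypothesis Xg1 : XS (pcG g1).
Hypothesis stab : H `&` conjg g1 B = BS.
Local Notation O := (orbit g1).

Let g1u : (g1 : 'M_n) \in unitmx. Proof. by have [GU _ _ _] := gG; exact: GU. Qed.
Let hgG h : H h -> G (h *m g1).
Proof. by have [_ _ GM _] := gG; move=> Hh; exact: GM _ _ (HG Hh) Gg1. Qed.

Lemma orbit_pcE h k : H h -> H k -> pcH h = pcH k <-> pcG (h *m g1) = pcG (k *m g1).
Proof.
have [HU H1 HM HV] := gH; move=> Hh Hk; have hu := HU _ Hh.
rewrite (pcE gH gBS Hh Hk) (pcE gG gB (hgG Hh) (hgG Hk)) -stab.
have E : invmx (h *m g1) *m (k *m g1) = invmx g1 *m (invmx h *m k) *m g1.
  by rewrite (invmxM hu g1u) !mulmxA.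
rewrite E; split; first by move=> [_ /(conjgE _ _ g1u)].
move=> Bg; split; last exact/conjgE.
by apply: HM => //; exact: HV.
Qed.

Let inO (x : coset_space H BS) : O (pcG (rp x *m g1)).
Proof. by exists (rp x) => //; exact: rpG. Qed.

Definition orbit_map (x : coset_space H BS) : sub_fspace O :=
  exist (fun a : coset_space G B => a \in O) (pcG (rp x *m g1)) (mem_set (inO x)).

Lemma orbit_map_pc h : H h -> val (orbit_map (pcH h)) = pcG (h *m g1).
Proof.
by move=> Hh; apply/orbit_pcE => //; [exact: rpG|rewrite rpK].
Qed.

(* A junk value outside the orbit. *)
Definition orbit_inv (x : coset_space G B) : coset_space H BS :=
  match pselect (O x) with
  | left Ox => pcH (s2val (cid2 Ox))
  | right _ => pcH 1%:M
  end.

Lemma orbit_invE h : H h -> orbit_inv (pcG (h *m g1)) = pcH h.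
Proof.
move=> Hh; rewrite /orbit_inv; case: pselect => [Ox|[]]; last by exists h.
by apply/orbit_pcE => //; [exact: s2valP (cid2 Ox)|exact: s2valP' (cid2 Ox)].
Qed.

Lemma orbit_inv_section g : G g -> O (pcG g) -> exists2 h : zmat C n -> zmat C n,
  mx_in (regular_at g) h /\ H (h g) & orbit_inv (pcG g) = pcH (h g) /\
  \forall y \near g, G y -> O (pcG y) -> H (h y) /\ orbit_inv (pcG y) = pcH (h y).
Proof.
have [GU _ GM GV] := gG; have [_ _ HM _] := gH.
move=> Gg Og; have Xg := orbit_sub Gg1 Xg1 Og; have [k Hk kg] := Og.
have [h rh nh] := orbit_section Gg Xg.
have E y : G y -> H (h y) -> pcG y = pcG (h y *m g) ->
    H (h y *m k) /\ orbit_inv (pcG y) = pcH (h y *m k).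
  move=> Gy Hhy ->; have Hhk := HM _ _ Hhy Hk; split => //.
  rewrite -orbit_invE // -mulmxA; congr orbit_inv.
  by apply: pcMl => //; [exact: HG|exact: hgG].
have [Hhg eg] := nbhs_singleton nh Gg Xg.
have r := regular_ring g; exists (fun y => h y *m k).
  split; last exact: HM.
  by apply: (mxinM r) => //; exact: (mxin_cst r).
split; first exact: (E g Gg Hhg eg).2.
apply: filterS nh => y nhy Gy Oy; have [Hhy ey] := nhy Gy (orbit_sub Gg1 Xg1 Oy).
exact: E.
Qed.

Lemma orbit_map_continuous : continuous orbit_map.
Proof.
have r := @polyfun_ring C n.
pose rg (x : zmat C n) : zmat C n := x *m g1.
have cr : continuous rg.
  by apply: poly_continuous; apply: (mxinM r) (mxin_cst r _); exact: mxin_id.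
apply/continuousP => A /sub_open[W oW WE]; apply: (open_pc (gG := gH)) => h Hh /= /WE.
rewrite orbit_map_pc // => Wh; have nW : \forall y \near h, G (rg y) -> W (pcG (rg y)) := cr h _ (near_pc oW (hgG Hh) Wh).
near=> y => Hy; apply/WE; rewrite orbit_map_pc //.
exact: (near nW y _ (hgG Hy)).
Unshelve. all: by end_near.
Qed.

(** Off the orbit the implication is void; the set is open there because the orbit is closed. *)
Lemma orbit_inv_open (V : set (coset_space H BS)) : open V ->
  open [set x | O x -> V (orbit_inv x)].
Proof.
move=> oV; apply: (open_pc (gG := gG)) => g Gg Vg.
have [Og|nO] := pselect (O (pcG g)); last first.
  have := near_pc (closed_openC (orbit_closed Gg1 Xg1)) Gg nO.
  by apply: filterS => y nOy Gy Oy; case: (nOy Gy).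
have [h [rh Hhg] [eg nh]] := orbit_inv_section Gg Og.
have {}Vg : V (pcH (h g)) by rewrite -eg; exact: Vg.
have nV : \forall y \near g, H (h y) -> V (pcH (h y)) := regular_continuous rh (near_pc oV Hhg Vg).
near=> y => Gy Oy; have [//|Hhy ->] := near nh y _ Gy Oy.
by apply: (near nV y).
Unshelve. all: by end_near.
Qed.

Lemma orbit_map_regular (V : set (sub_fspace O)) (f : sub_fspace O -> C) :
  open V -> fs_regular V f -> fs_regular (orbit_map @^-1` V) (f \o orbit_map).
Proof.
have r := @polyfun_ring C n.
move=> oV rf; have oP : open (orbit_map @^-1` V).
  by move/continuousP: orbit_map_continuous; apply.
apply/(regular_pc gH _ oP) => h Hh Vh.
have [U [k [oU Uh rk fk]]] := rf _ Vh.
rewrite orbit_map_pc // in Uh.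
have [Fk rF fF] := (regular_pc gG k oU).1 rk _ (hgG Hh) Uh.
have pr : mx_in (@polyfun C n) (fun x : zmat C n => x *m g1).
  by apply: (mxinM r) (mxin_cst r _); exact: mxin_id.
have nV := near_pc oP Hh Vh.
have nU : \forall y \near h, G (y *m g1) -> U (pcG (y *m g1)) :=
  poly_continuous pr (near_pc oU (hgG Hh) Uh).
have nF : \forall y \near h, G (y *m g1) -> k (pcG (y *m g1)) = Fk (y *m g1) :=
  poly_continuous pr fF.
exists (fun x : zmat C n => Fk (x *m g1)).
  apply: (regular_comp (F := fun x : zmat C n => x *m g1 : zmat C n)) => //.
  by move=> i j; apply: regular_poly; exact: pr.
near=> y => Hy /=; have Gy := hgG Hy.
rewrite fk; [|exact: (near nV y)|by rewrite orbit_map_pc //; exact: (near nU y _ Gy)].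
by rewrite orbit_map_pc //; exact: (near nF y _ Gy).
Unshelve. all: by end_near.
Qed.

(** Regularity on the orbit asks for a local extension to an open subset of the coset space. [F0]
    composed with [h] extends the function to matrices, but without being right [B]-invariant;
    [extend_at] repairs this. *)
Lemma orbit_inv_regular (V : set (coset_space H BS)) (f : coset_space H BS -> C) :
  open V -> fs_regular V f ->
  fs_regular ((orbit_inv \o val : sub_fspace O -> _) @^-1` V)
    (f \o (orbit_inv \o val : sub_fspace O -> _)).
Proof.
move=> oV rf x Vx; have Ox : O (val x) by exact: set_mem (valP x).
pose g := rp (val x); have Gg : G g by exact: rpG.
have gE : pcG g = val x by exact: rpK.
have Og : O (pcG g) by rewrite gE.
have [h [rh Hhg] [eg nh]] := orbit_inv_section Gg Og.
have Vhg : V (pcH (h g)) by rewrite -eg gE.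
have [F0 rF fF] := (regular_pc gH f oV).1 rf _ Hhg Vhg.
have nF : \forall y \near g, H (h y) -> f (pcH (h y)) = F0 (h y) := regular_continuous rh fF.
pose dom : set (zmat C n) := [set y | [/\ G y, O (pcG y) & V (orbit_inv (pcG y))]].
have [GU _ GM _] := gG.
have [[_ cB sB] _ _] := bB.
have [|||Om [Phi [oO Og' OB Or OE]]] := @extend_at C n B dom (fun y => f (orbit_inv (pcG y)))
    (fun y => F0 (h y)) g aB cB sB (GU _ Gg).
- by move=> y b [Gy Oy Vy] Bb; rewrite /dom /= pcMr //; split=> //; split=> //; exact: GM _ _ Gy (BG Bb).
- exact: (regular_comp (F := h) rh rF).
- near=> y => -[Gy Oy Vy]; have [//|Hhy ->] := near nh y _ Gy Oy.
  by apply: (near nF y).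
pose U : set (coset_space G B) := [set z | Om (rp z)].
have rpOm y : G y -> Om (rp (pcG y)) <-> Om y.
  move=> Gy; have [b Bb E] := rp_pc gG gB Gy; rewrite E; split; last by move=> /OB /(_ Bb)[].
  move=> /OB; have [_ _ _ BV] := gB => /(_ _ (BV _ Bb))[].
  by rewrite mulmxK //; have [BU _ _ _] := gB; exact: BU.
have oU : open U.
  apply: (open_pc (gG := gG)) => y Gy /(rpOm _ Gy) Oy.
  have : \forall z \near y, Om z by exact: open_nbhs_nbhs.
  by apply: filterS => z Oz Gz; apply/rpOm.
exists U, (fun z => Phi (rp z)); split=> //.
  apply/(regular_pc gG _ oU) => y Gy /(rpOm _ Gy) Oy; exists Phi; first exact: Or.
  have : \forall z \near y, Om z by exact: open_nbhs_nbhs.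
  apply: filterS => z Oz Gz; have [b Bb ->] := rp_pc gG gB Gz.
  by have [] := OB z b Oz Bb.
move=> y Vy Uy; have Oy : O (val y) by exact: set_mem (valP y).
rewrite -OE //=; first by rewrite rpK.
by split; [exact: rpG|rewrite rpK|rewrite rpK].
Unshelve. all: by end_near.
Qed.

Lemma orbit_map_equivariant : equivariant_isomorphism H orbit_map.
Proof.
have [HU _ HM HV] := gH; have [GU _ GM GV] := gG.
split; last first.
  move=> h x y Hh; rewrite -(rpK gH x) -(rpK gH y).
  have := rpG x; have := rpG y; move: (rp x) (rp y) => k l Hl Hk.
  rewrite (coset_pc gH gBS Hl) (coset_pc gH gBS Hk) translateM !orbit_map_pc // => E.
  have Hhk := HM _ _ Hh Hk.
  rewrite (coset_pc gG gB (hgG Hl)) (coset_pc gG gB (hgG Hk)) translateM mulmxA.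
  apply/translate_eq => //; [exact: GU (hgG Hl)|exact: GU (hgG Hhk)|].
  apply/(pcE gG gB (hgG Hl) (hgG Hhk)); apply/orbit_pcE => //.
  by apply/pcE => //; apply/translate_eq => //; exact: HU.
split; first by split; [exact: orbit_map_continuous|exact: orbit_map_regular].
exists (orbit_inv \o val); split.
- by move=> x /=; rewrite orbit_invE ?rpK //; exact: rpG.
- move=> y; apply: val_inj; have [h Hh hE] : O (val y) by exact: set_mem (valP y).
  have -> : (orbit_inv \o val) y = pcH h by rewrite /= -hE orbit_invE.
  by rewrite orbit_map_pc.
split; last exact: orbit_inv_regular.
apply/continuousP => V oV; apply/sub_open; exists [set x | O x -> V (orbit_inv x)].
  exact: orbit_inv_open.
by move=> y; split=> [Vy //|]; apply; exact: set_mem (valP y).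
Qed.

End OrbitIso.

End Components.

(** * Tori *)

Section Tori.
Context {C : numClosedFieldType}.

Definition torsion (x : C) := exists2 m, (0 < m)%N & x ^+ m = 1.

Lemma Xn_sub_1_split m : (0 < m)%N -> exists r : seq C, [/\ uniq r, size r = m,
  forall x, x \in r -> x ^+ m = 1 & 'X^m - 1 = \prod_(x <- r) ('X - x%:P)].
Proof.
move=> m0; have [r Hr] := closed_field_poly_normal ('X^m - 1 : {poly C}).
have mon : 'X^m - 1 \is @monic C by exact: monicXnsubC.
rewrite (monicP mon) scale1r in Hr; exists r; split=> //.
- rewrite -separable_prod_XsubC -Hr; apply: separable_Xn_sub_1.
  by rewrite pnatr_eq0 -lt0n.
- by have := congr1 (fun p : {poly C} => size p) Hr; rewrite size_XnsubC // size_prod_XsubC => -[].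
- move=> x xr; have : root ('X^m - 1) x by rewrite Hr root_prod_XsubC.
  by rewrite /root hornerD hornerN hornerC hornerXn subr_eq0 => /eqP.
Qed.

Lemma torsion_dense1 (p : {poly C}) : (forall x, torsion x -> p.[x] = 0) -> p = 0.
Proof.
move=> H; apply/eqP/negPn/negP => p0; have m0 : (0 < size p)%N by rewrite size_poly_gt0.
(* With [m = size p] there are [m] roots of unity, one more than the degree of [p]. *)
have [r [ur sr rr _]] := Xn_sub_1_split m0.
have : (size r < size p)%N.
  apply: max_poly_roots => //; apply/allP => x xr; apply/rootP/H; exists (size p) => //.
  exact: rr.
by rewrite sr ltnn.
Qed.

(** Coordinates are freed one at a time: with the others fixed, [f] is a polynomial in one variable
    that vanishes at all roots of unity. *)
Lemma torsion_dense r (V : set (zmat C r)) : closed V ->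
  (forall d : 'rV[C]_r, (forall i, torsion (d 0 i)) -> V (dmx d)) -> forall d, V (dmx d).
Proof.
move=> cV Vt d; apply: contrapT => /(closed_sep cV)[f pf [fV]]; apply/negP; rewrite negbK.
suff H k (e : 'rV[C]_r) : (forall i : 'I_r, (k <= i)%N -> torsion (e 0 i)) -> f (dmx e) = 0.
  by apply/eqP/(H r d) => i; rewrite leqNgt ltn_ord.
elim: k e => [|k IH] e He; first by apply: fV; apply: Vt => i; exact: He.
have [rk|kr] := leqP r k.
  by apply: IH => i ki; have := ltn_ord i; rewrite ltnNge (leq_trans rk ki).
pose ev (t : C) : 'rV[C]_r := \row_i (if i == Ordinal kr then t else e 0 i).
have pev : mx_in poly1 (fun t => dmx (ev t)).
  move=> i j; have r1 := @poly1_ring C.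
  have [->|ij] := eqVneq i j.
    have -> : (fun t => dmx (ev t) j j) = (fun t => if j == Ordinal kr then t else e 0 j).
      by apply/funext => t; rewrite dmx_diag mxE.
    by case: (j == _); [exact: poly1_id|exact: (frC r1)].
  have -> : (fun t => dmx (ev t) i j) = (fun=> 0).
    by apply/funext => t; rewrite mxE (negbTE ij) mulr0n.
  exact: (frC r1).
have [q Hq] := fr_polyfun poly1_ring pev pf.
have q0 : q = 0.
  apply: torsion_dense1 => t tt; rewrite -Hq; apply: IH => i ki; rewrite mxE.
  case: eqVneq => [//|ik]; apply: He; rewrite ltn_neqAle ki andbT.
  by apply: contraNneq ik => ki'; apply/eqP/val_inj.
rewrite (_ : e = ev (e 0 (Ordinal kr))); first by rewrite Hq q0 horner0.
by apply/rowP => i; rewrite mxE; case: eqVneq => [->|].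
Qed.

Lemma torsion_diagble n (x : zmat C n) m : (0 < m)%N -> mxpow (x : 'M_n) m = 1%:M -> diagble x.
Proof.
case: n x => [|n] x m0 xm; first by exists 1%:M; rewrite ?unitmx1 //; apply/is_diag_mxP => -[].
have [r [ur _ _ rE]] := Xn_sub_1_split m0.
have [|P Pu] := (diagonalizableP (x : 'M_n.+1)).2.
  exists r => //; rewrite -rE; apply: mxminpoly_min.
  rewrite rmorphB rmorphXn rmorph1 /= horner_mx_X.
  have -> : (x : 'M_n.+1) ^+ m = mxpow (x : 'M_n.+1) m by elim: (m) => //= k <-; rewrite exprS.
  by rewrite xm subrr.
rewrite /similar_to conjumx // => dP.
by exists (invmx P); rewrite ?unitmx_inv // invmxK.
Qed.

(** An infinite family is reduced to a finite list of its elements whose span has maximal dimension,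
    hence contains the family. *)
Lemma simultaneous_diag n (D : set (zmat C n)) : comm_diag D ->
  exists2 w : zmat C n, (w : 'M_n) \in unitmx & forall s, D s -> is_diag_mx (invmx w *m s *m w).
Proof.
move=> [Dc Dd].
pose sp (k : nat) := `[< exists2 X : seq 'M[C]_n, (forall x, x \in X -> D x) & \dim <<X>> = k >].
have ex : exists k, sp k by exists (\dim <<[::] : seq 'M[C]_n>>); apply/asboolP; exists [::].
have bd k : sp k -> (k <= \dim (@fullv C 'M[C]_n))%N.
  by move=> /asboolP[X _ <-]; exact: dimvS (subvf _).
have [k /asboolP[X XD Xk] kmax] := ex_maxnP ex bd.
have Dsp s : D s -> (s : 'M_n) \in <<X>>%VS.
  move=> Ds; have sub : (<<X>> <= <<(s : 'M_n) :: X>>)%VS by rewrite span_cons addvSr.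
  have /kmax : sp (\dim <<(s : 'M_n) :: X>>).
    by apply/asboolP; exists ((s : 'M_n) :: X) => // x; rewrite inE => /orP[/eqP->|/XD].
  rewrite -Xk => le; have /eqP -> : <<X>>%VS == <<(s : 'M_n) :: X>>%VS.
    by rewrite eqEdim sub.
  by rewrite span_cons; exact: subvP (addvSl _ _) _ (memv_line _).
have : codiagonalizable X.
  apply/codiagonalizableP; split=> [x y /XD Dx /XD Dy|x /XD /Dd[p pu dp]].
    exact: Dc.
  exists (invmx p); rewrite ?unitmx_inv // /similar_to conjumx ?unitmx_inv //.
  by rewrite invmxK.
move=> [P Pu /allP PX]; exists (invmx P); rewrite ?unitmx_inv // => s Ds; rewrite invmxK.
have : P *m s *m invmx P = \sum_(i < size X) coord (in_tuple X) i s *: (P *m X`_i *m invmx P).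
  rewrite {1}(coord_span (X := in_tuple X) (Dsp s Ds)) mulmx_sumr mulmx_suml.
  by apply: eq_bigr => i _; rewrite -scalemxAr -scalemxAl.
move=> ->; apply/is_diag_mxP => a b ab; rewrite summxE big1 // => i _.
have := PX _ (mem_nth 0 (ltn_ord i)); rewrite /= /similar_to conjumx // => /is_diag_mxP dX.
by rewrite mxE dX ?mulr0.
Qed.

(** The isomorphism with a diagonal group is abstract and does not carry diagonalizability, but it
    carries finite order, from which diagonalizability follows. The torsion elements share one
    diagonalizing basis. *)
Lemma torus_comm_diag n (T : set (zmat C n)) : torus T -> comm_diag T.
Proof.
move=> [[gT cT] [r [phi [[[_ _] [psi [phiK psiK [cpsi _]]]] phiM]]]].
have [TU T1 TM TV] := gT.
have TP (a : group_fspace T) : T (val a) by exact: set_mem (valP a).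
have Dg (a : group_fspace T) : @diagonal_group C r (val (phi a)) by exact: set_mem (valP (phi a)).
pose mk := in_group gT.
have mkK x : T x -> val (mk x) = x by exact: in_groupK.
have dE (a : group_fspace T) : val (phi a) = dmx (\row_i (val (phi a)) i i).
  by have [da _] := Dg a; rewrite {1}[val (phi a)]is_diag_dmx.
have comm s t : T s -> T t -> s *m t = t *m s.
  move=> Ts Tt; have Tst := TM _ _ Ts Tt; have Tts := TM _ _ Tt Ts.
  suff E : mk (s *m t) = mk (t *m s).
    exact: etrans (esym (mkK _ Tst)) (etrans (congr1 val E) (mkK _ Tts)).
  apply: (can_inj phiK); apply: val_inj.
  have E1 := phiM (mk s) (mk t) (mk (s *m t)).
  have E2 := phiM (mk t) (mk s) (mk (t *m s)).
  rewrite (mkK _ Ts) (mkK _ Tt) in E1 E2; rewrite (E1 (mkK _ Tst)) (E2 (mkK _ Tts)).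
  by rewrite (dE (mk s)) (dE (mk t)); exact: dmxC.
have pw_phi (a : group_fspace T) k : exists b : group_fspace T,
    val b = mxpow (val a : 'M_n) k /\ val (phi b) = mxpow (val (phi a) : 'M_r) k.
  elim: k => [|k [b [b1 b2]]].
    exists (mk 1%:M); split; first by rewrite mkK.
    have [_ u] := Dg (mk 1%:M).
    have := phiM (mk 1%:M) (mk 1%:M) (mk 1%:M); rewrite mkK // mulmx1 => /(_ erefl).
    by move=> /(congr1 (mulmx (invmx (val (phi (mk 1%:M)))))); rewrite mulKmx // mulVmx // => <-.
  exists (mk (val a *m val b)); have Tab := TM _ _ (TP a) (TP b).
  split; first by rewrite mkK //= b1.
  by rewrite (phiM a b) ?mkK //= b2.
have tors (a : group_fspace T) m : mxpow (val (phi a) : 'M_r) m = 1%:M -> mxpow (val a : 'M_n) m = 1%:M.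
  move=> am; have [b [<- b2]] := pw_phi a m; have [c [c1 c2]] := pw_phi a 0.
  suff -> : b = c by [].
  by apply: (can_inj phiK); apply: val_inj; rewrite b2 am c2.
pose Tt : set (zmat C n) := [set x | T x /\ exists2 m, (0 < m)%N & mxpow (x : 'M_n) m = 1%:M].
have [|w wu dw] := @simultaneous_diag n Tt.
  split; first by move=> s t [Ts _] [Tt' _]; exact: comm.
  by move=> s [_ [m m0 sm]]; exact: torsion_diagble sm.
split=> // t Tt'; exists w => //.
pose Z := [set x : zmat C n | is_diag_mx (invmx w *m x *m w)].
have cZ : closed Z.
  rewrite (_ : Z = [set x | forall ij : {ij : 'I_n * 'I_n | ij.1 != ij.2 :> nat},
      (invmx w *m x *m w) (sval ij).1 (sval ij).2 = 0]).
    by apply: closed_all => ij; apply: closed_zero; exact: mxin_sandwich.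
  apply/seteqP; split=> x /=; first by move=> /is_diag_mxP H [[i j] /= ij]; exact: H.
  by move=> H; apply/is_diag_mxP => i j ij; exact: (H (exist _ (i, j) ij)).
(* Being diagonal in the basis [w] is a closed condition; pulled back along the continuous [psi], it
   spreads from the torsion points of the diagonal group to all of it. *)
have : closed ((val \o psi) @^-1` Z).
  apply: closed_comp cZ => x _; apply: continuous_comp; first exact: cpsi.
  exact: initial_continuous.
move=> /closed_openC[V oV VE].
have VP (b : group_fspace (@diagonal_group C r)) : V (val b) <-> ~ Z (val (psi b)).
  by move: VE => /seteqP[/(_ b) V1 /(_ b) V2]; split.
have key d : (~` V) (dmx d) -> forall a, val (phi a) = dmx d -> Z (val a).
  by move=> nV a ad; apply: contrapT => nZ; apply: nV; rewrite -ad; apply/VP; rewrite phiK.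
suff /key : (~` V) (dmx (\row_i (val (phi (mk t))) i i)) by move=> /(_ (mk t) (dE _)); rewrite /Z /= mkK.
apply: torsion_dense; first exact: open_closedC.
move=> d dt Vd.
have du : @diagonal_group C r (dmx d).
  split; first exact: diag_mx_is_diag.
  rewrite unitmxE unitfE det_diag; apply/prodf_neq0 => i _.
  have [m m0 dm] := dt i; apply: contraTneq isT => d0.
  by move/eqP: dm; rewrite d0 expr0n gtn_eqF // eq_sym oner_eq0.
pose b : group_fspace (@diagonal_group C r) := exist _ (dmx d) (mem_set du).
have := (VP b).1 Vd; apply; apply: dw; split; first exact: TP.
have /choice[m Hm] : forall i, exists m, (0 < m)%N /\ d 0 i ^+ m = 1.
  by move=> i; have [m m0 dm] := dt i; exists m.
exists (\prod_i m i)%N; first by apply: prodn_gt0 => i; have [] := Hm i.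
apply: tors; rewrite psiK /= mxpow_dmx; apply/matrixP => i j; rewrite !mxE.
case: eqVneq => // _; rewrite !mulr1n (bigD1 i) //= exprM.
by have [_ ->] := Hm i; rewrite expr1n.
Qed.

End Tori.

Lemma krull_dim_homeo (R : realType) (X Y : topologicalType) (f : X -> Y) (g : Y -> X) :
  continuous f -> continuous g -> cancel f g -> cancel g f ->
  krull_dim R X = krull_dim R Y.
Proof.
have sub (X' Y' : topologicalType) (f' : X' -> Y') (g' : Y' -> X') :
    continuous f' -> continuous g' -> cancel f' g' -> cancel g' f' ->
    (krull_dim R X' <= krull_dim R Y')%E.
  move=> cf cg fK gK; apply: le_ereal_sup => _ [k [F [Fc Fs]] <-]; exists k => //.
  exists (fun i => g' @^-1` (F i)); split=> i ik; last first.
    have [s1 s2] := Fs i ik; split; first by move=> y; exact: s1.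
    by apply: contra_not s2 => H x Fx; have := H (f' x); rewrite /= fK; apply.
  have [cF [[x Fx] irr]] := Fc i ik; split.
    by apply: closed_comp cF => y _; exact: cg.
  split; first by exists (f' x); rewrite /= fK.
  move=> A B cA cB AB.
  have [|||H|H] := irr (f' @^-1` A) (f' @^-1` B).
  - by apply: closed_comp cA => y _; exact: cf.
  - by apply: closed_comp cB => y _; exact: cf.
  - by move=> y Fy; apply: AB; rewrite /= fK.
  - by left=> y /H; rewrite /= gK.
  - by right=> y /H; rewrite /= gK.
by move=> cf cg fK gK; apply/le_anti/andP; split; [exact: sub cf cg fK gK|exact: sub cg cf gK fK].
Qed.

Theorem corollary2p2 (R : realType) (n : nat) (G B T S : set (zmat R[i] n))
  (GS0 := identity_component (fixed_subgroup S G))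
  (BS := fixed_subgroup S B)
  (XBS := fixed_points (G := G) (B := B) S) :
  connected G -> reductive G ->
  maximal_torus G T -> borel G B -> T `<=` B ->
  matrix_subgroup S -> S `<=` T ->
  (forall C, is_component XBS C ->
     exists phi : coset_space GS0 BS -> sub_fspace C,
       equivariant_isomorphism GS0 phi) /\
  (forall C D, is_component XBS C -> is_component XBS D ->
     krull_dim R (sub_fspace C) = krull_dim R (sub_fspace D)).
Proof.
move=> _ [aG _] [tT _ _] bB TB _ ST.
have bfp : borel_property R[i] by exact: borel_fixed_point.
have SB : S `<=` B by exact: subset_trans TB.
have dS : comm_diag S.
  have [Tc Td] := torus_comm_diag tT.
  by split=> [s t /ST Ts /ST Tt|s /ST Ts]; [exact: Tc|exact: Td].
have iso C : is_component XBS C -> exists phi : coset_space GS0 BS -> sub_fspace C,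
    equivariant_isomorphism GS0 phi.
  move=> [x Xx ->]; rewrite -(rpK aG.1 x) in Xx *.
  have [g [Gg Xg Og st]] := orbit_base bfp bB SB dS (rpG x) Xx.
  rewrite (orbit_component bfp bB SB dS (rpG x) Xx) -Og.
  exact: ex_intro (orbit_map_equivariant bfp bB SB dS Gg Xg st).
split=> // C D /iso[f [[[cf _] [f' [fK f'K [cf' _]]]] _]] /iso[h [[[ch _] [h' [hK h'K [ch' _]]]] _]].
by rewrite -(krull_dim_homeo R cf cf' fK f'K) -(krull_dim_homeo R ch ch' hK h'K).
Qed.
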